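(* Let $N\ge 2$, let $\Omega\subset\mathbb{R}^2$ be a domain, $\Gamma_1,\dots,\Gamma_N\in\mathbb{R}\setminus\{0\}$, let $g\in C^4(\Omega\times\Omega)$ satisfy $g(x,y)=g(y,x)$ for all $x,y\in\Omega$, let $a_0\in\Omega$ be a nondegenerate critical point of $h(x)=g(x,x)$, and let $Z(t)$ be a $2\pi$-periodic LRE-stable relative equilibrium of the whole-plane system $M_{\vec\Gamma}\dot z=J_N\nabla H_{\mathbb{R}^2}(z)$. Let $(z^{(r)})_{r\in(0,r_0)}$ be the family of $2\pi r^2$-periodic solutions of $M_{\vec\Gamma}\dot z=J_N\nabla H(z)$ induced by $a_0$ and $Z$ (see context). (a) If $a_0$ is a saddle point of $h$, then $z^{(r)}$ is spectrally unstable for all sufficiently small $r>0$. (b) If $h$ has a local minimum or a local maximum at $a_0$, then $z^{(r)}$ is L-stable for all sufficiently small $r>0$.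
   Context: Notation. $\mathcal F_N(\Omega)=\{z=(z_1,\dots,z_N)\in\Omega^N: z_j\ne z_k\text{ for }j\ne k\}\subset\mathbb{R}^{2N}$. $M_{\vec\Gamma}=\mathrm{diag}(\Gamma_1,\Gamma_1,\dots,\Gamma_N,\Gamma_N)\in\mathbb{R}^{2N\times2N}$; $J\in\mathbb{R}^{2\times2}$ is rotation by $-\pi/2$; $J_N=\mathrm{diag}(J,\dots,J)\in\mathbb{R}^{2N\times 2N}$; $\Gamma=\sum_j\Gamma_j$. $D=\{\hat a=(a,\dots,a)\in\mathbb{R}^{2N}:a\in\mathbb{R}^2\}$. Hamiltonians. $G(x,y)=-\frac1{2\pi}\log|x-y|-g(x,y)$, $h(x)=g(x,x)$, and $H:\mathcal F_N(\Omega)\to\mathbb{R}$, $H(z)=\sum_{j\ne k}\Gamma_j\Gamma_kG(z_k,z_j)-\sum_{j}\Gamma_j^2h(z_j)$ (first sum over ordered pairs). $H_{\mathbb{R}^2}:\mathcal F_N(\mathbb{R}^2)\to\mathbb{R}$, $H_{\mathbb{R}^2}(z)=-\frac1{2\pi}\sum_{j\neq k}\Gamma_j\Gamma_k\log|z_j-z_k|$. Relative equilibria. A $2\pi$-periodic relative equilibrium is a solution of the whole-plane system of the form $Z(t)=e^{-\nu J_Nt}z_0$ with $z_0\in\mathcal F_N(\mathbb{R}^2)$, normalized (by rescaling) so that $\nu\in\{1,-1\}$. Floquet multipliers. For a $T$-periodic solution of one of these systems they are the eigenvalues of $X(T)$, where $X(t)$ is the fundamental solution, $X(0)=\mathrm{id}$,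 of the linearization along the solution (for the whole-plane system: $M_{\vec\Gamma}\dot v=J_N\nabla^2H_{\mathbb{R}^2}(Z(t))v$, $T=2\pi$). Stability notions. A periodic solution of a Hamiltonian system is spectrally stable if all its Floquet multipliers lie on the unit circle $S^1\subset\mathbb{C}$, otherwise spectrally unstable. It is L-stable if it is spectrally stable, the multiplier $1$ has algebraic multiplicity $2$, and the remaining multipliers are all simple (in particular $-1$ is not a multiplier). A relative equilibrium $Z$ is nondegenerate if the multiplier $1$ has geometric multiplicity $3$; algebraic nondegenerate if in addition $1$ has algebraic multiplicity $4$; LRE-stable if it is spectrally stable, algebraic nondegenerate, and the remaining multipliers are all simple (in particular different from $-1$). (Algebraic nondegeneracy forces $\Gamma\neq0$.) Induced solutions. Let $g\in C^m$, $m\ge2$, $\Gamma\ne0$, $a_0$ a nondegenerate critical point of $h$ and $Z$ a nondegenerate $2\pi$-periodic relative equilibrium. A known existence theorem provides $r_0>0$ and a family $(z^{(r)})_{r\in(0,r_0)}$ of $2\pi r^2$-periodic solutions of $M_{\vec\Gamma}\dot z=J_N\nabla H(z)$ with $z^{(r)}(t)=a_0+rZ(t/r^2)+o(r)$ uniformly in $t$ as $r\to0$ and $(r,t)\mapsto z^{(r)}(t)$ of class $C^{m-1}$. In rescaled form $z^{(r)}(t)=a_0+ru^{(r)}(t/r^2)$, where, with $u^{(0)}=Z$, the map $[0,r_0)\ni r\mapsto u^{(r)}\in H^1(\mathbb{R}/2\pi\mathbb{Z},\mathbb{R}^{2N})$ is of class $C^{m-2}$, it is of class $C^{m-1}$ on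 $(0,r_0)$, and, if $m\ge3$, $\partial_ru^{(r)}|_{r=0}\in D$ (a constant function). This is the family induced by $a_0$ and $Z$. *)

(* Defs.v *)
From HB Require Import structures.
From mathcomp Require Import all_boot all_order all_algebra.
From mathcomp Require Import all_classical all_reals all_analysis.
From mathcomp Require Import complex.
Set Implicit Arguments.
Unset Strict Implicit.
Unset Printing Implicit Defensive.
Import Order.TTheory GRing.Theory Num.Theory.
Import numFieldNormedType.Exports.
Local Open Scope classical_set_scope.
Local Open Scope ring_scope.

(* The norm of the library on matrices is the sup norm, whence this one. *)
Definition enorm (R : realType) (n : nat) (v : 'cV[R]_n) : R :=
  Num.sqrt (\sum_(i < n) v i 0 ^+ 2).

Definition gradient (R : realType) (n : nat) (f : 'cV[R]_n -> R)
    (x : 'cV[R]_n) : 'cV[R]_n :=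
  \col_(i < n) 'D_(delta_mx i 0) f x.

Definition hessian (R : realType) (n : nat) (f : 'cV[R]_n -> R)
    (x : 'cV[R]_n) : 'M[R]_n :=
  \matrix_(i < n, j < n) 'D_(delta_mx i 0) ('D_(delta_mx j 0) f) x.

(* Class C^k on the open set U; the values of f outside U are irrelevant. *)
Fixpoint Ck_on (R : realType) (V W : normedModType R) (k : nat) (U : set V)
    (f : V -> W) : Prop :=
  (forall x, U x -> {for x, continuous f}) /\
  (if k is k'.+1 then
     forall v : V, (forall x, U x -> derivable f x v) /\ Ck_on k' U ('D_v f)
   else True).

Definition nondegenerate_critical_point (R : realType) (n : nat)
    (f : 'cV[R]_n -> R) (a : 'cV[R]_n) : Prop :=
  gradient f a = 0 /\ \det (hessian f a) != 0.

Definition local_minimum (R : realType) (n : nat) (f : 'cV[R]_n -> R)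
    (a : 'cV[R]_n) : Prop :=
  \forall x \near a, f a <= f x.

Definition local_maximum (R : realType) (n : nat) (f : 'cV[R]_n -> R)
    (a : 'cV[R]_n) : Prop :=
  \forall x \near a, f x <= f a.

Definition saddle_point (R : realType) (n : nat) (f : 'cV[R]_n -> R)
    (a : 'cV[R]_n) : Prop :=
  [/\ gradient f a = 0, ~ local_minimum f a & ~ local_maximum f a].

(* The exponential series, summed entrywise. *)
Definition expmx (R : realType) (n : nat) (A : 'M[R]_n) : 'M[R]_n :=
  \matrix_(i < n, j < n)
    limn (series (fun k : nat => (k`!%:R)^-1 * (A ^+ k) i j)).

(* Phase space: R^(2N) is 'cV_(N * 2), and the coordinate k : 'I_2 of the     *)
(* vortex j : 'I_N has the index mxvec_index j k, that is, 2 * j + k.         *)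
Definition vortex (R : realType) (N : nat) (z : 'cV[R]_(N * 2)) (j : 'I_N) :
    'cV[R]_2 :=
  \col_(k < 2) z (mxvec_index j k) 0.

Definition hat (R : realType) (N : nat) (a : 'cV[R]_2) : 'cV[R]_(N * 2) :=
  (mxvec (\matrix_(j < N, k < 2) a k 0))^T.

Definition config (R : realType) (N : nat) (Omega : set 'cV[R]_2) :
    set 'cV[R]_(N * 2) :=
  [set z | (forall j, Omega (vortex z j)) /\
           (forall j k, j != k -> vortex z j <> vortex z k)].

Definition vorticity_mx (R : realType) (N : nat) (Gamma : 'I_N -> R) :
    'M[R]_(N * 2) :=
  diag_mx (mxvec (\matrix_(j < N, k < 2) Gamma j)).

(* Rotation by - pi / 2: (x, y) |-> (y, - x). *)
Definition J2 (R : realType) : 'M[R]_2 := delta_mx 0 1 - delta_mx 1 0.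

Definition JN (R : realType) (N : nat) : 'M[R]_(N * 2) :=
  \sum_(j < N) \sum_(k < 2) \sum_(l < 2)
    J2 R k l *: delta_mx (mxvec_index j k) (mxvec_index j l).

Definition green (R : realType) (g : 'cV[R]_2 -> 'cV[R]_2 -> R)
    (x y : 'cV[R]_2) : R :=
  - (2 * pi)^-1 * ln (enorm (x - y)) - g x y.

Definition robin (R : realType) (g : 'cV[R]_2 -> 'cV[R]_2 -> R)
    (x : 'cV[R]_2) : R := g x x.

Definition hamiltonian (R : realType) (N : nat) (Gamma : 'I_N -> R)
    (g : 'cV[R]_2 -> 'cV[R]_2 -> R) (z : 'cV[R]_(N * 2)) : R :=
  \sum_(j < N) \sum_(k < N | k != j)
     Gamma j * Gamma k * green g (vortex z k) (vortex z j)
  - \sum_(j < N) Gamma j ^+ 2 * robin g (vortex z j).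

Definition hamiltonian_plane (R : realType) (N : nat) (Gamma : 'I_N -> R)
    (z : 'cV[R]_(N * 2)) : R :=
  - (2 * pi)^-1 * \sum_(j < N) \sum_(k < N | k != j)
     Gamma j * Gamma k * ln (enorm (vortex z j - vortex z k)).

Definition solution (R : realType) (N : nat) (Gamma : 'I_N -> R)
    (Omega : set 'cV[R]_2) (H : 'cV[R]_(N * 2) -> R)
    (z : R -> 'cV[R]_(N * 2)) : Prop :=
  forall t, [/\ config Omega (z t), derivable z t 1 &
    vorticity_mx Gamma *m derive1 z t = JN R N *m gradient H (z t)].

Definition relative_equilibrium (R : realType) (N : nat) (Gamma : 'I_N -> R)
    (Z : R -> 'cV[R]_(N * 2)) : Prop :=
  solution Gamma setT (hamiltonian_plane Gamma) Z /\
  exists nu : R, exists z0 : 'cV[R]_(N * 2),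
    [/\ nu = 1 \/ nu = - 1, config setT z0 &
        forall t, Z t = expmx (- (nu * t) *: JN R N) *m z0].

Definition fundamental_solution (R : realType) (N : nat) (Gamma : 'I_N -> R)
    (H : 'cV[R]_(N * 2) -> R) (z : R -> 'cV[R]_(N * 2))
    (X : R -> 'M[R]_(N * 2)) : Prop :=
  X 0 = 1%:M /\
  forall t, derivable X t 1 /\
    vorticity_mx Gamma *m derive1 X t = JN R N *m hessian H (z t) *m X t.

(* P is X(T), complexified: its eigenvalues are the Floquet multipliers of    *)
(* the T-periodic solution z, and there is exactly one P. Quantifying         *)
(* existentially over P below makes no stability notion hold vacuously.       *)
Definition monodromy (R : realType) (N : nat) (Gamma : 'I_N -> R)
    (H : 'cV[R]_(N * 2) -> R) (z : R -> 'cV[R]_(N * 2)) (T : R)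
    (P : 'M[complex R]_(N * 2)) : Prop :=
  exists2 X : R -> 'M[R]_(N * 2), fundamental_solution Gamma H z X &
    P = map_mx (real_complex R) (X T).

Definition spectrum_on_circle (R : realType) (n : nat)
    (P : 'M[complex R]_n) : Prop :=
  forall l, eigenvalue P l -> `|l| = 1.

(* eigenspace is made of row vectors, which does not affect its dimension.   *)
Definition geometric_multiplicity (R : realType) (n : nat)
    (P : 'M[complex R]_n) (l : complex R) : nat := \rank (eigenspace P l).

Definition algebraic_multiplicity (R : realType) (n : nat)
    (P : 'M[complex R]_n) (l : complex R) : nat := mup l (char_poly P).

Definition other_multipliers_simple (R : realType) (n : nat)
    (P : 'M[complex R]_n) : Prop :=
  forall l, eigenvalue P l -> l != 1 -> algebraic_multiplicity P l = 1%N.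

Definition spectrally_unstable (R : realType) (N : nat) (Gamma : 'I_N -> R)
    (H : 'cV[R]_(N * 2) -> R) (z : R -> 'cV[R]_(N * 2)) (T : R) : Prop :=
  exists2 P, monodromy Gamma H z T P & ~ spectrum_on_circle P.

(* That - 1 is not a multiplier follows, here and for LRE-stability: P is     *)
(* symplectic, so that - 1 cannot have multiplicity one.                      *)
Definition L_stable (R : realType) (N : nat) (Gamma : 'I_N -> R)
    (H : 'cV[R]_(N * 2) -> R) (z : R -> 'cV[R]_(N * 2)) (T : R) : Prop :=
  exists2 P, monodromy Gamma H z T P &
    [/\ spectrum_on_circle P, algebraic_multiplicity P 1 = 2%N &
        other_multipliers_simple P].

Definition LRE_stable (R : realType) (N : nat) (Gamma : 'I_N -> R)
    (Z : R -> 'cV[R]_(N * 2)) : Prop :=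
  exists2 P, monodromy Gamma (hamiltonian_plane Gamma) Z (2 * pi) P &
    [/\ spectrum_on_circle P, geometric_multiplicity P 1 = 3%N,
        algebraic_multiplicity P 1 = 4%N & other_multipliers_simple P].

(* H^1(R / 2 pi Z, R^n), represented by actual (absolutely continuous)        *)
(* functions u with a square integrable weak derivative v.                    *)
Definition weak_derivative (R : realType) (n : nat) (u v : R -> 'cV[R]_n) :
    Prop :=
  [/\ periodic u (2 * pi), periodic v (2 * pi) &
    forall i : 'I_n,
      [/\ measurable_fun setT (fun t => v t i 0),
          (\int[lebesgue_measure]_(t in `[0%R, (2 * pi)%R]) ((v t i 0) ^+ 2)%:E
             < +oo)%E &
          forall s t, s <= t -> u t i 0 - u s i 0 =
            (\int[lebesgue_measure]_(x in `[s, t]) v x i 0)%R]].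

Definition H1 (R : realType) (n : nat) (u : R -> 'cV[R]_n) : Prop :=
  exists v, weak_derivative u v.

(* v is determined almost everywhere by u, so that the choice is harmless;    *)
(* only meaningful if H1 u.                                                   *)
Definition H1_norm (R : realType) (n : nat) (u : R -> 'cV[R]_n) : R :=
  let v := xget (fun=> 0) [set v | weak_derivative u v] in
  Num.sqrt (\int[lebesgue_measure]_(t in `[0, 2 * pi])
              (enorm (u t) ^+ 2 + enorm (v t) ^+ 2))%R.

(* Derivative in H^1 at r, relative to the interval I (hence one-sided at an  *)
(* endpoint of I).                                                            *)
Definition H1_derivative (R : realType) (n : nat) (I : set R)
    (f : R -> R -> 'cV[R]_n) (r : R) (f' : R -> 'cV[R]_n) : Prop :=
  H1 f' /\
  H1_norm (fun t => h^-1 *: (f (r + h) t - f r t) - f' t)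
    @[h --> within [set h | I (r + h)] (dnbhs (0 : R))] --> (0 : R).

Fixpoint H1_Ck_on (R : realType) (n : nat) (k : nat) (I : set R)
    (f : R -> R -> 'cV[R]_n) : Prop :=
  [/\ forall r, I r -> H1 (f r),
      forall r, I r ->
        H1_norm (fun t => f s t - f r t) @[s --> within I (nbhs r)]
          --> (0 : R) &
      if k is k'.+1 then
        exists2 f' : R -> R -> 'cV[R]_n,
          forall r, I r -> H1_derivative I f r (f' r) & H1_Ck_on k' I f'
      else True].

(* The u with z r t = hat a0 + r u(t / r^2), extended by Z to r = 0. *)
Definition rescaled (R : realType) (N : nat) (a0 : 'cV[R]_2)
    (Z : R -> 'cV[R]_(N * 2)) (z : R -> R -> 'cV[R]_(N * 2)) (r s : R) :
    'cV[R]_(N * 2) :=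
  if r == 0 then Z s else r^-1 *: (z r (r ^+ 2 * s) - hat N a0).

Definition induced_family (R : realType) (N m : nat) (Gamma : 'I_N -> R)
    (Omega : set 'cV[R]_2) (g : 'cV[R]_2 -> 'cV[R]_2 -> R) (a0 : 'cV[R]_2)
    (Z : R -> 'cV[R]_(N * 2)) (r0 : R) (z : R -> R -> 'cV[R]_(N * 2)) :
    Prop :=
  0 < r0 /\
  (forall r, 0 < r < r0 ->
     solution Gamma Omega (hamiltonian Gamma g) (z r) /\
     periodic (z r) (2 * pi * r ^+ 2)) /\
  (forall e : R, 0 < e -> \forall r \near 0^'+, forall t,
     enorm (z r t - (hat N a0 + r *: Z (t / r ^+ 2))) <= e * r) /\
  Ck_on m.-1 [set p : R * R | 0 < p.1 < r0] (fun p => z p.1 p.2) /\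
  H1_Ck_on (m - 2) `[0, r0[ (rescaled a0 Z z) /\
  H1_Ck_on m.-1 `]0, r0[ (rescaled a0 Z z) /\
  ((3 <= m)%N -> exists a : 'cV[R]_2,
     H1_derivative `[0, r0[ (rescaled a0 Z z) 0 (fun=> hat N a)).

(* Main.v *)
Require Import Defs.
From HB Require Import structures.
From mathcomp Require Import all_boot all_order all_algebra.
From mathcomp Require Import all_classical all_reals all_analysis.
From mathcomp Require Import complex zify ring lra.
Set Implicit Arguments.
Unset Strict Implicit.
Unset Printing Implicit Defensive.
Import Order.TTheory GRing.Theory Num.Theory.
Import numFieldNormedType.Exports.
Local Open Scope classical_set_scope.
Local Open Scope ring_scope.

(** Blow up the family at a0: u_r(s) = (z_r(r^2 s) - a0) / r converges to Z,
    uniformly on a period. The logarithmic kernel is invariant under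
    translations and changes by a constant under scalings, so that r^2 times
    the Hessian of H along z_r is the Hessian of the plane Hamiltonian along
    u_r, minus r^2 times the Hessian of the regular part
    Phi(z) = sum_(j, k) Gamma_j Gamma_k g(z_k, z_j)  (rescaled_hessianE). By
    continuous dependence on the generator (flow_cvg), the monodromy matrices
    X_r of z_r converge to the monodromy matrix X_0 of Z. All of them are
    symplectic for W = J_N M. The multiplier 1 of X_0 has multiplicity four,
    and its other multipliers are simple and lie on the circle, hence stay
    there; the question is how the four multipliers at 1 split.

    Two of them stay at 1, since X_r fixes the velocity of z_r. The other two
    belong to the center of vorticity L, the average of the vortices weighted
    by their strengths. The plane flow conserves it, and translations D are
    dual to it: L X_0 = L, X_0 D = D and L D = 1. To leading order the drift of
    L is caused by the Robin function alone (momentum_drift_cvg):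
    r^-2 L (X_r - 1) converges to B L, where B = - 2 pi Gamma J h''(a0) and
    Gamma is the total vorticity. So det B has the sign of det h''(a0), which
    is negative at a saddle and positive at an extremum.

    Passing from B to the multipliers does not require to follow a degenerate
    Jordan block. Characteristic polynomials of symplectic matrices are
    palindromic, x^N c(x + 1/x) with c of degree N, and multipliers on the
    circle correspond to roots of c in [-2, 2]. Because of the velocity,
    c_r = (y - 2) d_r, and d_0 = (y - 2) q with the roots of q simple and in
    (-2, 2). Roots of q persist as real roots of d_r in (-2, 2), because of
    sign changes (simple_roots_persist). The remaining root of d_r is real, and
    the sign of d_r(2) tells on which side of 2 it lies. If e_r is the
    velocity and l_r = (W e_r)^T, then up to positive factors
    d_r(2) = det (X_r - 1 + e_r a + b l_r) for suitable a and b (deflated_det).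
    Multiplying by 1 + (r^-2 - 1) D L gives a determinant with the limit
    det B det (X_0 - 1 + D L + e_0 a + b l_0)  (reduced_det_limit), and the
    second factor is a positive multiple of q(2) > 0 (start_det_gt0). Hence at
    a saddle d_r(2) < 0, and a root y > 2 gives a multiplier outside the circle
    (spectral_instability). At an extremum d_r(2) > 0, so that d_r has N - 1
    distinct roots in (-2, 2) and z_r is L-stable (spectral_stability).

    That Gamma is nonzero follows from the multiplicity four: otherwise
    translations and velocity would be three isotropic fixed vectors, and
    force the multiplicity six (total_vorticity_neq0). *)

(** * Determinants and characteristic polynomials of low rank perturbations *)

Lemma char_poly_mx_sub (F : fieldType) n k (K : 'M[F]_n) (E : 'M[F]_(n, k)) A :
  char_poly_mx (K + E *m A) =
  char_poly_mx K - map_mx polyC E *m map_mx polyC A.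
Proof. by rewrite /char_poly_mx map_mxD map_mxM opprD addrA. Qed.

(** Two block triangular factorizations of one block matrix. *)
Lemma det_sylvester (F : comNzRingType) n k (E : 'M[F]_(n, k)) A (x : F) :
  x ^+ k * \det (x%:M - E *m A) = x ^+ n * \det (x%:M - A *m E).
Proof.
set B := block_mx x%:M E A 1%:M.
have eq1 : B *m block_mx 1%:M 0 (- A) 1%:M = block_mx (x%:M - E *m A) E 0 1%:M.
  rewrite mulmx_block !mulmx1 !mulmx0 !mulmxN mul1mx addrN.
  by rewrite !add0r.
have eq2 : block_mx 1%:M 0 (- A) x%:M *m B = block_mx x%:M E 0 (x%:M - A *m E).
  rewrite mulmx_block !mul1mx !mul0mx !mulNmx mulmx1 !addr0 addrC.
  by rewrite scalar_mxC addrN [- _ + _]addrC.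
have := congr1 determinant eq1.
rewrite det_mulmx det_lblock !det1 !mulr1 det_ublock det1 mulr1 => detB.
have := congr1 determinant eq2.
by rewrite det_mulmx det_lblock det_ublock det1 mul1r !det_scalar detB.
Qed.

(** The characteristic matrix C of K acts on E as multiplication by X, whence
    C (X - E A) = X (C - E A). *)
Lemma deflation_right (F : fieldType) n k (K : 'M[F]_n) (E : 'M[F]_(n, k)) A :
  K *m E = 0 ->
  'X^k * char_poly (K + E *m A) = char_poly K * char_poly (A *m E).
Proof.
move=> KE; pose C : 'M[{poly F}]_n := char_poly_mx K.
pose E' : 'M[{poly F}]_(n, k) := map_mx polyC E.
pose A' : 'M[{poly F}]_(k, n) := map_mx polyC A.
have CE : C *m E' = 'X *: E'.
  by rewrite mulmxBl -map_mxM KE map_mx0 subr0 mul_scalar_mx.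
have CM : C *m ('X%:M - E' *m A') = 'X *: (C - E' *m A').
  by rewrite mulmxBr mulmxA CE mul_mx_scalar [RHS]scalerBr -scalemxAl.
have X_neq0 : 'X^n != 0 :> {poly F} by rewrite monic_neq0 ?monicXn.
have := congr1 determinant CM; rewrite det_mulmx detZ => detCM.
apply: (mulfI X_neq0); rewrite mulrCA /(char_poly (K + _)) char_poly_mx_sub.
rewrite -detCM [LHS]mulrCA [RHS]mulrCA; congr (_ * _).
by rewrite det_sylvester /char_poly /char_poly_mx map_mxM.
Qed.

Lemma char_poly_tr (F : fieldType) n (K : 'M[F]_n) :
  char_poly K^T = char_poly K.
Proof.
rewrite /char_poly -[RHS]det_tr; congr (\det _).
by rewrite /char_poly_mx linearB /= tr_scalar_mx map_trmx.
Qed.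

(** Right and left null vectors of K can be deflated one after the other: the
    left ones remain null vectors of K + E A because they annihilate E. *)
Lemma deflation (F : fieldType) n k (K : 'M[F]_n)
    (E : 'M[F]_(n, k)) A (L : 'M[F]_(k, n)) B :
  K *m E = 0 -> L *m K = 0 -> L *m E = 0 ->
  'X^(k + k) * char_poly (K + E *m A + B *m L) =
  char_poly K * char_poly (A *m E) * char_poly (L *m B).
Proof.
move=> KE LK LE; rewrite -(deflation_right _ KE) exprD -!mulrA; congr (_ * _).
rewrite -[char_poly (K + _ + _)]char_poly_tr.
rewrite -[char_poly (K + _)]char_poly_tr -[char_poly (L *m B)]char_poly_tr.
rewrite linearD /= !trmx_mul deflation_right //.
by rewrite -trmx_mul mulmxDr LK add0r mulmxA LE mul0mx trmx0.
Qed.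

(** * Palindromic polynomials and their trace polynomials *)

Lemma poly_eq_nonzero (F : numFieldType) (p q : {poly F}) :
  (forall x, x != 0 -> p.[x] = q.[x]) -> p = q.
Proof.
move=> pq; apply/eqP; rewrite -subr_eq0; apply/negPn/negP => r_neq0.
pose s : seq F := [seq i.+1%:R | i <- iota 0 (size (p - q))].
have s_roots : all (root (p - q)) s.
  apply/allP => _ /mapP[i _ ->]; apply/rootP.
  by rewrite hornerD hornerN pq ?subrr // pnatr_eq0.
have s_uniq : uniq s.
  rewrite map_inj_uniq ?iota_uniq // => i j /eqP.
  by rewrite eqr_nat => /eqP[].
have := max_poly_roots r_neq0 s_roots s_uniq.
by rewrite size_map size_iota ltnn.
Qed.

(** The numerator x^n c(x + 1/x) of c at x + 1/x. *)
Definition recip (F : fieldType) n (c : {poly F}) : {poly F} :=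
  \sum_(k < n.+1) c`_k *: ('X^(n - k) * ('X^2 + 1) ^+ k).

Lemma horner_recip (F : fieldType) n (c : {poly F}) x :
  (size c <= n.+1)%N -> x != 0 -> (recip n c).[x] = x ^+ n * c.[x + x^-1].
Proof.
move=> size_c x_neq0; rewrite /recip horner_sum (horner_coef_wide _ size_c).
rewrite big_distrr /=; apply: eq_bigr => k _.
rewrite hornerZ hornerM hornerXn horner_exp hornerD hornerXn hornerC.
have -> : x ^+ 2 + 1 = x * (x + x^-1) by rewrite mulrDr mulfV // expr2.
have kn : (k <= n)%N by rewrite -ltnS.
have -> : x ^+ n = x ^+ (n - k) * x ^+ k by rewrite -exprD subnK.
by rewrite exprMn; ring.
Qed.

Lemma recipD (F : fieldType) n : {morph @recip F n : c d / c + d}.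
Proof.
move=> c d; rewrite /recip -big_split /=; apply: eq_bigr => k _.
by rewrite coefD scalerDl.
Qed.

Lemma recip_widen (F : fieldType) n (c : {poly F}) :
  (size c <= n.+1)%N -> recip n.+1 c = 'X * recip n c.
Proof.
move=> size_c; rewrite /recip big_ord_recr /= nth_default // scale0r addr0.
rewrite big_distrr /=; apply: eq_bigr => k _.
by rewrite -scalerAr mulrA -exprS subSn // -ltnS.
Qed.

Lemma recip_Xn (F : fieldType) n (a : F) :
  recip n (a *: 'X^n) = a *: ('X^2 + 1) ^+ n.
Proof.
rewrite /recip big_ord_recr /= big1 => [|k _].
  by rewrite coefZ coefXn eqxx mulr1 subnn mul1r add0r.
by rewrite coefZ coefXn ltn_eqF // mulr0 scale0r.
Qed.

Lemma map_recip (F F' : fieldType) (f : {rmorphism F -> F'}) n c :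
  map_poly f (recip n c) = recip n (map_poly f c).
Proof.
rewrite /recip rmorph_sum /=; apply: eq_bigr => k _.
by rewrite map_polyZ coef_map rmorphM !rmorphXn rmorphD rmorphXn rmorph1 /= map_polyX.
Qed.

Lemma coef0_palindromic (F : numFieldType) n (p : {poly F}) :
  (size p <= n.+1)%N -> (forall x, x != 0 -> p.[x] = x ^+ n * p.[x^-1]) ->
  p`_0 = p`_n.
Proof.
move=> size_p p_pal; suff pE : p = \poly_(i < n.+1) p`_(n - i).
  by rewrite {1}pE coef_poly subn0.
apply: poly_eq_nonzero => x x_neq0; rewrite p_pal // horner_poly.
rewrite (horner_coef_wide _ size_p) big_distrr /=.
rewrite [RHS](reindex_inj rev_ord_inj) /=; apply: eq_bigr => i _.
have le_in : (i <= n)%N by rewrite -ltnS.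
rewrite subSS subKn // mulrCA; congr (_ * _).
have -> : x ^+ n = x ^+ (n - i) * x ^+ i by rewrite -exprD subnK.
by rewrite exprVn mulfK // expf_neq0.
Qed.

(** Subtract the multiple of (X^2 + 1)^n with the same leading coefficient. By
    palindromicity the constant coefficient vanishes with it, and the quotient
    by X is palindromic of smaller degree. *)
Lemma palindromic_recip (F : numFieldType) n (p : {poly F}) :
  (size p <= n.*2.+1)%N ->
  (forall x, x != 0 -> p.[x] = x ^+ n.*2 * p.[x^-1]) ->
  exists2 c : {poly F}, (size c <= n.+1)%N & p = recip n c.
Proof.
elim: n p => [|n IHn] p size_p p_pal.
  exists p => //; rewrite /recip big_ord1 subnn !expr0 mulr1.
  by rewrite alg_polyC; apply: size1_polyC.
pose a := p`_n.+1.*2; pose p1 := p - a *: ('X^2 + 1) ^+ n.+1.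
have monX : ('X^2 + 1 : {poly F}) \is monic.
  by rewrite monicE lead_coefDl ?lead_coefXn // size_polyXn size_poly1.
have size_X : size (('X^2 + 1 : {poly F}) ^+ n.+1) = n.+1.*2.+1.
  have := size_exp ('X^2 + 1 : {poly F}) n.+1.
  rewrite size_polyDl size_polyXn ?size_poly1 //= mul2n => <-.
  by rewrite prednK // size_poly_gt0 monic_neq0 // monic_exp.
have size_p1 : (size p1 <= n.+1.*2)%N.
  have : (size p1 <= n.+1.*2.+1)%N.
    rewrite (leq_trans (size_polyD _ _)) // geq_max size_p size_polyN.
    by rewrite (leq_trans (size_scale_leq _ _)) // size_X.
  rewrite leq_eqVlt => /orP[/eqP size_p1|//].
  have : lead_coef p1 = 0.
    rewrite lead_coefE size_p1 coefB coefZ.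
    have := monicP (monic_exp n.+1 monX).
    by rewrite lead_coefE size_X /= => ->; rewrite mulr1 subrr.
  by move/eqP; rewrite lead_coef_eq0 => /eqP ->; rewrite size_poly0.
have p1_pal x : x != 0 -> p1.[x] = x ^+ n.+1.*2 * p1.[x^-1].
  move=> x_neq0; rewrite !hornerD !hornerN !hornerZ mulrBr -p_pal //.
  congr (_ - _); rewrite mulrCA; congr (_ * _).
  rewrite !horner_exp !hornerD !hornerXn !hornerC -mul2n exprM -exprMn.
  by congr (_ ^+ _); rewrite mulrDr exprVn mulfV ?expf_neq0 // mulr1 addrC.
have /factor_theorem[p2] : root p1 0.
  apply/rootP; rewrite horner_coef0 (@coef0_palindromic _ n.+1.*2) //.
    by rewrite nth_default.
  exact: leq_trans size_p1 _.
rewrite subr0 => p12.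
have size_p2 : (size p2 <= n.*2.+1)%N.
  have [->|p2_neq0] := eqVneq p2 0; first by rewrite size_poly0.
  by move: size_p1; rewrite p12 size_mulX // doubleS.
have p2_pal x : x != 0 -> p2.[x] = x ^+ n.*2 * p2.[x^-1].
  move=> x_neq0; have := p1_pal x x_neq0; rewrite p12 !hornerM !hornerX.
  rewrite mulrC doubleS !exprS -!mulrA => /(mulfI x_neq0) ->.
  by rewrite mulrCA [x * _]mulrCA mulfV // mulr1.
have [c2 size_c2 p2E] := IHn p2 size_p2 p2_pal.
exists (a *: 'X^(n.+1) + c2).
  rewrite (leq_trans (size_polyD _ _)) // geq_max (leq_trans size_c2) // andbT.
  by rewrite (leq_trans (size_scale_leq _ _)) // size_polyXn.
by rewrite recipD recip_Xn recip_widen // -p2E mulrC -p12 addrC subrK.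
Qed.

Lemma recip_prod (F : numFieldType) (s : seq F) :
  recip (size s) (\prod_(y <- s) ('X - y%:P)) =
  \prod_(y <- s) ('X^2 - y *: 'X + 1).
Proof.
apply: poly_eq_nonzero => x x_neq0.
rewrite horner_recip // ?size_prod_XsubC //.
elim: s => [|y s IHs]; first by rewrite !big_nil !hornerC mulr1.
rewrite !big_cons !hornerM /= exprS mulrACA IHs; congr (_ * _).
rewrite !hornerE mulrBr mulrDr mulfV //.
by ring.
Qed.

Lemma quadratic_root (F : numClosedFieldType) (y : F) :
  exists2 x, x != 0 & y = x + x^-1.
Proof.
pose d := sqrtC (y ^+ 2 - 4); pose x := (y + d) / 2.
have xy : x * (y - x) = 1.
  have -> : x * (y - x) = (y ^+ 2 - d ^+ 2) / 4 by rewrite /x; field.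
  by rewrite sqrtCK opprB addrC subrK mulfV // pnatr_eq0.
have x_neq0 : x != 0.
  by apply: contraPneq xy => ->; rewrite mul0r => /esym/eqP; rewrite oner_eq0.
exists x => //; apply: (mulfI x_neq0).
by rewrite mulrDr mulfV // -xy mulrBr addrC subrK.
Qed.

Lemma reciprocal_quadraticE (F : fieldType) (x : F) : x != 0 ->
  'X^2 - (x + x^-1) *: 'X + 1 = ('X - x%:P) * ('X - x^-1%:P).
Proof.
move=> x_neq0; rewrite mulrBl !mulrBr -polyCM mulfV // -expr2.
by rewrite -!mul_polyC polyCD; ring.
Qed.

Lemma unit_trace_bound (F : numClosedFieldType) (x : F) : `|x| = 1 ->
  x + x^-1 \is Num.real /\ `|x + x^-1| <= 2.
Proof.
move=> x1; split; last first.
  apply: le_trans (ler_normD _ _) _.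
  by rewrite normfV x1 invr1 -[1 + 1]/(2%:R) lexx.
rewrite invC_norm x1 expr1n invr1 mul1r.
by apply/CrealP; rewrite rmorphD /= conjCK addrC.
Qed.

Section Stability.
Variable R : rcfType.
Notation C := (complex R).
Notation toC := (real_complex R).
Notation polC := (map_poly toC).

Lemma bounded_real_complex (y : C) : y \is Num.real -> `|y| <= 2 ->
  exists2 t : R, y = toC t & - 2 <= t <= 2.
Proof.
move=> /complex_realP[t ->] t2; exists t => //.
rewrite -ler_norml -lecR (rmorph_nat toC).
by move: t2; rewrite normc_def /= expr0n addr0 sqrtr_sqr.
Qed.

(** If |x| = 1 then x + 1/x is real and in [-2, 2]. A repeated root y of c would
    make the solutions of x + 1/x = y repeated roots of p, and a root y = - 2
    would make - 1 one, as both solutions then coincide; only y = 2 may do so. *)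
Lemma stable_trace_poly n (c : {poly R}) :
  c \is monic -> size c = n.+1 ->
  let p := polC (recip n c) in
  (forall l, root p l -> `|l| = 1) -> mup 1 p = 4%N ->
  (forall l, root p l -> l != 1 -> mup l p = 1%N) ->
  exists ys : seq R, [/\ c = ('X - 2%:P) ^+ 2 * \prod_(y <- ys) ('X - y%:P),
    uniq ys & forall y, y \in ys -> - 2 < y < 2].
Proof.
move=> c_mon size_c p p_circle p_four p_simple.
have [s cE] := closed_field_poly_normal (polC c).
rewrite (monicP _) ?map_monic // scale1r in cE.
have size_s : size s = n.
  have := congr1 (fun q : {poly _} => size q) cE.
  by rewrite size_map_poly size_c size_prod_XsubC => -[].
have pE : p = \prod_(y <- s) ('X^2 - y *: 'X + 1).
  by rewrite /p map_recip cE -size_s recip_prod.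
have root_s x : x != 0 -> x + x^-1 \in s -> root p x.
  move=> x_neq0 xs; rewrite pE (big_rem _ xs) /= rootM.
  by rewrite reciprocal_quadraticE // rootM root_XsubC eqxx.
have s_real y : y \in s -> exists2 t : R, y = toC t & - 2 <= t <= 2.
  have [x x_neq0 ->] := quadratic_root y => xs.
  have [yr y2] := unit_trace_bound (p_circle _ (root_s _ x_neq0 xs)).
  exact: bounded_real_complex.
pose t := [seq complex.Re y | y <- s].
have sE : s = [seq toC y | y <- t].
  rewrite -map_comp -[LHS]map_id; apply/eq_in_map => y /s_real[u -> _] //=.
have t_bound y : y \in t -> - 2 <= y <= 2.
  by move=> /mapP[z /s_real[u -> u2] ->].
have ctE : c = \prod_(y <- t) ('X - y%:P).
  apply: (@map_poly_inj _ _ toC); rewrite cE sE big_map rmorph_prod.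
  by apply: eq_bigr => y _ /=; rewrite map_polyXsubC.
have p_split y : exists q, p = ('X^2 - toC y *: 'X + 1) ^+ count_mem y t * q /\
    (forall x, root q x -> exists2 y', y' != y & x ^+ 2 - toC y' * x + 1 = 0).
  exists (\prod_(y' <- t | y' != y) ('X^2 - toC y' *: 'X + 1)); split.
    rewrite pE sE big_map (bigID (pred1 y)) /=; congr (_ * _).
    rewrite -big_filter (eq_big_seq (fun=> 'X^2 - toC y *: 'X + 1)); last first.
      by move=> z; rewrite mem_filter => /andP[/eqP ->].
    by rewrite big_const_seq count_predT size_filter -Monoid.iteropE.
  move=> x; rewrite rootE horner_prod prodf_seq_eq0 => /hasP[y' _].
  by rewrite !hornerE => /andP[y'y /eqP y'x]; exists y'.
have t_simple y : y \in t -> y != 2 -> y != -2 /\ (count_mem y t <= 1)%N.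
  move=> yt y2; have [x x_neq0 yx] := quadratic_root (toC y).
  have root_x : root p x by apply: root_s; rewrite // -yx sE map_f.
  have x_neq1 : x != 1.
    apply: contraNneq y2 => x1; move: yx; rewrite x1 invr1.
    by rewrite -[1 + 1]/(2%:R) -(rmorph_nat toC) => /complexI ->.
  have p_neq0 : p != 0.
    have p0 : p.[0] = 1.
      rewrite pE horner_prod big1 // => z _.
      by rewrite horner_coef0 coefD coefB coefZ coefX coefXn coef1 mulr0 subr0 add0r.
    by apply: contra_eq_neq p0 => ->; rewrite horner0 eq_sym oner_eq0.
  have := p_simple x root_x x_neq1.
  have [q [pq _]] := p_split y.
  have dvd_p : ('X - x%:P) ^+ count_mem y t * ('X - x^-1%:P) ^+ count_mem y t %| p.
    by rewrite pq -exprMn -reciprocal_quadraticE // -yx dvdp_mulIl.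
  move=> mup_x; split; last by rewrite -mup_x mup_geq // (dvdp_trans _ dvd_p) // dvdp_mulIl.
  apply: contra_eq_neq mup_x => yE; rewrite gtn_eqF // mup_geq //.
  have x_inv : x^-1 = x.
    suff /eqP : (x + 1) ^+ 2 = 0 by rewrite expf_eq0 /= addr_eq0 => /eqP ->; rewrite invrN1.
    have : x * toC y = x * (x + x^-1) by rewrite -yx.
    rewrite mulrDr mulfV // yE rmorphN (rmorph_nat toC) => eqx.
    have -> : (x + 1) ^+ 2 = x * x + 1 - x * - 2 by ring.
    by rewrite eqx subrr.
  apply: dvdp_trans dvd_p; rewrite x_inv -exprD dvdp_exp2l //.
  by rewrite addnn (@leq_double 1) -has_count has_pred1.
have count2 : count_mem 2 t = 2%N.
  have [q [pq q_root]] := p_split 2.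
  have quad1 : 'X^2 - toC 2 *: 'X + 1 = ('X - 1%:P) ^+ 2 :> {poly C}.
    have -> : toC 2 = 1 + 1^-1 by rewrite invr1 (rmorph_nat toC).
    by rewrite reciprocal_quadraticE ?oner_eq0 // invr1 expr2.
  have q1 : ~~ root q 1.
    apply/negP => /q_root[y' y'2 /eqP].
    rewrite expr1n mulr1 addrAC subr_eq0 -[1 + 1]/(2%:R) -(rmorph_nat toC).
    by move=> /eqP/complexI /esym/eqP; apply/negP.
  move: p_four; rewrite pq quad1 -exprM mupMl // mup_XsubCX eqxx.
  by rewrite mul2n -[4%N]/(2.*2) => /double_inj.
exists [seq y <- t | y != 2]; split.
- rewrite {1}ctE (bigID (pred1 2)) /= big_filter; congr (_ * _).
  rewrite -big_filter (eq_big_seq (fun=> 'X - 2%:P)); last first.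
    by move=> z; rewrite mem_filter => /andP[/eqP ->].
  by rewrite big_const_seq count_predT size_filter count2 /= mulr1 expr2.
- apply: count_mem_uniq => y; rewrite count_filter /=.
  have [y2|y2] := eqVneq y 2.
    rewrite (@eq_count _ _ pred0) ?count_pred0 ?mem_filter ?y2 ?eqxx // => z /=.
    by case: (z == 2).
  rewrite (@eq_count _ _ (pred1 y)) ?mem_filter ?y2 => [|z /=]; last first.
    by case: eqVneq => // ->; rewrite y2.
  have [yt|/count_memPn -> //] := boolP (y \in t).
  have [_] := t_simple y yt y2; rewrite leq_eqVlt ltnS leqn0 => /orP[/eqP -> //|].
  by move/eqP/count_memPn; rewrite yt.
- move=> y; rewrite mem_filter => /andP[y2 yt].
  have [ym2 _] := t_simple y yt y2.
  have /andP[ge_y le_y] := t_bound y yt.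
  by rewrite !lt_neqAle ge_y le_y y2 eq_sym ym2.
Qed.

(** For y in (-2, 2) the solutions of x + 1/x = y are two conjugate points of
    the circle, and they determine y. *)
Lemma trace_roots_stable n (c : {poly R}) t :
  c = \prod_(y <- 2 :: t) ('X - y%:P) -> n = (size t).+1 -> uniq t ->
  (forall y, y \in t -> - 2 < y < 2) ->
  let p := polC (recip n c) in
  [/\ forall l, root p l -> `|l| = 1, mup 1 p = 2%N &
      forall l, root p l -> l != 1 -> mup l p = 1%N].
Proof.
move=> -> -> t_uniq t_bound p.
pose q y : {poly C} := 'X^2 - toC y *: 'X + 1.
have pE : p = \prod_(y <- 2 :: t) q y.
  rewrite /p map_recip rmorph_prod /= -(size_map toC).
  rewrite -[(size _).+1]/(size (toC 2 :: map toC t)) -map_cons.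
  rewrite (eq_bigr (fun y => 'X - (toC y)%:P)) => [|y _]; last first.
    by rewrite /= map_polyXsubC.
  by rewrite -(big_map toC xpredT (fun z => 'X - z%:P)) recip_prod big_map.
have q2 : q 2 = ('X - 1%:P) ^+ 2.
  have yE : toC 2 = 1 + 1^-1 by rewrite invr1 (rmorph_nat toC).
  by rewrite /q yE reciprocal_quadraticE ?oner_eq0 // invr1 expr2.
have q_root y : - 2 < y < 2 -> forall l, root (q y) l -> [/\ l != 0, `|l| = 1,
    l != l^-1 & q y = ('X - l%:P) * ('X - l^-1%:P)].
  move=> y2 l /rootP; rewrite /q !hornerE => /eqP.
  rewrite addrAC subr_eq0 => /eqP ly.
  have l_neq0 : l != 0.
    apply: contra_eq_neq ly => ->.
    by rewrite mulr0 expr0n add0r oner_eq0.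
  have yE : toC y = l + l^-1.
    by apply: (mulIf l_neq0); rewrite -ly mulrDl mulVf // expr2.
  have l_nonreal : l != l^*%C.
    apply/negP => /eqP l_conj.
    have lr : l = toC (complex.Re l).
      by move: l_conj; case: (l) => a b [] /eqP; rewrite -addr_eq0 -mulr2n mulrn_eq0 /= => /eqP ->.
    move: yE; rewrite lr -fmorphV -rmorphD => /complexI yl.
    have r_neq0 : complex.Re l != 0.
      by apply: contraNneq l_neq0 => r0; rewrite lr r0 rmorph0.
    set r := complex.Re l in yl r_neq0.
    have : y ^+ 2 = (r - r^-1) ^+ 2 + 4 by rewrite yl; field.
    have : 0 <= (r - r^-1) ^+ 2 by apply: sqr_ge0.
    by case/andP: y2; nra.
  have l_inv : l^-1 = l^*%C.
    have : (l^*%C - l) * (l^*%C - l^-1) = 0.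
      have -> : (l^*%C - l) * (l^*%C - l^-1) =
        l^*%C ^+ 2 - (l + l^-1) * l^*%C + 1 by field.
      have ly' : l^*%C ^+ 2 + 1 = toC y * l^*%C.
        by rewrite -(conjc_real y) -rmorphM -ly rmorphD rmorphXn rmorph1.
      by rewrite -yE addrAC ly' subrr.
    move/eqP; rewrite mulf_eq0 !subr_eq0 eq_sym (negPf l_nonreal) /=.
    by move/eqP.
  split => //; rewrite ?l_inv //.
    apply/eqP; rewrite -(@pexpr_eq1 _ _ 2) //; apply/eqP.
    by rewrite sqr_normc -l_inv mulfV.
  by rewrite /q yE reciprocal_quadraticE // l_inv.
have q_disj y y' l : root (q y) l -> root (q y') l -> l != 0 -> y = y'.
  move=> /rootP + /rootP; rewrite /q !hornerE => yl y'l l_neq0.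
  apply: complexI; apply: (mulIf l_neq0).
  by move: yl; rewrite -y'l => /addIr/addrI/oppr_inj.
have root_p l : root p l -> l = 1 \/ exists2 y, y \in t & root (q y) l.
  rewrite pE rootE horner_prod prodf_seq_eq0 => /hasP[y].
  rewrite inE => /orP[/eqP -> /=|yt ql]; last by right; exists y.
  rewrite q2 horner_exp expf_eq0 /= hornerXsubC subr_eq0 => /eqP ->.
  by left.
have p_rest1 : ~~ root (\prod_(y <- t) q y) 1.
  rewrite rootE horner_prod prodf_seq_eq0; apply/hasPn => y /t_bound y2 /=.
  apply/negP => /eqP/rootP /(q_root _ y2)[_ _].
  by rewrite invr1 eqxx.
split.
- move=> l /root_p[->|[y yt]]; first by rewrite normr1.
  by move=> /(q_root _ (t_bound _ yt))[].
- by rewrite pE big_cons q2 mupMl // mup_XsubCX eqxx.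
- move=> l /root_p[->|]; first by rewrite eqxx.
  move=> [y yt ql] l1.
  have [l_neq0 _ l_inv qE] := q_root y (t_bound y yt) l ql.
  rewrite pE big_cons mupMr; last first.
    by rewrite q2 rootE horner_exp expf_eq0 /= hornerXsubC subr_eq0.
  rewrite (big_rem _ yt) /= mupMl; last first.
    rewrite rootE horner_prod prodf_seq_eq0; apply/hasPn => y' /= y't.
    apply/negP => /eqP/rootP ql'; move: y't.
    rewrite mem_rem_uniq // inE => /andP[/eqP yy' _]; apply: yy'.
    exact: q_disj ql' ql l_neq0.
  rewrite qE mupMl; last by rewrite root_XsubC.
  by rewrite -[_ - _]expr1 mup_XsubCX eqxx.
Qed.

Lemma poly_root_sign (d : {poly R}) a b : a < b -> d.[a] * d.[b] < 0 ->
  exists2 x, a < x < b & root d x.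
Proof.
wlog da : d / d.[a] < 0.
  move=> wl ab dab; have [/wl|da|da] := ltgtP d.[a] 0; first exact.
    have [||x xab] := wl (- d) _ ab; rewrite ?hornerN ?oppr_lt0 ?mulrNN //.
    by rewrite rootN; exists x.
  by rewrite da mul0r ltxx in dab.
move=> ab; rewrite nmulr_rlt0 // => db.
have [x /andP[ax xb] dx] := poly_ivt (ltW ab) (introT andP (conj (ltW da) (ltW db))).
exists x => //; rewrite !lt_neqAle ax xb !andbT.
apply/andP; split.
  by apply: contraTneq dx => <-; rewrite rootE lt_eqF.
by apply: contraTneq dx => ->; rewrite rootE gt_eqF.
Qed.

(** A monic d with d(2) < 0 has a root y > 2, and x + 1/x = y has a solution
    x > 1. *)
Lemma trace_root_gt2_unstable n (d : {poly R}) : d \is monic ->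
  (size d <= n)%N -> d.[2] < 0 ->
  exists2 l, root (polC (recip n (('X - 2%:P) * d))) l & `|l| <> 1.
Proof.
move=> d_mon size_d d2.
have [b b2 db] : exists2 b, 2 < b & 0 < d.[b].
  have [|b b_lc] := @polyrcf.poly_pinfty_gt_lc _ d.
    by rewrite (monicP d_mon) ltr01.
  exists (Num.max b 3); first by rewrite lt_max ltr_nat orbT.
  by rewrite (lt_le_trans ltr01) // -(monicP d_mon) b_lc // le_max lexx.
have db2 : d.[2] * d.[b] < 0 by rewrite nmulr_rlt0.
have [y /andP[y2 _] dy] := poly_root_sign b2 db2.
pose w := Num.sqrt (y ^+ 2 - 4); pose x := (y + w) / 2.
have w2 : w ^+ 2 = y ^+ 2 - 4 by rewrite sqr_sqrtr //; nra.
have w_gt0 : 0 <= w by apply: sqrtr_ge0.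
have x1 : 1 < x by rewrite /x; lra.
have x_neq0 : x != 0 by rewrite gt_eqF // (lt_trans ltr01).
have xE : x + x^-1 = y.
  apply: (mulfI x_neq0); rewrite mulrDr mulfV // /x.
  have -> : (y + w) / 2 * ((y + w) / 2) = (y ^+ 2 + 2 * y * w + w ^+ 2) / 4 by field.
  by rewrite w2; field.
exists (toC x).
  rewrite rootE horner_map horner_recip //; last first.
    rewrite (leq_trans (size_polyMleq _ _)) // size_XsubC.
    by rewrite addSn /= add1n ltnS.
  by rewrite xE hornerM (rootP dy) mulr0 mulr0 rmorph0.
rewrite normc_def /= expr0n addr0 sqrtr_sqr => /complexI.
by rewrite gtr0_norm ?(lt_trans ltr01) // => x1'; move: x1; rewrite x1' ltxx.
Qed.

Lemma positive_lower_bound (s : seq R) : (forall x, x \in s -> 0 < x) ->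
  exists2 e, 0 < e & forall x, x \in s -> e < x.
Proof.
elim: s => [|x s IHs] s_gt0; first by exists 1.
have [|e e_gt0 es] := IHs; first by move=> y ys; apply: s_gt0; rewrite inE ys orbT.
have x_gt0 : 0 < x by apply: s_gt0; rewrite mem_head.
exists (Num.min e (x / 2)); first by rewrite lt_min e_gt0 divr_gt0.
move=> y; rewrite inE gt_min => /orP[/eqP -> |/es -> //].
by rewrite ltr_pdivrMr // ltr_pMr // ltr1n orbT.
Qed.

(** Points that are close to well separated points are distinct. *)
Lemma separated_choice (s : seq R) (e : R) (Q : R -> R -> Prop) :
  uniq s -> (forall y z, y \in s -> z \in s -> y != z -> 2 * e <= `|y - z|) ->
  (forall y x, Q y x -> `|x - y| < e) -> (forall y, y \in s -> exists x, Q y x) ->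
  exists t, [/\ size t = size s, uniq t &
    forall x, x \in t -> exists2 y, y \in s & Q y x].
Proof.
move=> + + Qe; elim: s => [|y s IHs] /= s_uniq s_sep s_ex; first by exists [::].
move: s_uniq => /andP[ys s_uniq].
have [||t [size_t t_uniq tQ]] := IHs s_uniq.
- by move=> u v us vs; apply: s_sep; rewrite inE ?us ?vs orbT.
- by move=> u us; apply: s_ex; rewrite inE us orbT.
have [x Qx] := s_ex y (mem_head _ _).
exists (x :: t); split => /=; first by rewrite size_t.
  rewrite t_uniq andbT; apply/negP => /tQ[z zs Qz].
  have yz : y != z by apply: contraNneq ys => ->.
  have := s_sep y z (mem_head _ _) _ yz; rewrite inE zs orbT => /(_ isT).
  apply/negP; rewrite -ltNge.
  have -> : y - z = (x - z) - (x - y) by ring.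
  rewrite (le_lt_trans (ler_normB _ _)) // mulr_natl mulr2n ltrD //.
    exact: Qe.
  exact: Qe.
move=> u; rewrite inE => /orP[/eqP ->|/tQ[z zs Qz]].
  by exists y => //; rewrite mem_head.
by exists z => //; rewrite inE zs orbT.
Qed.

(** Only the signs of d at finitely many points around the roots of d0 matter,
    so that no continuity of roots is needed. Near the root 2 it is the sign
    of d at 2 itself that keeps the root of d on the left. *)
Lemma simple_roots_persist (ys : seq R) :
  uniq (2 :: ys) -> (forall y, y \in ys -> - 2 < y < 2) ->
  let d0 := \prod_(y <- 2 :: ys) ('X - y%:P) in
  exists2 ws : seq R, (forall w, w \in ws -> w != 2 /\ d0.[w] != 0) &
  forall d : {poly R}, d \is monic -> size d = (size ys).+2 ->
    (forall w, w \in ws -> 0 < d.[w] * d0.[w]) -> 0 < d.[2] ->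
  exists t, [/\ d = \prod_(y <- t) ('X - y%:P), size t = (size ys).+1, uniq t &
    forall y, y \in t -> - 2 < y < 2].
Proof.
move=> s_uniq ys_bound; set s := 2 :: ys => d0.
have s_bound y : y \in s -> - 2 < y <= 2.
  rewrite inE => /orP[/eqP ->|/ys_bound/andP[-> /ltW->//]].
  by rewrite lexx andbT (lt_trans _ (ltr0n _ 2)) // oppr_lt0 ltr0n.
pose gaps := [seq `|p.1 - p.2| / 3 | p <- [seq (y, z) | y <- s, z <- s] & p.1 != p.2]
  ++ [seq y + 2 | y <- s].
have [|e e_gt0 e_gaps] := @positive_lower_bound gaps.
  move=> x; rewrite mem_cat => /orP[] /mapP[].
    move=> p; rewrite mem_filter => /andP[pp _] ->.
    by rewrite divr_gt0 // normr_gt0 subr_eq0.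
  by move=> y /s_bound/andP[y2 _] ->; rewrite -ltrBlDr sub0r.
have e_sep y z : y \in s -> z \in s -> y != z -> 3 * e < `|y - z|.
  move=> ys' zs yz; rewrite mulrC -ltr_pdivlMr //; apply: e_gaps.
  rewrite mem_cat; apply/orP; left; apply/mapP; exists (y, z) => //.
  by rewrite mem_filter; apply/andP; split=> //; apply: allpairs_f.
have e_low y : y \in s -> - 2 < y - e.
  move=> ys'; rewrite ltrBrDr addrC -ltrBrDr opprK; apply: e_gaps.
  by rewrite mem_cat (map_f (fun y => y + 2)) ?orbT.
have e_high y : y \in ys -> y + e < 2 - e.
  move=> ys'; have /andP[_ y2] := ys_bound y ys'.
  have := e_sep y 2; rewrite inE ys' orbT mem_head (lt_eqF y2) => /(_ isT isT isT).
  by rewrite distrC gtr0_norm ?subr_gt0 // => ?; lra.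
(* The root 2 gets no point on its right: the sign of d at 2 replaces it. *)
pose ws := 2 - e :: [seq y - e | y <- ys] ++ [seq y + e | y <- ys].
have ws_near w : w \in ws -> exists2 y, y \in s & `|w - y| = e.
  rewrite inE mem_cat => /or3P[/eqP ->|/mapP[y ys' ->]|/mapP[y ys' ->]].
  - by exists 2; rewrite ?mem_head // addrAC subrr sub0r normrN gtr0_norm.
  - by exists y; rewrite ?inE ?ys' ?orbT // addrAC subrr sub0r normrN gtr0_norm.
  - by exists y; rewrite ?inE ?ys' ?orbT // addrAC subrr add0r gtr0_norm.
have ws_nonroot w : w \in ws -> w \notin s.
  move=> /ws_near[y ys' wy]; apply/negP => w_s.
  have [wyE|wy'] := eqVneq w y.
    by move: e_gt0; rewrite -wy wyE subrr normr0 ltxx.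
  by have := e_sep w y w_s ys' wy'; rewrite wy => ?; lra.
have d0_neq0 w : w \notin s -> d0.[w] != 0.
  by move=> ws'; rewrite -/(root d0 w) root_prod_XsubC.
exists ws.
  move=> w /ws_nonroot w_s; split; last exact: d0_neq0.
  by apply: contraNneq w_s => ->; rewrite mem_head.
have d0_rem y w : y \in s -> d0.[w] = (w - y) * (\prod_(z <- rem y s) ('X - z%:P)).[w].
  by move=> ys'; rewrite /d0 (big_rem _ ys') hornerM hornerXsubC.
have rem_sign y : y \in s ->
    0 < (\prod_(z <- rem y s) ('X - z%:P)).[y - e] * (\prod_(z <- rem y s) ('X - z%:P)).[y + e].
  move=> ys'; rewrite !horner_prod -big_split big_seq; apply: prodr_gt0 => z.
  rewrite mem_rem_uniq // inE => /andP[zy zs]; rewrite !hornerXsubC /=.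
  have -> : (y - e - z) * (y + e - z) = `|y - z| ^+ 2 - e ^+ 2.
    by rewrite real_normK ?num_real //; ring.
  have := e_sep y z ys' zs; rewrite eq_sym zy => /(_ isT) yz.
  by rewrite subr_gt0 ltr_pXn2r ?nnegrE ?(ltW e_gt0) //; lra.
have d0_sign y : y \in s -> d0.[y - e] * d0.[y + e] < 0.
  move=> ys'; rewrite !(d0_rem y) // mulrACA pmulr_llt0 ?rem_sign //.
  by rewrite addrAC subrr sub0r addrAC subrr add0r mulNr oppr_lt0 mulr_gt0.
have d0_above : 0 < d0.[2 + e].
  rewrite horner_prod big_seq prodr_gt0 // => y /s_bound/andP[_ y2].
  by rewrite hornerXsubC subr_gt0 (le_lt_trans y2) // ltrDl.
move=> d d_mon size_d d_ws d2.
pose Q y x := [/\ root d x, `|x - y| < e & - 2 < x < 2].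
have [t [size_t t_uniq tQ]] : exists t, [/\ size t = size s, uniq t &
    forall x, x \in t -> exists2 y, y \in s & Q y x].
  apply: (@separated_choice s e Q) => //.
  - by move=> y z ys' zs yz; have := e_sep y z ys' zs yz; lra.
  - by move=> y x [].
  - move=> y ys'.
    have lo : y - e \in ws.
      move: ys'; rewrite !inE mem_cat => /orP[/eqP ->|ys'']; first by rewrite eqxx.
      by rewrite (map_f (fun y => y - e)) ?orbT.
    have dlo := d_ws _ lo; have lo2 := e_low y ys'.
    move: (ys'); rewrite inE => /orP[/eqP yE|ys''].
      have dlo0 : d.[2 - e] * d.[2] < 0.
        move: dlo (d0_sign y ys'); rewrite yE pmulr_llt0 // => + d0lo.
        by rewrite nmulr_lgt0 // pmulr_llt0.
      have [|x /andP[x_lo x_hi] dx] := poly_root_sign _ dlo0.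
        by rewrite ltrBlDr ltrDl.
      exists x; split => //; last by apply/andP; split; lra.
      by rewrite yE ltr_norml; apply/andP; split; lra.
    have hi : y + e \in ws by rewrite inE mem_cat (map_f (fun y => y + e)) ?orbT.
    have dhi := d_ws _ hi; have hi2 := e_high y ys''.
    have dsgn : d.[y - e] * d.[y + e] < 0.
      have := mulr_gt0 dlo dhi; rewrite mulrACA nmulr_lgt0 //.
      exact: d0_sign.
    have [|x /andP[x_lo x_hi] dx] := poly_root_sign _ dsgn.
      by rewrite ltrBlDr -addrA ltrDl addr_gt0.
    exists x; split => //; last by apply/andP; split; lra.
    by rewrite ltr_norml; apply/andP; split; lra.
exists t; split; rewrite ?size_t //; last first.
  by move=> x /tQ[y _ []].
have := @all_roots_prod_XsubC _ d t; rewrite size_t size_d (monicP d_mon) scale1r.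
apply => //; last by rewrite uniq_rootsE.
by apply/allP => x /tQ[y _ []].
Qed.

End Stability.

(** * Limits of matrices *)

Section MatrixLimits.
Variables (R : realType) (T : Type) (F : set_system T).
Context {FF : Filter F}.

Lemma cvg_bigsum I (r : seq I) (f : I -> T -> R) (l : I -> R) (P : pred I) :
  (forall i, P i -> f i t @[t --> F] --> l i) ->
  \sum_(i <- r | P i) f i t @[t --> F] --> \sum_(i <- r | P i) l i.
Proof.
by move=> fl; apply: cvg_big => //; exact: add_continuous.
Qed.

Lemma cvg_bigprod I (r : seq I) (f : I -> T -> R) (l : I -> R) (P : pred I) :
  (forall i, P i -> f i t @[t --> F] --> l i) ->
  \prod_(i <- r | P i) f i t @[t --> F] --> \prod_(i <- r | P i) l i.
Proof.
by move=> fl; apply: cvg_big => //; exact: mul_continuous.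
Qed.

Lemma cvg_mxP m n (X : T -> 'M[R]_(m, n)) (X0 : 'M[R]_(m, n)) :
  X t @[t --> F] --> X0 <-> (forall i j, X t i j @[t --> F] --> X0 i j).
Proof.
split=> [XX0 i j|XX0].
  apply/cvgrPdist_le => e e_gt0; have /cvgrPdist_le/(_ _ e_gt0) := XX0.
  apply: filterS => t; apply: le_trans.
  rewrite [leRHS]/Num.Def.normr/= mx_normrE.
  by apply: le_trans; last exact: (le_bigmax _ _ (i, j)); rewrite !mxE.
apply/cvgrPdist_le => e e_gt0.
have : F (fun t => forall ij : 'I_m * 'I_n, `|X0 ij.1 ij.2 - X t ij.1 ij.2| <= e).
  by apply: filter_forall => -[i j] /=; have /cvgrPdist_le/(_ _ e_gt0) := XX0 i j.
apply: filterS => t Xt.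
rewrite /Num.Def.normr/= mx_normrE (bigmax_le _ (ltW e_gt0)) //= => ij _.
by rewrite !mxE.
Qed.

Lemma cvg_mulmx m n p (A : T -> 'M[R]_(m, n)) (B : T -> 'M[R]_(n, p))
    (A0 : 'M[R]_(m, n)) (B0 : 'M[R]_(n, p)) :
  A t @[t --> F] --> A0 -> B t @[t --> F] --> B0 ->
  A t *m B t @[t --> F] --> A0 *m B0.
Proof.
move=> /cvg_mxP A_cvg /cvg_mxP B_cvg; apply/cvg_mxP => i j; rewrite mxE.
under eq_cvg do rewrite mxE.
by apply: cvg_bigsum => k _; apply: cvgM.
Qed.

Lemma cvg_det n (A : T -> 'M[R]_n) (A0 : 'M[R]_n) :
  A t @[t --> F] --> A0 -> \det (A t) @[t --> F] --> \det A0.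
Proof.
move=> /cvg_mxP A_cvg; rewrite /determinant.
apply: cvg_bigsum => s _; apply: cvgM; first exact: cvg_cst.
exact: cvg_bigprod.
Qed.

Definition coef_cvg (P : T -> {poly R}) (p : {poly R}) :=
  forall k, (P t)`_k @[t --> F] --> p`_k.

Lemma coef_cvg_cst p : coef_cvg (fun=> p) p.
Proof. by move=> k; exact: cvg_cst. Qed.

Lemma coef_cvgM P Q p q :
  coef_cvg P p -> coef_cvg Q q -> coef_cvg (fun t => P t * Q t) (p * q).
Proof.
move=> Pp Qq k; rewrite coefM; under eq_cvg do rewrite coefM.
by apply: cvg_bigsum => i _; apply: cvgM.
Qed.

Lemma coef_cvg_sum I (r : seq I) (P : I -> T -> {poly R}) p :
  (forall i, coef_cvg (P i) (p i)) ->
  coef_cvg (fun t => \sum_(i <- r) P i t) (\sum_(i <- r) p i).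
Proof.
move=> Pp k; rewrite coef_sum; under eq_cvg do rewrite coef_sum.
by apply: cvg_bigsum => i _; apply: Pp.
Qed.

Lemma coef_cvg_prod I (r : seq I) (P : I -> T -> {poly R}) p :
  (forall i, coef_cvg (P i) (p i)) ->
  coef_cvg (fun t => \prod_(i <- r) P i t) (\prod_(i <- r) p i).
Proof.
move=> Pp; elim: r => [|i r IHr].
  rewrite big_nil; have -> : (fun t => \prod_(i <- [::]) P i t) = fun=> 1.
    by apply/funext => t; rewrite big_nil.
  exact: coef_cvg_cst.
rewrite big_cons.
have -> : (fun t => \prod_(j <- i :: r) P j t) =
    fun t => P i t * \prod_(j <- r) P j t.
  by apply/funext => t; rewrite big_cons.
exact: coef_cvgM.
Qed.

Lemma coef_cvg_char_poly n (A : T -> 'M[R]_n) (A0 : 'M[R]_n) :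
  A t @[t --> F] --> A0 -> coef_cvg (fun t => char_poly (A t)) (char_poly A0).
Proof.
move=> /cvg_mxP A_cvg; rewrite /char_poly /determinant.
apply: coef_cvg_sum => s; apply: coef_cvgM; first exact: coef_cvg_cst.
apply: coef_cvg_prod => i k; rewrite !mxE coefB coefC.
under eq_cvg do rewrite !mxE coefB coefC.
apply: cvgB; first exact: cvg_cst.
by case: (k == 0%N) => //; exact: cvg_cst.
Qed.

End MatrixLimits.

(** * Symplectic matrices and deflation *)

Lemma horner_char_poly (F : fieldType) n (X : 'M[F]_n) x :
  (char_poly X).[x] = \det (x%:M - X).
Proof.
rewrite /char_poly -horner_evalE -det_map_mx; congr (\det _).
apply/matrixP => i j; rewrite !mxE /= horner_evalE hornerD hornerN hornerC.
by case: (i == j); rewrite ?mulr1n ?mulr0n ?hornerX ?horner0.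
Qed.

(** A symplectic matrix is conjugate to the inverse of its transpose. *)
Lemma symplectic_palindromic (R : rcfType) n (W X : 'M[R]_n) x :
  W \in unitmx -> X^T *m W *m X = W -> \det X = 1 -> ~~ odd n -> x != 0 ->
  (char_poly X).[x] = x ^+ n * (char_poly X).[x^-1].
Proof.
move=> W_unit X_symp X_det n_even x_neq0; rewrite !horner_char_poly.
have eqX : X^T *m W *m (x%:M - X) = (x *: X^T - 1%:M) *m W.
  rewrite mulmxBr X_symp mulmxBl mul1mx mul_mx_scalar.
  by rewrite -scalemxAl.
have W_det : \det W != 0 by rewrite -unitfE -unitmxE.
have := congr1 determinant eqX.
rewrite !det_mulmx det_tr X_det mul1r mulrC => /(mulIf W_det) ->.
have -> : x *: X^T - 1%:M = (- x) *: (x^-1%:M - X)^T.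
  rewrite linearB /= tr_scalar_mx scalerBr scale_scalar_mx scaleNr opprK.
  by rewrite mulNr mulfV // addrC raddfN.
rewrite detZ det_tr; congr (_ * _).
by rewrite exprNn -signr_odd (negPf n_even) mul1r.
Qed.

(** Evaluate the deflation of X - 1 at 0: the factor (x - 1)^(2 k) of the
    characteristic polynomial of X cancels, and so do the two signs (-1)^k. *)
Lemma deflated_det (F : numFieldType) n k (X : 'M[F]_n) (E : 'M[F]_(n, k))
    (A : 'M[F]_(k, n)) (L : 'M[F]_(k, n)) (B : 'M[F]_(n, k)) s :
  ~~ odd n -> (X - 1%:M) *m E = 0 -> L *m (X - 1%:M) = 0 -> L *m E = 0 ->
  char_poly X = ('X - 1%:P) ^+ (k + k) * s ->
  s.[1] * \det (A *m E) * \det (L *m B) = \det (X - 1%:M + E *m A + B *m L).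
Proof.
move=> n_even KE LK LE XE.
have := deflation A B KE LK LE; set p' := char_poly (_ + _) => eq_p.
have eq_p' : p' = (s \Po ('X + 1%:P)) * char_poly (A *m E) * char_poly (L *m B).
  apply: poly_eq_nonzero => x x_neq0.
  have x_pow : x ^+ (k + k) != 0 by rewrite expf_neq0.
  have := congr1 (horner^~ x) eq_p; rewrite /= !hornerM hornerXn => eq_x.
  apply: (mulfI x_pow); rewrite eq_x horner_comp !mulrA; congr (_ * _ * _).
  have -> : (char_poly (X - 1%:M)).[x] = (char_poly X).[x + 1].
    by rewrite !horner_char_poly [(x + 1)%:M]raddfD /= opprB addrA.
  by rewrite XE hornerM horner_exp !hornerE addrK.
have := congr1 (horner^~ 0) eq_p'.
rewrite /= !hornerM horner_comp !horner_char_poly.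
have scalar0 m : (0%:M : 'M[F]_m) = 0.
  by apply/matrixP => i j; rewrite !mxE mul0rn.
have detN m (M : 'M[F]_m) : \det (- M) = (-1) ^+ m * \det M.
  by rewrite -scaleN1r detZ.
rewrite !scalar0 !sub0r !detN -signr_odd (negPf n_even) mul1r => ->.
rewrite hornerD hornerX hornerC add0r; set u := (-1) ^+ k.
have uu : u * u = 1 by rewrite -expr2 sqrr_sign.
set a := \det (A *m E); set b := \det (L *m B).
have -> : s.[1] * (u * a) * (u * b) = u * u * (s.[1] * a * b) by ring.
by rewrite uu mul1r.
Qed.

Lemma det_rank_update (F : fieldType) n k (U : 'M[F]_(n, k)) (V : 'M[F]_(k, n)) :
  \det (1%:M + U *m V) = \det (1%:M + V *m U).
Proof.
have := det_sylvester (- U) V 1; rewrite !expr1n !mul1r.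
by rewrite mulNmx mulmxN !opprK.
Qed.

Section ReducedDeterminant.
Variables (R : realType) (n k : nat) (F : set_system R).
Context {FF : Filter F}.
Variables (K : R -> 'M[R]_n) (e : R -> 'cV[R]_n) (l : R -> 'rV[R]_n).
Variables (K0 : 'M[R]_n) (e0 : 'cV[R]_n) (l0 : 'rV[R]_n).
Variables (D : 'M[R]_(n, k)) (L : 'M[R]_(k, n)) (A : 'M[R]_k) (h : 'cV[R]_k).
Hypotheses (LD : L *m D = 1%:M) (K0D : K0 *m D = 0) (LK0 : L *m K0 = 0).
Hypotheses (l0D : l0 *m D = 0) (Le0 : L *m e0 = 0).
Hypothesis K_cvg : K r @[r --> F] --> K0.
Hypothesis e_cvg : e r @[r --> F] --> e0.
Hypothesis l_cvg : l r @[r --> F] --> l0.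
Hypothesis LK_cvg : r ^- 2 *: (L *m K r) @[r --> F] --> A *m L.
Hypothesis Le_cvg : r ^- 2 *: (L *m e r) @[r --> F] --> h.

(** The transposes of e0 and l0, corrected by the projection D L so that the
    first vanishes on D and the second has no component along D. *)
Definition defl_row := e0^T *m (1%:M - D *m L).
Definition defl_col := (1%:M - D *m L) *m l0^T.

Lemma defl_rowD : defl_row *m D = 0.
Proof. by rewrite -mulmxA mulmxBl mul1mx -mulmxA LD mulmx1 subrr mulmx0. Qed.

Lemma defl_colL : L *m defl_col = 0.
Proof. by rewrite mulmxA mulmxBr mulmx1 mulmxA LD mul1mx subrr mul0mx. Qed.

(** The determinant is of order r^(2 k), because L K r and L e r are of order
    r^2. Left multiplication by 1 + (r^-2 - 1) D L, of determinant r^(-2 k),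
    rescales exactly the directions D, and everything then has a limit. *)
Lemma reduced_det_limit :
  (r ^- 2) ^+ k * \det (K r + e r *m defl_row + defl_col *m l r) @[r --> F] -->
  \det A * \det (K0 + D *m L + e0 *m defl_row + defl_col *m l0).
Proof.
move: defl_rowD defl_colL; move: defl_row defl_col => a b aD Lb.
pose S r := 1%:M + D *m ((r ^- 2 - 1) *: L).
have S_det r : \det (S r) = (r ^- 2) ^+ k.
  rewrite det_rank_update -scalemxAl LD scalemx1 -raddfD /=.
  by rewrite addrC subrK det_scalar.
pose N0 := K0 + D *m L + e0 *m a + b *m l0.
have -> : \det A * \det N0 =
    \det (K0 + D *m (A *m L) + (e0 + D *m h) *m a + b *m l0).
  have <- : N0 *m (1%:M + D *m ((A - 1%:M) *m L + h *m a)) =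
      K0 + D *m (A *m L) + (e0 + D *m h) *m a + b *m l0.
    have N0D : N0 *m D = D.
      rewrite !mulmxDl K0D -!mulmxA LD l0D aD !mulmx0 mulmx1.
      by rewrite !addr0 add0r.
    rewrite mulmxDr mulmx1 mulmxA N0D mulmxDr mulmxBl mul1mx mulmxBr mulmxDl.
    rewrite /N0 -!mulmxA; move: (K0) (D *m L) (e0 *m a) (b *m l0) => x1 x2 x3 x4.
    move: (D *m (A *m L)) (D *m (h *m a)) => x5 x6.
    by apply/matrixP => i j; rewrite !mxE; ring.
  rewrite det_mulmx det_rank_update mulrC; congr (_ * _); congr (\det _).
  rewrite mulmxDl -!mulmxA LD aD mulmx0 mulmx1 addr0.
  by rewrite addrC subrK.
have S_lim : S r *m (K r + e r *m a + b *m l r) @[r --> F] -->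
    K0 + D *m (A *m L) + (e0 + D *m h) *m a + b *m l0.
  have S_M m r (M : 'M[R]_(n, m)) :
      S r *m M = M - D *m (L *m M) + D *m (r ^- 2 *: (L *m M)).
    rewrite mulmxDl mul1mx -mulmxA -scalemxAl scalerBl scale1r mulmxBr.
    by rewrite addrA addrAC.
  have S_cvg m (M : R -> 'M[R]_(n, m)) (M0 : 'M[R]_(n, m)) (c : 'M[R]_(k, m)) :
      L *m M0 = 0 -> M r @[r --> F] --> M0 ->
      r ^- 2 *: (L *m M r) @[r --> F] --> c ->
      S r *m M r @[r --> F] --> M0 + D *m c.
    move=> LM0 M_cvg LM_cvg; under eq_cvg do rewrite S_M.
    rewrite -[X in X + _]subr0 -(mulmx0 _ D) -[X in _ - D *m X]LM0.
    apply: cvgD; [apply: cvgB => //|]; apply: cvg_mulmx => //; try exact: cvg_cst.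
    by apply: cvg_mulmx => //; exact: cvg_cst.
  have -> : (fun r => S r *m (K r + e r *m a + b *m l r)) =
      (fun r => S r *m K r + (S r *m e r) *m a + b *m l r).
    apply/funext => r; rewrite !mulmxDr !mulmxA; congr (_ + _ *m _).
    by rewrite S_M Lb scaler0 mulmx0 subr0 addr0.
  apply: cvgD; [apply: cvgD|]; [exact: S_cvg| |].
    by apply: cvg_mulmx; [exact: S_cvg | exact: cvg_cst].
  by apply: cvg_mulmx; [exact: cvg_cst | exact: l_cvg].
under eq_cvg do rewrite -S_det -det_mulmx.
exact: cvg_det.
Qed.

End ReducedDeterminant.

Lemma size_recip_term (F : fieldType) n k : (k <= n)%N ->
  (size ('X^(n - k) * ('X^2 + 1) ^+ k : {poly F})%R <= (n + k).+1)%N.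
Proof.
move=> kn; apply: leq_trans (size_polyMleq _ _) _.
rewrite size_polyXn addSn /=.
have size2 : (size ('X^2 + 1 : {poly F})%R <= 3)%N.
  by rewrite size_polyDl size_polyXn // size_poly1.
have := size_poly_exp_leq ('X^2 + 1 : {poly F}) k => size_pow.
rewrite (leq_trans (leq_add (leqnn _) size_pow)) // addnS ltnS.
case: (size _) size2 => [|[|[|[|]]]] //= _; lia.
Qed.

Lemma size_recip (F : fieldType) n (c : {poly F}) :
  (size (recip n c) <= n.*2.+1)%N.
Proof.
apply: leq_trans (size_sum _ _ _) _; apply/bigmax_leqP => k _.
apply: leq_trans (size_scale_leq _ _) _.
apply: leq_trans (size_recip_term _ _) _; first by rewrite -ltnS.
by rewrite ltnS -addnn leq_add2l -ltnS.
Qed.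

Lemma lead_recip (F : fieldType) n (c : {poly F}) :
  (recip n c)`_(n.*2) = c`_n.
Proof.
rewrite /recip coef_sum big_ord_recr /= big1 => [|k _].
  rewrite add0r coefZ subnn mul1r.
  have monX : ('X^2 + 1 : {poly F}) \is monic.
    by rewrite monicE lead_coefDl ?lead_coefXn // size_polyXn size_poly1.
  have size_X : size (('X^2 + 1 : {poly F}) ^+ n) = n.*2.+1.
    have := size_exp ('X^2 + 1 : {poly F}) n.
    rewrite size_polyDl size_polyXn ?size_poly1 //= mul2n => <-.
    by rewrite prednK // size_poly_gt0 monic_neq0 // monic_exp.
  have := monicP (monic_exp n monX); rewrite lead_coefE size_X /= => ->.
  by rewrite mulr1.
rewrite coefZ [X in _ * X]nth_default ?mulr0 //.
rewrite (leq_trans (size_recip_term _ _)) // ?(ltnW (ltn_ord k)) //.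
by rewrite -addnn ltn_add2l.
Qed.

Lemma recip_factor (F : numFieldType) n (d : {poly F}) : (size d <= n.+1)%N ->
  recip n.+1 (('X - 2%:P) * d) = ('X - 1%:P) ^+ 2 * recip n d.
Proof.
move=> size_d; apply: poly_eq_nonzero => x x_neq0.
rewrite hornerM horner_exp !horner_recip //; last first.
  by rewrite (leq_trans (size_polyMleq _ _)) // size_XsubC.
rewrite hornerM !hornerXsubC exprS mulrACA mulrA [in RHS]mulrA.
by congr (_ * _ * _); field.
Qed.

Lemma horner_recip1 (F : numFieldType) n (d : {poly F}) :
  (size d <= n.+1)%N -> (recip n d).[1] = d.[2].
Proof.
by move=> size_d; rewrite horner_recip ?oner_eq0 // expr1n mul1r invr1.
Qed.

(** Values of c are linear in the coefficients of recip n c, and therefore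
    inherit their convergence. *)
Lemma recip_coord (R : rcfType) n (w : R) : exists kappa : nat -> R,
  forall c : {poly R}, (size c <= n.+1)%N ->
    c.[w] = \sum_(i < n.*2.+1) (recip n c)`_i * kappa i.
Proof.
have [x x_neq0 wx] := quadratic_root (real_complex R w).
exists (fun i => complex.Re (x ^- n * x ^+ i)) => c size_c.
have sC : (size (map_poly (real_complex R) c) <= n.+1)%N by rewrite size_map_poly.
have cE : real_complex R c.[w] =
    \sum_(i < n.*2.+1) real_complex R (recip n c)`_i * (x ^- n * x ^+ i).
  have := horner_map (real_complex R) c w; rewrite /= => <-.
  rewrite wx; apply: (mulfI (expf_neq0 n x_neq0)).
  rewrite -horner_recip // -map_recip.
  rewrite (@horner_coef_wide _ n.*2.+1) ?size_map_poly ?size_recip //.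
  rewrite big_distrr; apply: eq_bigr => i _ /=.
  rewrite coef_map [RHS]mulrCA; congr (_ * _).
  by rewrite mulrA mulfV ?expf_neq0 // mul1r.
rewrite -[LHS]/(complex.Re (real_complex R c.[w])) cE.
rewrite (big_morph (@complex.Re R) (id1 := 0) (op1 := +%R)) //; last by case=> ? ? [].
by apply: eq_bigr => i _; case: (x ^- n * x ^+ i) => u v /=; rewrite mul0r subr0.
Qed.

Lemma trace_poly_exists (R : rcfType) n N (W X : 'M[R]_n) : n = N.*2 ->
  W \in unitmx -> X^T *m W *m X = W -> \det X = 1 ->
  exists c : {poly R}, [/\ c \is monic, size c = N.+1 & char_poly X = recip N c].
Proof.
move=> nN W_unit X_symp X_det.
have [||c size_c pE] := @palindromic_recip _ N (char_poly X).
- by rewrite size_char_poly nN.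
- move=> x x_neq0; rewrite -nN; apply: symplectic_palindromic W_unit X_symp X_det _ x_neq0.
  by rewrite nN odd_double.
have cN : c`_N = 1.
  rewrite -lead_recip -pE -nN; have := monicP (char_poly_monic X).
  by rewrite lead_coefE size_char_poly.
have size_cE : size c = N.+1.
  apply/eqP; rewrite eqn_leq size_c ltnNge; apply/negP => size_cN.
  by move: cN => /eqP; rewrite nth_default // eq_sym oner_eq0.
by exists c; split=> //; rewrite monicE lead_coefE size_cE /= cN.
Qed.

Lemma filter_seqI (T : choiceType) (U : Type) (F : set_system U) (s : seq T)
    (P : T -> U -> Prop) : Filter F -> (forall w, w \in s -> F (P w)) ->
  F (fun r => forall w, w \in s -> P w r).
Proof.
move=> FF; elim: s => [|w s IHs] sP; first by apply: filterE.
have Fw := sP w (mem_head _ _).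
have Fs : F (fun r => forall v, v \in s -> P v r).
  by apply: IHs => v vs; apply: sP; rewrite inE vs orbT.
by apply: filterS2 Fw Fs => r Pw Ps v; rewrite inE => /orP[/eqP -> //|/Ps].
Qed.

(** * How the multiplier 1 of a symplectic limit splits *)

Section SpectralAlternative.
Variables (R : realType) (N n : nat) (F : set_system R).
Context {FF : ProperFilter F}.
Hypothesis nN : n = N.*2.
Variables (W : 'M[R]_n) (X : R -> 'M[R]_n) (e : R -> 'cV[R]_n) (l : R -> 'rV[R]_n).
Variables (X0 : 'M[R]_n) (e0 : 'cV[R]_n) (l0 : 'rV[R]_n).
Variables (D : 'M[R]_(n, 2)) (L : 'M[R]_(2, n)) (A : 'M[R]_2) (h : 'cV[R]_2).
Hypotheses (W_unit : W \in unitmx) (LD : L *m D = 1%:M).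
Hypotheses (X0_symp : X0^T *m W *m X0 = W) (X0_det : \det X0 = 1).
Hypotheses (X0D : (X0 - 1%:M) *m D = 0) (LX0 : L *m (X0 - 1%:M) = 0).
Hypotheses (X0e0 : (X0 - 1%:M) *m e0 = 0) (l0X0 : l0 *m (X0 - 1%:M) = 0).
Hypotheses (l0e0 : l0 *m e0 = 0) (l0D : l0 *m D = 0) (Le0 : L *m e0 = 0).
Hypotheses (e0_neq0 : e0 != 0) (l0_neq0 : l0 != 0).
Hypothesis X_prop : F [set r | [/\ r != 0, (X r)^T *m W *m X r = W /\ \det (X r) = 1,
  (X r - 1%:M) *m e r = 0, l r *m (X r - 1%:M) = 0 & l r *m e r = 0]].
Hypothesis X_cvg : X r @[r --> F] --> X0.
Hypothesis e_cvg : e r @[r --> F] --> e0.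
Hypothesis l_cvg : l r @[r --> F] --> l0.
Hypothesis LX_cvg : r ^- 2 *: (L *m (X r - 1%:M)) @[r --> F] --> A *m L.
Hypothesis Le_cvg : r ^- 2 *: (L *m e r) @[r --> F] --> h.
Notation toC := (real_complex R).
Hypothesis X0_circle : spectrum_on_circle (map_mx toC X0).
Hypothesis X0_four : algebraic_multiplicity (map_mx toC X0) 1 = 4%N.
Hypothesis X0_simple : other_multipliers_simple (map_mx toC X0).

Let a := defl_row e0 D L.
Let b := defl_col l0 D L.
Let f r := \det (X r - 1%:M + e r *m a + b *m l r).

Lemma mx11_gram (m : nat) (v : 'cV[R]_m) : v != 0 -> 0 < \det (v^T *m v).
Proof.
move=> v_neq0; rewrite det_mx11 mxE lt_neqAle sumr_ge0 => [|i _]; last first.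
  by rewrite mxE -expr2 sqr_ge0.
rewrite andbT eq_sym; apply: contra v_neq0 => /eqP v0; apply/eqP/colP => i.
have v_ge0 (j : 'I_m) : true -> 0 <= v^T 0 j * v j 0 by rewrite mxE -expr2 sqr_ge0.
have := psumr_eq0P v_ge0 v0 (i := i) isT.
by rewrite !mxE => /eqP; rewrite mulf_eq0 orbb => /eqP.
Qed.

Lemma ae0_gt0 : 0 < \det (a *m e0).
Proof.
rewrite /a /defl_row -mulmxA mulmxBl mul1mx -mulmxA Le0 mulmx0 subr0.
exact: mx11_gram.
Qed.

Lemma l0b_gt0 : 0 < \det (l0 *m b).
Proof.
rewrite /b /defl_col mulmxA mulmxBr mulmx1 mulmxA l0D mul0mx subr0.
by rewrite -{1}[l0]trmxK mx11_gram // trmx_eq0.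
Qed.

Lemma stable_start : exists ys : seq R, [/\
  char_poly X0 = recip N (\prod_(y <- [:: 2, 2 & ys]) ('X - y%:P)),
  N = (size ys).+2, uniq ys & forall y, y \in ys -> - 2 < y < 2].
Proof.
have [c0 [c0_mon size_c0 c0E]] := trace_poly_exists nN W_unit X0_symp X0_det.
have pC : map_poly toC (recip N c0) = char_poly (map_mx toC X0).
  by rewrite -c0E map_char_poly.
have [|||ys [cE ys_uniq ys_bound]] := stable_trace_poly c0_mon size_c0.
- by rewrite pC => z; rewrite -eigenvalue_root_char; exact: X0_circle.
- by rewrite pC; exact: X0_four.
- by rewrite pC => z; rewrite -eigenvalue_root_char; exact: X0_simple.
have cE' : c0 = \prod_(y <- [:: 2, 2 & ys]) ('X - y%:P).
  by rewrite cE !big_cons expr2 mulrA.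
exists ys; split=> //; first by rewrite -cE'.
by apply/eqP; rewrite -eqSS -size_c0 cE' size_prod_XsubC.
Qed.

(** X0 + D L has a double multiplier 2 in place of two of the four multipliers
    1. Deflating the other two by e0 and l0 leaves the product of the numbers
    2 - y over the remaining roots y < 2 of the trace polynomial. *)
Lemma start_det_gt0 : 0 < \det (X0 - 1%:M + D *m L + e0 *m a + b *m l0).
Proof.
have [ys [p0E NE _ ys_bound]] := stable_start.
pose q := \prod_(y <- ys) ('X - y%:P).
have size_q : size q = (size ys).+1 by rewrite size_prod_XsubC.
have p0E' : char_poly X0 = ('X - 1%:P) ^+ 4 * recip (size ys) q.
  rewrite p0E !big_cons NE recip_factor; last first.
    by rewrite (leq_trans (size_polyMleq _ _)) // size_XsubC size_prod_XsubC.
  by rewrite recip_factor ?size_q // mulrA -exprD.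
pose s := recip (size ys) q * ('X - 2%:P) ^+ 2.
have XE : char_poly (X0 + D *m L) = ('X - 1%:P) ^+ (1 + 1) * s.
  have := deflation_right L X0D; rewrite LD => eq_p.
  have X1_neq0 : ('X - 1%:P : {poly R}) ^+ 2 != 0.
    by rewrite expf_neq0 // polyXsubC_eq0.
  apply: (mulfI X1_neq0); apply: poly_eq_nonzero => x _.
  have hp (m : nat) (c : R) : (('X - c%:P) ^+ m).[x] = (x - c) ^+ m.
    by rewrite horner_exp hornerXsubC.
  have := congr1 (horner^~ (x - 1)) eq_p; rewrite /= hornerM hornerXn hornerM.
  rewrite !horner_char_poly.
  have -> : (x - 1)%:M - (X0 - 1%:M + D *m L) = x%:M - (X0 + D *m L).
    by rewrite [(x - 1)%:M]raddfB /= [X0 - 1%:M + _]addrAC opprB addrA subrK.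
  have -> : (x - 1)%:M - (X0 - 1%:M) = x%:M - X0.
    by rewrite [(x - 1)%:M]raddfB /= opprB addrA subrK.
  rewrite -raddfB /= det_scalar -!horner_char_poly p0E' => eq_x.
  rewrite hornerM hp eq_x hornerM hp [in RHS]mulrA -exprD hornerM hp /s.
  by rewrite [in RHS]hornerM hp; ring.
have XDe : (X0 + D *m L - 1%:M) *m e0 = 0.
  by rewrite addrAC mulmxDl X0e0 -mulmxA Le0 mulmx0 addr0.
have lXD : l0 *m (X0 + D *m L - 1%:M) = 0.
  by rewrite addrAC mulmxDr l0X0 mulmxA l0D mul0mx addr0.
have n_even : ~~ odd n by rewrite nN odd_double.
have := deflated_det a b n_even XDe lXD l0e0 XE.
rewrite [X0 + D *m L - 1%:M]addrAC => <-.
rewrite !pmulr_lgt0 ?ae0_gt0 ?l0b_gt0 // /s hornerM horner_recip1 ?size_q //.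
rewrite horner_exp hornerXsubC.
have -> : (1 - 2) ^+ 2 = 1 :> R by ring.
rewrite mulr1 horner_prod.
rewrite big_seq prodr_gt0 // => y /ys_bound/andP[_ y2].
by rewrite hornerXsubC subr_gt0.
Qed.

Lemma pos_cvg (g : R -> R) c : g r @[r --> F] --> c -> 0 < c -> F [set r | 0 < g r].
Proof. by move=> gc c_gt0; apply: (cvgr_gt _ gc). Qed.

Lemma near_e_pos : F [set r | 0 < \det (a *m e r)].
Proof.
apply: (@pos_cvg _ (\det (a *m e0))); last exact: ae0_gt0.
by apply: cvg_det; apply: cvg_mulmx => //; exact: cvg_cst.
Qed.

Lemma near_l_pos : F [set r | 0 < \det (l r *m b)].
Proof.
apply: (@pos_cvg _ (\det (l0 *m b))); last exact: l0b_gt0.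
by apply: cvg_det; apply: cvg_mulmx => //; exact: cvg_cst.
Qed.

(** The null vectors e r and l r account for one root 2 of the trace polynomial;
    the value at 2 of its cofactor d is f r, up to the positive factors
    a (e r) and (l r) b. *)
Lemma near_reduced_trace : F [set r | exists d : {poly R}, [/\ d \is monic,
  size d = N, char_poly (X r) = recip N (('X - 2%:P) * d),
  0 < f r -> 0 < d.[2] & f r < 0 -> d.[2] < 0]].
Proof.
apply: filterS3 X_prop near_e_pos near_l_pos.
move=> r [r_neq0 [X_symp X_det] Xe lX le] ae lb.
have [c [c_mon size_c cE]] := trace_poly_exists nN W_unit X_symp X_det.
have c2 : c.[2] = 0.
  rewrite -(@horner_recip1 _ N) ?size_c // -cE horner_char_poly.
  apply/eqP/det0P; exists (l r).
    by apply: contraTneq lb => ->; rewrite mul0mx det0 ltxx.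
  by rewrite -[_ - _]opprB mulmxN lX oppr0.
have /factor_theorem[d cd] : root c 2 by apply/rootP.
have d_neq0 : d != 0.
  by apply: contraTneq c_mon => d0; rewrite cd d0 mul0r monicE lead_coef0 eq_sym oner_eq0.
have size_d : size d = N.
  by apply/eqP; rewrite -eqSS -size_c cd size_Mmonic ?monicXsubC // size_XsubC addn2.
have [M NM] : exists M, N = M.+1.
  by exists N.-1; rewrite prednK // -size_d size_poly_gt0.
have XE : char_poly (X r) = ('X - 1%:P) ^+ (1 + 1) * recip M d.
  by rewrite cE NM cd mulrC recip_factor // size_d NM.
have n_even : ~~ odd n by rewrite nN odd_double.
have := deflated_det a b n_even Xe lX le XE; rewrite horner_recip1 ?size_d ?NM // => fE.
have f_sign : f r = d.[2] * (\det (a *m e r) * \det (l r *m b)).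
  by rewrite mulrA fE.
have pos := mulr_gt0 ae lb.
exists d; split=> //; rewrite ?f_sign ?pmulr_lgt0 ?pmulr_llt0 //.
- by move: c_mon; rewrite cd monicMr ?monicXsubC.
- by rewrite size_d.
- by rewrite cE cd NM mulrC.
Qed.

Lemma near_f_sign c : 0 < c * \det A -> F [set r | 0 < c * f r].
Proof.
move=> cA.
have F_neq0 : F [set r | r != 0] by apply: filterS X_prop => r [].
have X1_cvg : X r - 1%:M @[r --> F] --> X0 - 1%:M.
  by apply: cvgB => //; exact: cvg_cst.
have f_cvg : (r ^- 2) ^+ 2 * f r @[r --> F] -->
    \det A * \det (X0 - 1%:M + D *m L + e0 *m a + b *m l0).
  exact: reduced_det_limit LX_cvg Le_cvg.
have cf_cvg : c * ((r ^- 2) ^+ 2 * f r) @[r --> F] -->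
    c * (\det A * \det (X0 - 1%:M + D *m L + e0 *m a + b *m l0)).
  by apply: cvgM; first exact: cvg_cst.
have lim_gt0 : 0 < c * (\det A * \det (X0 - 1%:M + D *m L + e0 *m a + b *m l0)).
  by rewrite mulrA pmulr_lgt0 ?start_det_gt0.
apply: filterS2 F_neq0 (pos_cvg cf_cvg lim_gt0) => r r_neq0; rewrite /= mulrCA pmulr_rgt0 //.
by rewrite exprn_even_gt0 ?orbT //= invr_eq0 expf_neq0.
Qed.

Lemma spectral_instability : \det A < 0 ->
  F [set r | ~ spectrum_on_circle (map_mx toC (X r))].
Proof.
move=> A_lt0; have := @near_f_sign (-1); rewrite mulN1r oppr_gt0 => /(_ A_lt0) f_neg.
apply: filterS2 near_reduced_trace f_neg => r [d [d_mon size_d dE _ d_neg]].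
rewrite /= mulN1r oppr_gt0 => /d_neg d2 X_circle.
have [|z z_root z_circle] := @trace_root_gt2_unstable _ N d d_mon _ d2.
  by rewrite size_d.
apply: z_circle; apply: X_circle; rewrite eigenvalue_root_char.
by rewrite -map_char_poly dE.
Qed.

Lemma spectral_stability : 0 < \det A ->
  F [set r | [/\ spectrum_on_circle (map_mx toC (X r)),
    algebraic_multiplicity (map_mx toC (X r)) 1 = 2%N &
    other_multipliers_simple (map_mx toC (X r))]].
Proof.
move=> A_gt0; have := @near_f_sign 1; rewrite mul1r => /(_ A_gt0) f_pos.
have [ys [p0E NE ys_uniq ys_bound]] := stable_start.
have s_uniq : uniq (2 :: ys).
  rewrite /= ys_uniq andbT; apply/negP => /ys_bound/andP[_].
  by rewrite ltxx.
have [ws ws_prop persist] := simple_roots_persist s_uniq ys_bound.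
set d0 := \prod_(y <- 2 :: ys) ('X - y%:P) in ws_prop persist.
have c0E : char_poly X0 = recip N (('X - 2%:P) * d0) by rewrite p0E big_cons.
have size_d0 : size d0 = N by rewrite size_prod_XsubC /= NE.
have size_c (d : {poly R}) : size d = N -> (size (('X - 2%:P) * d)%R <= N.+1)%N.
  by move=> dN; rewrite (leq_trans (size_polyMleq _ _)) // size_XsubC dN.
have ws_near : F (fun r => forall w, w \in ws -> forall d : {poly R}, size d = N ->
    char_poly (X r) = recip N (('X - 2%:P) * d) -> 0 < d.[w] * d0.[w]).
  apply: filter_seqI => w /ws_prop[w2 d0w].
  have [kappa kappaE] := recip_coord N w.
  have p_cvg : (\sum_(i < N.*2.+1) (char_poly (X r))`_i * kappa i) *
      (\sum_(i < N.*2.+1) (char_poly X0)`_i * kappa i) @[r --> F] -->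
      (\sum_(i < N.*2.+1) (char_poly X0)`_i * kappa i) ^+ 2.
    apply: cvgM; last exact: cvg_cst.
    apply: cvg_bigsum => i _; apply: cvgM; last exact: cvg_cst.
    exact: coef_cvg_char_poly.
  have := pos_cvg p_cvg; rewrite c0E -kappaE ?size_c // hornerM hornerXsubC.
  have c0w : (w - 2) * d0.[w] != 0 by rewrite mulf_neq0 // subr_eq0.
  rewrite exprn_even_gt0 //= c0w => /(_ isT); apply: filterS => r + d size_d dE.
  rewrite /= dE -kappaE ?size_c // hornerM hornerXsubC mulrACA -expr2.
  by rewrite pmulr_rgt0 // exprn_even_gt0 //= subr_eq0.
apply: filterS3 near_reduced_trace f_pos ws_near.
move=> r [d [d_mon size_d dE d_pos _]] fr dws.
rewrite /= mul1r in fr.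
have [||t [tE size_t t_uniq t_bound]] := persist d d_mon _ _ (d_pos fr).
- by rewrite size_d NE.
- by move=> w ws_w; apply: dws.
have [||circle two simple] :=
    @trace_roots_stable _ N (('X - 2%:P) * d) t _ _ t_uniq t_bound.
- by rewrite big_cons tE.
- by rewrite size_t NE.
have pE : map_poly toC (recip N (('X - 2%:P) * d)) = char_poly (map_mx toC (X r)).
  by rewrite -dE map_char_poly.
rewrite pE in circle two simple.
split; first by move=> z; rewrite eigenvalue_root_char; exact: circle.
  exact: two.
by move=> z; rewrite eigenvalue_root_char; exact: simple.
Qed.

End SpectralAlternative.

(** * Directional derivatives and functions of class C^k *)

Lemma dnbhs0_neq0 (R : realType) : (0 : R)^' [set t | t != 0].
Proof. by rewrite /dnbhs /within /=; apply: filterE. Qed.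

Lemma is_derive_linear (R : realType) (a t : R) : is_derive t 1 (fun s => a * s) a.
Proof.
have := @is_deriveZ _ _ _ id a t 1 1 (is_derive_id _ _).
by congr is_derive; rewrite /GRing.scale /= mulr1.
Qed.

Section DirectionalDerivatives.
Variables (R : realType) (V : normedModType R).
Implicit Types (f g : V -> R) (x y v w b : V) (U : set V).

Lemma derive_lineE f x v t :
  'D_v f (t *: v + x) = 'D_1 (fun s : R => f (s *: v + x)) t.
Proof.
rewrite /derive; set g1 := fun h => h^-1 *: _; set g2 := fun h => h^-1 *: _.
suff -> : g1 = g2 by [].
apply/funext => h; rewrite /g1 /g2 /=.
by rewrite addrA -scalerDl [h *: (1 : R^o)]mulr1.
Qed.

Lemma derivable_line f x v t :
  derivable f (t *: v + x) v <-> derivable (fun s : R => f (s *: v + x)) t 1.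
Proof.
rewrite /derivable; set g1 := fun h => h^-1 *: _; set g2 := fun h => h^-1 *: _.
suff -> : g1 = g2 by [].
apply/funext => h; rewrite /g1 /g2 /=.
by rewrite addrA -scalerDl [h *: (1 : R^o)]mulr1.
Qed.

Lemma is_derive_line f x v t d :
  is_derive (t *: v + x) v f d <-> is_derive t 1 (fun s : R => f (s *: v + x)) d.
Proof.
split=> [[fv <-]|[fv <-]]; apply: DeriveDef.
- exact/derivable_line.
- by rewrite derive_lineE.
- exact/derivable_line.
- by rewrite derive_lineE.
Qed.

Lemma is_derive_line0 f x v d :
  is_derive x v f d <-> is_derive (0 : R) 1 (fun s : R => f (s *: v + x)) d.
Proof. by rewrite -is_derive_line scale0r add0r. Qed.

Lemma is_derive_scale f x v d (a : R) :
  is_derive x v f d -> is_derive x (a *: v) f (a * d).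
Proof.
move=> /is_derive_line0 fd; apply/is_derive_line0.
have -> : (fun s : R => f (s *: (a *: v) + x)) =
    (fun s : R => f (s *: v + x)) \o (fun s : R => a * s).
  by apply/funext => s /=; rewrite scalerA mulrC.
rewrite mulrC; apply: is_derive1_comp; first by rewrite mulr0.
exact: is_derive_linear.
Qed.

Lemma deriveZ_dir f x v (a : R) : derivable f x v ->
  derivable f x (a *: v) /\ 'D_(a *: v) f x = a * 'D_v f x.
Proof.
move=> /derivableP/(is_derive_scale a) fd; split; first exact: ex_derive.
exact: derive_val.
Qed.

Lemma mvt_dir_open f x v :
  (forall t : R, 0 <= t <= 1 -> derivable f (t *: v + x) v) ->
  exists2 t : R, 0 < t < 1 & f (v + x) - f x = 'D_v f (t *: v + x).
Proof.
move=> fv; pose phi (s : R) := f (s *: v + x).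
have phi_der (t : R) : t \in `]0, 1[ -> is_derive t 1 phi ('D_v f (t *: v + x)).
  rewrite in_itv /= => /andP[t0 t1]; apply/is_derive_line/derivableP/fv.
  by rewrite !ltW.
have phi_cont : {within `[0, 1], continuous phi}.
  apply: derivable_within_continuous => t; rewrite in_itv /= => t01.
  exact/derivable_line/fv.
have [t + eq_t] := MVT ltr01 phi_der phi_cont.
rewrite in_itv /= => t01; exists t => //.
by move: eq_t; rewrite /phi subr0 mulr1 scale1r scale0r add0r.
Qed.

Lemma mvt_dir f x v :
  (forall t : R, 0 <= t <= 1 -> derivable f (t *: v + x) v) ->
  exists2 t : R, 0 <= t <= 1 & f (v + x) - f x = 'D_v f (t *: v + x).
Proof.
move=> /mvt_dir_open[t /andP[t0 t1] eq_t]; exists t => //.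
by rewrite !ltW.
Qed.

(** The mean value theorem with moving base point y t. The intermediate point
    is picked by xget, which makes it a function of t. *)
Lemma step_limit U f x b (T : Type) (F : set_system T) (FF : Filter F)
    (h c : T -> R) (y : T -> V) (c0 : R) :
  open U -> U x -> (forall z, U z -> derivable f z b) ->
  {for x, continuous ('D_b f)} ->
  h t @[t --> F] --> (0 : R) -> F [set t | h t != 0] ->
  c t @[t --> F] --> c0 -> y t @[t --> F] --> x ->
  (h t)^-1 * (f ((h t * c t) *: b + y t) - f (y t)) @[t --> F] --> c0 * 'D_b f x.
Proof.
move=> U_open Ux f_der f_cont h_cvg h_neq0 c_cvg y_cvg.
pose rad t := `|h t * c t| * `|b| + `|y t - x|.
pose A t := [set z | `|z - x| <= rad t /\
  (h t)^-1 * (f ((h t * c t) *: b + y t) - f (y t)) = c t * 'D_b f z].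
pose xi t := xget x (A t).
have rad_ge0 t : 0 <= rad t by rewrite addr_ge0 // mulr_ge0.
have rad_cvg : rad t @[t --> F] --> (0 : R).
  have -> : (0 : R) = `|0 * c0| * `|b| + `|x - x|.
    by rewrite mul0r normr0 mul0r subrr normr0 addr0.
  apply: cvgD; first by apply: cvgM; [apply: cvg_norm; exact: cvgM|exact: cvg_cst].
  by apply: cvg_norm; apply: cvgB => //; exact: cvg_cst.
have xi_rad t : `|xi t - x| <= rad t.
  rewrite /xi; case: xgetP => [z _ [] //|_]; by rewrite subrr normr0.
have xi_cvg : xi t @[t --> F] --> x.
  apply/cvgrPdist_le => e e_gt0; have /cvgrPdist_le/(_ _ e_gt0) := rad_cvg.
  apply: filterS => t; rewrite sub0r normrN ger0_norm // => rad_e.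
  by rewrite distrC (le_trans (xi_rad t)).
have xi_eq : F (fun t => (h t)^-1 * (f ((h t * c t) *: b + y t) - f (y t)) =
    c t * 'D_b f (xi t)).
  have [e /= e_gt0 ball_U] : nbhs_ball x U by rewrite nbhs_ballE; exact: open_nbhs_nbhs.
  have rad_small : F (fun t => rad t < e) by exact: (cvgr_lt _ rad_cvg).
  apply: filterS2 h_neq0 rad_small => t ht rt; rewrite /xi.
  case: xgetP => [z _ [] //|/forallNP /= noA]; exfalso.
  have in_U (s : R) : 0 <= s <= 1 -> U (s *: ((h t * c t) *: b) + y t).
    move=> /andP[s0 s1]; apply: ball_U; rewrite -ball_normE /= distrC.
    rewrite (le_lt_trans _ rt) // -addrA (le_trans (ler_normD _ _)) //.
    by rewrite lerD2r !normrZ ler_piMl ?mulr_ge0 // ger0_norm.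
  have [|s s01 fs] := @mvt_dir f (y t) ((h t * c t) *: b).
    by move=> s s01; apply: (deriveZ_dir _ _).1; apply/f_der/in_U.
  apply: noA; exists (s *: ((h t * c t) *: b) + y t); split.
    case/andP: s01 => s0 s1; rewrite -addrA (le_trans (ler_normD _ _)) //.
    by rewrite lerD2r !normrZ ler_piMl ?mulr_ge0 // ger0_norm.
  rewrite fs (deriveZ_dir _ _).2; last exact/f_der/in_U.
  by rewrite !mulrA mulVf // mul1r.
apply: cvg_trans (_ : c t * 'D_b f (xi t) @[t --> F] --> c0 * 'D_b f x).
  apply: near_eq_cvg; apply: filterS xi_eq => t ->; by [].
by apply: cvgM => //; apply: cvg_comp xi_cvg f_cont.
Qed.

Lemma Ck1_derivable U f x v : Ck_on 1 U f -> U x -> derivable f x v.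
Proof. by move=> [_ /(_ v)[+ _]]; apply. Qed.

Lemma Ck1_continuous U f x v : Ck_on 1 U f -> U x -> {for x, continuous ('D_v f)}.
Proof. by move=> [_ /(_ v)[_ [+ _]]]; apply. Qed.

Lemma Ck_onS k U f : Ck_on k.+1 U f -> Ck_on k U f.
Proof.
elim: k f => [|k IHk] f /= [f_cont f_der]; split=> // v.
by have [fv Ckv] := f_der v; split=> //; exact: IHk.
Qed.

Lemma Ck_on_le k k' U f : (k' <= k)%N -> Ck_on k U f -> Ck_on k' U f.
Proof.
by elim: k => [|k IHk]; rewrite leq_eqVlt => /orP[/eqP ->|] // /IHk kf /Ck_onS.
Qed.

Lemma Ck_on_derive k U f v : Ck_on k.+1 U f -> Ck_on k U ('D_v f).
Proof. by move=> [_ /(_ v)[]]. Qed.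

Lemma Ck_on_continuous k U f x : Ck_on k U f -> U x -> {for x, continuous f}.
Proof. by case: k => [|k] [+ _]; apply. Qed.

Lemma derive_dirD U f x v w : open U -> Ck_on 1 U f -> U x ->
  'D_(v + w) f x = 'D_v f x + 'D_w f x.
Proof.
move=> U_open f_C1 Ux.
have step b (y : R -> V) : y h @[h --> 0^'] --> x ->
    h^-1 * (f ((h * 1) *: b + y h) - f (y h)) @[h --> 0^'] --> 1 * 'D_b f x.
  apply: (@step_limit U) => //.
  - by move=> z Uz; exact: Ck1_derivable f_C1 Uz.
  - exact: Ck1_continuous f_C1 Ux.
  - exact: nbhs_dnbhs.
  - exact: dnbhs0_neq0.
  - exact: cvg_cst.
have v_cvg : h *: v + x @[h --> (0 : R)^'] --> x.
  rewrite -[X in _ --> X]add0r -(scale0r v); apply: cvgD; last exact: cvg_cst.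
  by apply: cvgZr_tmp; exact: nbhs_dnbhs.
have x_cvg : cst x h @[h --> (0 : R)^'] --> x by exact: cvg_cst.
have sum_cvg : h^-1 * (f (h *: (v + w) + x) - f x) @[h --> (0 : R)^'] -->
    1 * 'D_v f x + 1 * 'D_w f x.
  have eq_q h : h^-1 * (f (h *: (v + w) + x) - f x) =
      h^-1 * (f ((h * 1) *: v + cst x h) - f (cst x h)) +
      h^-1 * (f ((h * 1) *: w + (h *: v + x)) - f (h *: v + x)).
    rewrite !mulr1 -mulrDr; congr (_ * _).
    by rewrite /= scalerDr -addrA addrCA; ring.
  by rewrite (eq_cvg _ _ eq_q); apply: cvgD; apply: step.
rewrite !mul1r in sum_cvg.
exact: cvg_lim sum_cvg.
Qed.

Lemma derive_dir_sum U f x I (s : seq I) (v : I -> V) (c : I -> R) :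
  open U -> Ck_on 1 U f -> U x ->
  'D_(\sum_(i <- s) c i *: v i) f x = \sum_(i <- s) c i * 'D_(v i) f x.
Proof.
move=> U_open f_C1 Ux; elim: s => [|i s IHs].
  by rewrite !big_nil derive0.
rewrite !big_cons (derive_dirD _ _ U_open f_C1 Ux) IHs; congr (_ + _).
apply: (deriveZ_dir _ _).2; exact: Ck1_derivable f_C1 Ux.
Qed.

(** The mean value theorem, applied to the increment of f in the direction v and
    then to the derivative of f along w. The symmetry of the left-hand side in
    v and w gives the symmetry of second derivatives. *)
Lemma second_difference U f x v w : open U -> Ck_on 2 U f -> U x ->
  (h ^+ 2)^-1 * (f (h *: w + (h *: v + x)) - f (h *: w + x) - f (h *: v + x) + f x)
    @[h --> (0 : R)^'] --> 'D_v ('D_w f) x.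
Proof.
move=> U_open f_C2 Ux.
have f_C1 := Ck_onS f_C2; have fw_C1 := Ck_on_derive w f_C2.
pose q h := (h ^+ 2)^-1 * (f (h *: w + (h *: v + x)) - f (h *: w + x) - f (h *: v + x) + f x).
pose A h := [set z | `|z - x| <= `|h| * (`|v| + `|w|) /\ q h = 'D_v ('D_w f) z].
pose xi h := xget x (A h).
have xi_rad h : `|xi h - x| <= `|h| * (`|v| + `|w|).
  rewrite /xi; case: xgetP => [z _ [] //|_].
  by rewrite subrr normr0 mulr_ge0 ?addr_ge0.
have rad_cvg : `|h| * (`|v| + `|w|) @[h --> (0 : R)^'] --> (0 : R).
  rewrite -[X in _ --> X](mul0r (`|v| + `|w|)) -[X in X * _](@normr0 _ R).
  by apply: cvgM; [apply: cvg_norm; exact: nbhs_dnbhs|exact: cvg_cst].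
have xi_cvg : xi h @[h --> (0 : R)^'] --> x.
  apply/cvgrPdist_le => e e_gt0; have /cvgrPdist_le/(_ _ e_gt0) := rad_cvg.
  apply: filterS => t; rewrite sub0r normrN ger0_norm ?mulr_ge0 ?addr_ge0 // => rad_e.
  by rewrite distrC (le_trans (xi_rad t)).
have xi_eq : \forall h \near (0 : R)^', q h = 'D_v ('D_w f) (xi h).
  have [e /= e_gt0 ball_U] : nbhs_ball x U by rewrite nbhs_ballE; exact: open_nbhs_nbhs.
  have rad_small : \forall h \near (0 : R)^', `|h| * (`|v| + `|w|) < e by exact: (cvgr_lt _ rad_cvg).
  have h_neq0 : \forall h \near (0 : R)^', h != 0 by exact: nbhs_dnbhs_neq.
  apply: filterS2 h_neq0 rad_small => h h0 rh; rewrite /xi.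
  case: xgetP => [z _ [] //|/forallNP /= noA]; exfalso.
  have close (s t : R) : 0 <= s <= 1 -> 0 <= t <= 1 ->
      `|s *: (h *: v) + (t *: (h *: w) + x) - x| <= `|h| * (`|v| + `|w|).
    move=> /andP[s0 s1] /andP[t0 t1]; rewrite addrA addrK.
    rewrite (le_trans (ler_normD _ _)) // mulrDr !normrZ.
    by rewrite lerD // ler_piMl ?mulr_ge0 // ger0_norm.
  have in_U (s t : R) : 0 <= s <= 1 -> 0 <= t <= 1 -> U (s *: (h *: v) + (t *: (h *: w) + x)).
    move=> s01 t01; apply: ball_U; rewrite -ball_normE /= distrC.
    exact: le_lt_trans (close _ _ s01 t01) rh.
  have I0 : 0 <= (0 : R) <= 1 by rewrite lexx ler01.
  have I1 : 0 <= (1 : R) <= 1 by rewrite lexx ler01.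
  pose psi y := f (h *: v + y) - f y.
  have psi_der t : 0 <= t <= 1 -> is_derive (t *: (h *: w) + x) (h *: w) psi
      (h * ('D_w f (h *: v + (t *: (h *: w) + x)) - 'D_w f (t *: (h *: w) + x))).
    move=> t01; rewrite mulrBr; apply: is_deriveB; apply: is_derive_scale.
      apply/is_derive_line0.
      under eq_fun do rewrite addrCA.
      apply/is_derive_line0/derivableP; apply: Ck1_derivable f_C1 _.
      by have := in_U 1 t I1 t01; rewrite scale1r.
    apply/derivableP; apply: Ck1_derivable f_C1 _.
    by have := in_U 0 t I0 t01; rewrite scale0r add0r.
  have [|t t01 eq_t] := @mvt_dir psi x (h *: w).
    by move=> t t01; have [] := psi_der t t01.
  have [_ psi_t] := psi_der t t01; rewrite psi_t in eq_t.
  have [|s s01 eq_s] := @mvt_dir ('D_w f) (t *: (h *: w) + x) (h *: v).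
    move=> s s01; apply: (deriveZ_dir _ _).1; apply: Ck1_derivable fw_C1 _.
    exact: in_U.
  rewrite (deriveZ_dir _ _).2 in eq_s; last first.
    by apply: Ck1_derivable fw_C1 _; exact: in_U.
  apply: noA; exists (s *: (h *: v) + (t *: (h *: w) + x)); split; first exact: close.
  rewrite eq_s in eq_t; rewrite /q.
  have -> : f (h *: w + (h *: v + x)) - f (h *: w + x) - f (h *: v + x) + f x =
      psi (h *: w + x) - psi x.
    by rewrite /psi addrCA; ring.
  by rewrite eq_t mulrA -expr2 mulrA mulVf ?mul1r // expf_neq0.
apply: cvg_trans (_ : 'D_v ('D_w f) (xi h) @[h --> (0 : R)^'] --> 'D_v ('D_w f) x).
  by apply: near_eq_cvg; apply: filterS xi_eq => h; rewrite /q => ->.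
have fvw_cont := @Ck1_continuous U ('D_w f) x v fw_C1 Ux.
exact: (cvg_comp _ _ xi_cvg fvw_cont).
Qed.

Lemma derive_sym U f x v w : open U -> Ck_on 2 U f -> U x ->
  'D_v ('D_w f) x = 'D_w ('D_v f) x.
Proof.
move=> U_open f_C2 Ux.
have vw := @second_difference U f x v w U_open f_C2 Ux.
have wv := @second_difference U f x w v U_open f_C2 Ux.
have eq_q h : (h ^+ 2)^-1 * (f (h *: v + (h *: w + x)) - f (h *: v + x) - f (h *: w + x) + f x)
    = (h ^+ 2)^-1 * (f (h *: w + (h *: v + x)) - f (h *: w + x) - f (h *: v + x) + f x).
  by congr (_ * _); rewrite [h *: v + (h *: w + x)]addrCA; ring.
rewrite (eq_cvg _ _ eq_q) in wv.
by apply: (cvg_unique _ vw wv); exact: norm_hausdorff.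
Qed.

Lemma open_near_eq U f g x : open U -> U x -> (forall y, U y -> f y = g y) ->
  \near x, f x = g x.
Proof. by move=> U_open Ux fg; apply: filterS (open_nbhs_nbhs (conj U_open Ux)). Qed.

Lemma Ck_on_eq k U f g : open U -> (forall x, U x -> f x = g x) ->
  Ck_on k U f -> Ck_on k U g.
Proof.
move=> U_open; elim: k f g => [|k IHk] f g fg /= [f_cont f_der].
all: have near_fg x (Ux : U x) := open_near_eq U_open Ux fg.
all: have g_cont x : U x -> {for x, continuous g}.
1, 3: move=> Ux; rewrite /prop_for /continuous_at -fg //.
1, 2: by apply: cvg_trans (f_cont x Ux); apply: near_eq_cvg; exact: near_fg.
- by split.
- split=> // v; have [fv Ckv] := f_der v; split.
    by move=> x Ux; apply: near_eq_derivable (near_fg x Ux) (fv x Ux).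
  apply: IHk Ckv => x Ux; exact: near_eq_derive (near_fg x Ux).
Qed.

Lemma Ck_on_cst k U (c : R) : Ck_on k U (fun=> c).
Proof.
elim: k c => [|k IHk] c /=; split=> //; try by move=> x _; apply: cvg_cst.
move=> v; split=> [x _|]; first exact: derivable_cst.
have -> : 'D_v (fun=> c) = fun=> 0 by apply/funext => x; rewrite derive_cst.
exact: IHk.
Qed.

Lemma Ck_onD k U f g : open U -> Ck_on k U f -> Ck_on k U g ->
  Ck_on k U (fun x => f x + g x).
Proof.
move=> U_open; elim: k f g => [|k IHk] f g /= [f_cont f_der] [g_cont g_der].
all: have fg_cont x : U x -> {for x, continuous (fun x => f x + g x)}.
1, 3: by move=> Ux; apply: cvgD; [exact: f_cont | exact: g_cont].
- by split.
- split=> // v; have [fv Cfv] := f_der v; have [gv Cgv] := g_der v; split.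
    by move=> x Ux; apply: derivableD; [exact: fv | exact: gv].
  apply: Ck_on_eq (IHk _ _ Cfv Cgv) => // x Ux.
  by rewrite deriveD //; [exact: fv | exact: gv].
Qed.

Lemma Ck_onZ k U f (c : R) : open U -> Ck_on k U f -> Ck_on k U (fun x => c * f x).
Proof.
move=> U_open; elim: k f => [|k IHk] f /= [f_cont f_der].
all: have cf_cont x : U x -> {for x, continuous (fun x => c * f x)}.
1, 3: by move=> Ux; apply: cvgM; [exact: cvg_cst | exact: f_cont].
- by split.
- split=> // v; have [fv Cfv] := f_der v; split.
    by move=> x Ux; apply: derivableZ; exact: fv.
  apply: Ck_on_eq (IHk _ Cfv) => // x Ux.
  by rewrite (@deriveZ _ _ _ f c) //; exact: fv.
Qed.

Lemma Ck_on_sum k U I (s : seq I) (P : pred I) (f : I -> V -> R) : open U ->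
  (forall i, P i -> Ck_on k U (f i)) -> Ck_on k U (fun x => \sum_(i <- s | P i) f i x).
Proof.
move=> U_open f_Ck; elim: s => [|i s IHs].
  by apply: Ck_on_eq (Ck_on_cst k U 0) => // x _; rewrite big_nil.
have [Pi|nPi] := boolP (P i).
  apply: Ck_on_eq (Ck_onD U_open (f_Ck i Pi) IHs) => // x _.
  by rewrite big_cons Pi.
by apply: Ck_on_eq IHs => // x _; rewrite big_cons (negPf nPi).
Qed.

End DirectionalDerivatives.

Section LinearPrecomposition.
Variables (R : realType) (V V' : normedModType R) (P : V' -> V).
Hypothesis P_lin : linear P.

Lemma derive_precomp (f : V -> R) v : 'D_v (f \o P) = 'D_(P v) f \o P.
Proof.
apply/funext => x; rewrite /derive /=.
set g1 := fun h => h^-1 *: _; set g2 := fun h => h^-1 *: _.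
suff -> : g1 = g2 by [].
by apply/funext => h; rewrite /g1 /g2 /= P_lin.
Qed.

Lemma derivable_precomp (f : V -> R) x v :
  derivable f (P x) (P v) -> derivable (f \o P) x v.
Proof.
rewrite /derivable; set g1 := fun h => h^-1 *: _; set g2 := fun h => h^-1 *: _.
suff -> : g1 = g2 by [].
by apply/funext => h; rewrite /g1 /g2 /= P_lin.
Qed.

Lemma Ck_on_precomp k U (f : V -> R) : continuous P ->
  Ck_on k U f -> Ck_on k (P @^-1` U) (f \o P).
Proof.
move=> P_cont; elim: k f => [|k IHk] f /= [f_cont f_der].
all: have fP_cont x : U (P x) -> {for x, continuous (f \o P)}.
1, 3: by move=> Ux; apply: continuous_comp; [exact: P_cont | exact: f_cont].
- by split.
- split=> // v; have [fv Cfv] := f_der (P v); split.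
    by move=> x Ux; apply: derivable_precomp; exact: fv.
  by rewrite derive_precomp; exact: IHk.
Qed.

End LinearPrecomposition.

Lemma mx_continuousP (R : realType) (T : topologicalType) m n (X : T -> 'M[R]_(m, n)) x :
  (forall i j, {for x, continuous (fun y => X y i j)}) -> {for x, continuous X}.
Proof.
move=> X_cont; apply: (proj2 (@cvg_mxP R T (nbhs x) _ m n X (X x))) => i j.
exact: X_cont.
Qed.

(** * Gradients and Hessians *)

Section ColumnVectors.
Variables (R : realType) (n : nat).
Implicit Types (f : 'cV[R]_n -> R) (x v w : 'cV[R]_n) (U : set 'cV[R]_n).

Lemma col_sum_delta v : v = \sum_(i <- index_enum 'I_n) v i 0 *: delta_mx i 0.
Proof.
apply/colP => i; rewrite summxE (bigD1 i) //= big1 ?addr0 => [|j ji].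
  by rewrite !mxE !eqxx mulr1.
by rewrite !mxE eq_sym (negPf ji) mulr0.
Qed.

Lemma derive_gradient U f x v : open U -> Ck_on 1 U f -> U x ->
  'D_v f x = ((gradient f x)^T *m v) 0 0.
Proof.
move=> U_open f_C1 Ux; rewrite {1}[v]col_sum_delta.
rewrite (derive_dir_sum _ _ _ U_open f_C1 Ux) mxE; apply: eq_bigr => i _.
by rewrite !mxE mulrC.
Qed.

Lemma derive_hessian U f x v w : open U -> Ck_on 2 U f -> U x ->
  'D_w ('D_v f) x = (w^T *m hessian f x *m v) 0 0.
Proof.
move=> U_open f_C2 Ux; have f_C1 := Ck_onS f_C2.
have Dv_near : \near x, 'D_v f x = \sum_(i < n) v i 0 * 'D_(delta_mx i 0) f x.
  apply: filterS (open_nbhs_nbhs (conj U_open Ux)) => y Uy.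
  by rewrite {1}[v]col_sum_delta (derive_dir_sum _ _ _ U_open f_C1 Uy).
rewrite (near_eq_derive _ Dv_near).
have Di_der i : derivable (fun y => v i 0 * 'D_(delta_mx i 0) f y) x w.
  by apply: derivableZ; exact: Ck1_derivable (Ck_on_derive _ f_C2) Ux.
have -> : (fun y => \sum_(i < n) v i 0 * 'D_(delta_mx i 0) f y) =
    \sum_(i < n) (fun y => v i 0 * 'D_(delta_mx i 0) f y).
  by apply/funext => y; rewrite fct_sumE.
rewrite derive_sum // mxE; apply: eq_bigr => j _.
have Dj_der : derivable ('D_(delta_mx j 0) f) x w.
  exact: Ck1_derivable (Ck_on_derive _ f_C2) Ux.
rewrite (@deriveZ _ _ _ ('D_(delta_mx j 0) f)) // mulrC; congr (_ * _).
rewrite {1}[w]col_sum_delta (derive_dir_sum _ _ _ U_open (Ck_on_derive _ f_C2) Ux) mxE.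
by apply: eq_bigr => i _; rewrite !mxE.
Qed.

Lemma hessian_sym U f x : open U -> Ck_on 2 U f -> U x ->
  (hessian f x)^T = hessian f x.
Proof.
move=> U_open f_C2 Ux; apply/matrixP => i j; rewrite !mxE.
exact: derive_sym U_open f_C2 Ux.
Qed.

Lemma hessian_continuous U f x : Ck_on 2 U f -> U x ->
  {for x, continuous (hessian f)}.
Proof.
move=> f_C2 Ux; apply/mx_continuousP => i j.
have -> : (fun y => hessian f y i j) = 'D_(delta_mx i 0) ('D_(delta_mx j 0) f).
  by apply/funext => y; rewrite mxE.
exact: Ck1_continuous (Ck_on_derive _ f_C2) Ux.
Qed.

Lemma gradient_continuous U f x : Ck_on 1 U f -> U x ->
  {for x, continuous (gradient f)}.
Proof.
move=> f_C1 Ux; apply/mx_continuousP => i j.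
have -> : (fun y => gradient f y i j) = 'D_(delta_mx i 0) f.
  by apply/funext => y; rewrite mxE.
exact: Ck1_continuous f_C1 Ux.
Qed.

(** Change one coordinate at a time: the partial derivatives are continuous, so
    that the direction may move with the step. *)
Lemma dir_limit U f x v (T : Type) (F : set_system T) (FF : Filter F)
    (h : T -> R) (w : T -> 'cV[R]_n) :
  open U -> Ck_on 1 U f -> U x ->
  h t @[t --> F] --> (0 : R) -> F [set t | h t != 0] ->
  w t @[t --> F] --> v ->
  (h t)^-1 * (f (h t *: w t + x) - f x) @[t --> F] --> 'D_v f x.
Proof.
move=> U_open f_C1 Ux h_cvg h_neq0 w_cvg.
have wi_cvg i : w t i 0 @[t --> F] --> v i 0 by move/cvg_mxP: w_cvg; apply.
pose W (s : seq 'I_n) t : 'cV[R]_n := \sum_(i <- s) w t i 0 *: delta_mx i 0.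
suff lim s : (h t)^-1 * (f (h t *: W s t + x) - f x) @[t --> F] -->
    \sum_(i <- s) v i 0 * 'D_(delta_mx i 0) f x.
  have := lim (index_enum 'I_n); rewrite -(derive_dir_sum _ _ _ U_open f_C1 Ux).
  by rewrite -col_sum_delta /W; under eq_cvg do rewrite -col_sum_delta.
elim: s => [|i s IHs].
  rewrite big_nil /W; under eq_cvg do rewrite big_nil scaler0 add0r subrr mulr0.
  exact: cvg_cst.
have W_cvg : h t *: W s t + x @[t --> F] --> x.
  rewrite -[X in _ --> X]add0r -(scale0r (\sum_(i <- s) v i 0 *: (delta_mx i 0 : 'cV[R]_n))).
  apply: cvgD; last exact: cvg_cst.
  apply: cvgZ => //; apply/cvg_mxP => j k; rewrite summxE.
  under eq_cvg do rewrite summxE.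
  by apply: cvg_bigsum => m _; rewrite !mxE; under eq_cvg do rewrite !mxE;
    apply: cvgM => //; exact: cvg_cst.
have step : (h t)^-1 * (f ((h t * w t i 0) *: delta_mx i 0 + (h t *: W s t + x)) -
    f (h t *: W s t + x)) @[t --> F] --> v i 0 * 'D_(delta_mx i 0) f x.
  apply: (@step_limit _ _ U) => //.
  - by move=> z Uz; exact: Ck1_derivable f_C1 Uz.
  - exact: Ck1_continuous f_C1 Ux.
rewrite big_cons; have eq_q t : (h t)^-1 * (f (h t *: W (i :: s) t + x) - f x) =
    (h t)^-1 * (f ((h t * w t i 0) *: delta_mx i 0 + (h t *: W s t + x)) -
    f (h t *: W s t + x)) + (h t)^-1 * (f (h t *: W s t + x) - f x).
  rewrite -mulrDr /W big_cons scalerDr scalerA -addrA; congr (_ * _).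
  by ring.
by rewrite (eq_cvg _ _ eq_q); apply: cvgD.
Qed.

Lemma is_derive_curve U f (z : R -> 'cV[R]_n) t : open U -> Ck_on 1 U f -> U (z t) ->
  derivable z t 1 -> is_derive t 1 (f \o z) ('D_(derive1 z t) f (z t)).
Proof.
move=> U_open f_C1 Uz z_der.
have w_cvg : h^-1 *: (z (h + t) - z t) @[h --> (0 : R)^'] --> derive1 z t.
  rewrite derive1E; move: z_der; rewrite /derivable /derive /=.
  have eq_q h : h^-1 *: (z (h *: (1 : R^o) + t) - z t) = h^-1 *: (z (h + t) - z t).
    by rewrite [h *: (1 : R^o)]mulr1.
  by under eq_fun do rewrite eq_q.
have id_cvg : id h @[h --> (0 : R)^'] --> (0 : R) by exact: nbhs_dnbhs.
have q_cvg : h^-1 * (f (h *: (h^-1 *: (z (h + t) - z t)) + z t) - f (z t))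
    @[h --> (0 : R)^'] --> 'D_(derive1 z t) f (z t).
  exact: (dir_limit _ U_open f_C1 Uz id_cvg (dnbhs0_neq0 R) w_cvg).
have {}q_cvg : h^-1 *: ((f \o z) (h *: (1 : R^o) + t) - (f \o z) t) @[h --> (0 : R)^'] -->
    'D_(derive1 z t) f (z t).
  apply: cvg_trans q_cvg.
  apply: near_eq_cvg; apply: filterS (dnbhs0_neq0 R) => h h_neq0 /=.
  by rewrite [h *: (1 : R^o)]mulr1 scalerA mulfV // scale1r subrK.
apply: DeriveDef; first by apply/cvg_ex; exists ('D_(derive1 z t) f (z t)).
exact: cvg_lim q_cvg.
Qed.

Lemma is_derive_gradient U f (z : R -> 'cV[R]_n) t : open U -> Ck_on 2 U f -> U (z t) ->
  derivable z t 1 ->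
  derivable (gradient f \o z) t 1 /\
  derive1 (gradient f \o z) t = hessian f (z t) *m derive1 z t.
Proof.
move=> U_open f_C2 Uz z_der.
have comp i j : is_derive t 1 (fun s => (gradient f \o z) s i j)
    ((hessian f (z t) *m derive1 z t) i j).
  have := is_derive_curve U_open (Ck_on_derive (delta_mx i 0) f_C2) Uz z_der.
  rewrite (derive_gradient _ U_open (Ck_on_derive _ f_C2) Uz).
  have -> : ((gradient ('D_(delta_mx i 0) f) (z t))^T *m derive1 z t) 0 0 =
      (hessian f (z t) *m derive1 z t) i j.
    rewrite (ord1 j) !mxE; apply: eq_bigr => k _; rewrite !mxE.
    by rewrite (@derive_sym _ _ U f (z t) (delta_mx k 0) (delta_mx i 0)).
  have -> // : 'D_(delta_mx i 0) f \o z = fun s => (gradient f \o z) s i j.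
  by apply/funext => s; rewrite /= !mxE.
have grad_der : derivable (gradient f \o z) t 1.
  by apply/derivable_mxP => i j; have [] := comp i j.
split=> //; rewrite derive1E derive_mx //; apply/matrixP => i j; rewrite mxE.
by have [] := comp i j.
Qed.

End ColumnVectors.

(** * Smoothness of the logarithmic kernel *)

Lemma Ck_on_sub (R : realType) (V : normedModType R) k (U U' : set V) (f : V -> R) :
  U' `<=` U -> Ck_on k U f -> Ck_on k U' f.
Proof.
move=> U'U; elim: k f => [|k IHk] f /= [f_cont f_der]; split=> //.
- by move=> x /U'U; exact: f_cont.
- by move=> x /U'U; exact: f_cont.
- by move=> v; have [fv Cfv] := f_der v; split=> [x /U'U|]; [exact: fv | exact: IHk].
Qed.

Section SmoothFunctions.
Variables (R : realType) (V : normedModType R).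
Implicit Types (f g : V -> R) (U : set V).

Lemma Ck_onM k U f g : open U -> Ck_on k U f -> Ck_on k U g ->
  Ck_on k U (fun x => f x * g x).
Proof.
move=> U_open; elim: k f g => [|k IHk] f g f_Ck g_Ck.
  split=> // x Ux; apply: cvgM; first exact: Ck_on_continuous f_Ck Ux.
  exact: Ck_on_continuous g_Ck Ux.
split.
  move=> x Ux; apply: cvgM; first exact: Ck_on_continuous f_Ck Ux.
  exact: Ck_on_continuous g_Ck Ux.
move=> v; have [fv Cfv] := f_Ck.2 v; have [gv Cgv] := g_Ck.2 v; split.
  by move=> x Ux; apply: derivableM; [exact: fv | exact: gv].
have Cfg := Ck_onD U_open (IHk _ _ (Ck_onS f_Ck) Cgv) (IHk _ _ (Ck_onS g_Ck) Cfv).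
apply: Ck_on_eq Cfg => // x Ux.
by rewrite deriveM //; [exact: fv | exact: gv].
Qed.

Lemma Ck_onV k U f : open U -> (forall x, U x -> f x != 0) -> Ck_on k U f ->
  Ck_on k U (fun x => (f x)^-1).
Proof.
move=> U_open f_neq0; elim: k f f_neq0 => [|k IHk] f f_neq0 f_Ck.
  split=> // x Ux; apply: cvgV; first exact: f_neq0.
  exact: Ck_on_continuous f_Ck Ux.
split.
  move=> x Ux; apply: cvgV; first exact: f_neq0.
  exact: Ck_on_continuous f_Ck Ux.
move=> v; have [fv Cfv] := f_Ck.2 v; split.
  by move=> x Ux; apply: derivableV; [exact: f_neq0 | exact: fv].
have CV := IHk _ f_neq0 (Ck_onS f_Ck).
have C := Ck_onM U_open (Ck_onZ (-1) U_open (Ck_onM U_open CV CV)) Cfv.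
apply: Ck_on_eq C => // x Ux.
rewrite deriveV //; [|exact: f_neq0|exact: fv].
by rewrite mulN1r -expr2 exprVn.
Qed.

Lemma Ck_on_ln k U f : open U -> (forall x, U x -> 0 < f x) -> Ck_on k U f ->
  Ck_on k U (fun x => ln (f x)).
Proof.
move=> U_open f_gt0 f_Ck.
have ln_cont x : U x -> {for x, continuous (fun x => ln (f x))}.
  move=> Ux; apply: continuous_comp; first exact: Ck_on_continuous f_Ck Ux.
  exact/continuous_ln/f_gt0.
case: k f_Ck => [|k] f_Ck; first by split.
split=> // v; have [fv Cfv] := f_Ck.2 v.
have ln_der x : U x -> is_derive x v (fun x => ln (f x)) ((f x)^-1 * 'D_v f x).
  move=> Ux; apply/is_derive_line0.
  have f_der : is_derive (0 : R) 1 (fun s : R => f (s *: v + x)) ('D_v f x).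
    by apply/(is_derive_line0 f x v); apply: derivableP; exact: fv.
  have := @is_derive1_comp R (@ln R) (fun s : R => f (s *: v + x)) 0 (f x)^-1 ('D_v f x).
  by apply=> //; rewrite scale0r add0r; apply/is_derive1_ln/f_gt0.
split; first by move=> x /ln_der[].
have C : Ck_on k U (fun x => (f x)^-1 * 'D_v f x).
  apply: Ck_onM => //; apply: Ck_onV => //; last exact: Ck_onS.
  by move=> x /f_gt0/lt0r_neq0.
by apply: Ck_on_eq C => // x /ln_der[_ ->].
Qed.

Lemma Ck_on_linear k U (P : V -> R) : linear P -> continuous P -> Ck_on k U P.
Proof.
move=> P_lin P_cont.
have P_der x v : is_derive x v P (P v).
  have eq_q h : h != 0 -> h^-1 *: ((P \o shift x) (h *: v) - P x) = P v.
    by move=> h0; rewrite /= P_lin addrK [h *: P v]/(h * P v) [_ *: _]mulrA mulVf // mul1r.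
  have lim_q : h^-1 *: ((P \o shift x) (h *: v) - P x) @[h --> (0 : R)^'] --> P v.
    by apply: cvg_near_cst; apply: filterS (dnbhs0_neq0 R) => h h0; rewrite eq_q.
  apply: DeriveDef; first by apply/cvg_ex; exists (P v).
  exact: cvg_lim lim_q.
case: k => [|k]; split=> //; first by move=> x _; exact: P_cont.
  by move=> x _; exact: P_cont.
move=> v; split; first by move=> x _; have [] := P_der x v.
have -> : 'D_v P = fun=> P v by apply/funext => x; have [] := P_der x v.
exact: Ck_on_cst.
Qed.

End SmoothFunctions.

Section LogKernel.
Variable R : realType.
Implicit Types x : 'cV[R]_2.

Definition log_kernel x : R := ln (enorm x).

Definition sqnorm x : R := \sum_(i < 2) x i 0 * x i 0.

Lemma sqnorm_gt0 x : x != 0 -> 0 < sqnorm x.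
Proof.
move=> x_neq0; rewrite lt_neqAle sumr_ge0 ?andbT => [|i _]; last by rewrite -expr2 sqr_ge0.
rewrite eq_sym; apply: contra x_neq0 => /eqP sq0; apply/eqP/colP => i.
have sq_ge0 (j : 'I_2) : true -> 0 <= x j 0 * x j 0 by rewrite -expr2 sqr_ge0.
have := psumr_eq0P sq_ge0 sq0 (i := i) isT.
by rewrite !mxE => /eqP; rewrite mulf_eq0 orbb => /eqP.
Qed.

(** In terms of the squared norm, a polynomial, the kernel is a composition of
    smooth functions. *)
Lemma log_kernelE x : x != 0 -> log_kernel x = 2^-1 * ln (sqnorm x).
Proof.
move=> /sqnorm_gt0 sq_gt0; rewrite /log_kernel /enorm.
have -> : \sum_(i < 2) x i 0 ^+ 2 = sqnorm x by apply: eq_bigr => i _; rewrite expr2.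
have sqrt_gt0 : 0 < Num.sqrt (sqnorm x) by rewrite sqrtr_gt0.
rewrite -{2}[sqnorm x]sqr_sqrtr ?ltW // expr2 lnM ?posrE //.
by field.
Qed.

Lemma coord_lin n (i : 'I_n) : linear (fun x : 'cV[R]_n => x i 0 : R).
Proof. by move=> a x y; rewrite !mxE. Qed.

Lemma coord_cont n (i : 'I_n) : continuous (fun x : 'cV[R]_n => x i 0 : R).
Proof. exact: coord_continuous. Qed.

Lemma open_neq0 : open [set x : 'cV[R]_2 | x != 0].
Proof.
have -> : [set x : 'cV[R]_2 | x != 0] = ~` [set 0].
  by apply/seteqP; split=> x /= => [/eqP|] // /eqP.
apply: closed_openC; apply: accessible_closed_set1; apply: hausdorff_accessible.
exact: norm_hausdorff.
Qed.

Lemma log_kernel_smooth k : Ck_on k [set x | x != 0] log_kernel.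
Proof.
have sq_smooth : Ck_on k [set x : 'cV[R]_2 | x != 0] sqnorm.
  apply: Ck_on_sum open_neq0 _ => i _.
  have Ci := Ck_on_linear k [set x : 'cV[R]_2 | x != 0] (coord_lin i) (@coord_cont 2 i).
  exact: (Ck_onM open_neq0 Ci Ci).
have C := Ck_onZ 2^-1 open_neq0 (Ck_on_ln open_neq0 sqnorm_gt0 sq_smooth).
by apply: (Ck_on_eq open_neq0) C => x x_neq0; rewrite log_kernelE.
Qed.

Lemma log_kernelZ (r : R) x : 0 < r -> x != 0 -> log_kernel (r *: x) = ln r + log_kernel x.
Proof.
move=> r_gt0 x_neq0.
have enorm_gt0 : 0 < enorm x.
  rewrite sqrtr_gt0.
  have -> : \sum_(i < 2) x i 0 ^+ 2 = sqnorm x by apply: eq_bigr => i _; rewrite expr2.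
  exact: sqnorm_gt0.
rewrite /log_kernel -lnM ?posrE //; congr ln; rewrite /enorm.
have -> : \sum_(i < 2) (r *: x) i 0 ^+ 2 = r ^+ 2 * \sum_(i < 2) x i 0 ^+ 2.
  by rewrite big_distrr; apply: eq_bigr => i _; rewrite mxE exprMn.
by rewrite sqrtrM ?sqr_ge0 // sqrtr_sqr gtr0_norm.
Qed.

Lemma log_kernelN x : log_kernel (- x) = log_kernel x.
Proof.
rewrite /log_kernel /enorm; congr (ln (Num.sqrt _)).
by apply: eq_bigr => i _; rewrite mxE sqrrN.
Qed.

End LogKernel.

(** * The vortex Hamiltonian and its symmetries *)

Section VortexCoordinates.
Variables (R : realType) (N : nat).
Implicit Types (z w : 'cV[R]_(N * 2)) (a e : 'cV[R]_2).

Lemma vortex_lin (j : 'I_N) : linear (fun z : 'cV[R]_(N * 2) => vortex z j).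
Proof. by move=> c z w; apply/colP => k; rewrite !mxE. Qed.

Lemma vortex_cont (j : 'I_N) : continuous (fun z : 'cV[R]_(N * 2) => vortex z j).
Proof.
move=> z; apply: mx_continuousP => i k.
have -> : (fun w : 'cV[R]_(N * 2) => vortex w j i k) =
    (fun w : 'cV[R]_(N * 2) => w (mxvec_index j i) 0 : R).
  by apply/funext => w; rewrite !mxE.
exact: coord_continuous.
Qed.

Lemma vortex_hat a (j : 'I_N) : vortex (hat N a) j = a.
Proof. by apply/colP => k; rewrite !mxE mxvecE mxE. Qed.

Lemma vortex_inj z w : (forall j, vortex z j = vortex w j) -> z = w.
Proof.
move=> zw; apply/colP => i; case/mxvec_indexP: i => j k.
by have /colP/(_ k) := zw j; rewrite !mxE.
Qed.

Definition pair_lin (k j : 'I_N) z := (vortex z k, vortex z j).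

Lemma pair_lin_lin k j : linear (pair_lin k j).
Proof. by move=> c z w; rewrite /pair_lin !vortex_lin. Qed.

Lemma pair_lin_cont k j : continuous (pair_lin k j).
Proof.
move=> z; have ck := @vortex_cont k z; have cj := @vortex_cont j z.
exact: (cvg_pair ck cj).
Qed.

Definition diff_lin (j k : 'I_N) z := vortex z j - vortex z k.

Lemma diff_lin_lin j k : linear (diff_lin j k).
Proof.
move=> c z w; rewrite /diff_lin !vortex_lin scalerBr opprD !addrA.
by congr (_ + _); rewrite addrAC.
Qed.

Lemma diff_lin_cont j k : continuous (diff_lin j k).
Proof.
move=> z; have cj := @vortex_cont j z; have ck := @vortex_cont k z.
exact: (cvgB cj ck).
Qed.

Lemma open_config (Omega : set 'cV[R]_2) : open Omega -> open (@config R N Omega).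
Proof.
move=> Omega_open; rewrite openE => z [zO z_neq]; rewrite /interior.
have nO (j : 'I_N) : nbhs z [set w | Omega (vortex w j)].
  have := open_comp (fun w _ => @vortex_cont j w) Omega_open.
  by move=> op; apply: open_nbhs_nbhs; split.
have nd (p : 'I_N * 'I_N) : nbhs z [set w | p.1 != p.2 -> diff_lin p.1 p.2 w != 0].
  have [->|p12] := eqVneq p.1 p.2; first by apply: filterE.
  have := open_comp (fun w _ => @diff_lin_cont p.1 p.2 w) (@open_neq0 R).
  move=> op; have zp : (diff_lin p.1 p.2 @^-1` [set x | x != 0]) z.
    by rewrite /preimage /= subr_eq0; apply/eqP/z_neq.
  by apply: filterS (open_nbhs_nbhs (conj op zp)) => w wp _.
have nO' : nbhs z (fun w => forall j, Omega (vortex w j)).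
  exact: (@filter_forall _ _ (fun j w => Omega (vortex w j)) (nbhs z) (nbhs_filter z) nO).
have nd' : nbhs z (fun w => forall p : 'I_N * 'I_N, p.1 != p.2 -> diff_lin p.1 p.2 w != 0).
  exact: (@filter_forall _ _ (fun (p : 'I_N * 'I_N) w => p.1 != p.2 -> diff_lin p.1 p.2 w != 0)
    (nbhs z) (nbhs_filter z) nd).
apply: filterS2 nO' nd' => w wO wd; split=> // j k jk.
by have := wd (j, k) jk; rewrite /= subr_eq0 => /eqP.
Qed.

Lemma config_diff (Omega : set 'cV[R]_2) z j k : config Omega z -> j != k ->
  diff_lin j k z != 0.
Proof. by move=> [_ zn] jk; rewrite subr_eq0; apply/eqP/zn. Qed.

Lemma sub_config (Omega : set 'cV[R]_2) z : config Omega z -> config setT z.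
Proof. by move=> [_ zn]; split. Qed.

Lemma config_affine a (r : R) z : r != 0 -> config setT z -> config setT (hat N a + r *: z).
Proof.
move=> r0 [_ zn]; split=> // j k jk.
have E i : vortex (hat N a + r *: z) i = r *: vortex z i + a.
  by rewrite addrC vortex_lin vortex_hat.
by rewrite !E => /addIr/(scalerI r0); exact: zn.
Qed.

End VortexCoordinates.

Section AffineInvariance.
Variables (R : realType) (V : normedModType R).

Lemma derive_invariant (f : V -> R) v : (forall x (h : R), f (h *: v + x) = f x) ->
  'D_v f = fun=> 0.
Proof.
move=> f_inv; apply/funext => x; apply: lim_near_cst => //.
by near=> h; rewrite /= f_inv subrr scaler0.
Unshelve. all: by end_near. Qed.
Lemma derive_affine U (f : V -> R) (c : V) (r a k : R) v x :
  open U -> (forall y, U y -> f (c + r *: y) = a * f y + k) -> U x ->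
  derivable f (c + r *: x) v -> derivable f x v ->
  r * 'D_v f (c + r *: x) = a * 'D_v f x.
Proof.
move=> U_open f_aff Ux fcv fv.
have -> : r * 'D_v f (c + r *: x) = 'D_v (fun y => f (c + r *: y)) x.
  rewrite -(deriveZ_dir r fcv).2 /derive.
  set g1 := fun h => h^-1 *: _; set g2 := fun h => h^-1 *: _.
  suff -> : g1 = g2 by [].
  apply/funext => h; rewrite /g1 /g2 /= [r *: (_ + _)]scalerDr !scalerA [X in X *: v]mulrC.
  by rewrite [c + (_ + _)]addrCA.
have near_f : \near x, f (c + r *: x) = a * f x + k by exact: open_near_eq f_aff.
rewrite (near_eq_derive _ near_f).
have afv : derivable (fun y => a * f y) x v by apply: derivableZ.
have kv : derivable (fun=> k : R) x v by exact: derivable_cst.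
rewrite (@deriveD _ _ _ (fun y => a * f y) (fun=> k)) // derive_cst addr0.
by rewrite (@deriveZ _ _ _ f).
Qed.

End AffineInvariance.

Section HatMatrix.
Variables (R : realType) (N : nat).

Definition hat_mx : 'M[R]_(N * 2, 2) := \matrix_(i, k) hat N (delta_mx k 0) i 0.

Lemma hat_mxE (e : 'cV[R]_2) : hat_mx *m e = hat N e.
Proof.
apply/colP => i; case/mxvec_indexP: i => j k; rewrite !mxE mxvecE mxE.
rewrite (bigD1 k) //= big1 ?addr0 => [|l lk].
  by rewrite !mxE mxvecE !mxE !eqxx mul1r.
by rewrite !mxE mxvecE !mxE eq_sym (negPf lk) mul0r.
Qed.

Lemma mul_hat_col m (M : 'M[R]_(m, N * 2)) k i :
  (M *m hat_mx) i k = (M *m hat N (delta_mx k 0)) i 0.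
Proof. by rewrite -hat_mxE mulmxA -colE [RHS]mxE. Qed.

Lemma hatZ (r : R) e : hat N (r *: e) = r *: hat N e.
Proof.
by apply: vortex_inj => j; apply/colP => k; rewrite !mxE !mxvecE !mxE.
Qed.

End HatMatrix.

Lemma gradientE (R : realType) n (f : 'cV[R]_n -> R) x i :
  gradient f x i 0 = 'D_(delta_mx i 0) f x.
Proof. by rewrite mxE. Qed.

Lemma hessianE (R : realType) n (f : 'cV[R]_n -> R) x i j :
  hessian f x i j = 'D_(delta_mx i 0) ('D_(delta_mx j 0) f) x.
Proof. by rewrite mxE. Qed.

Lemma scalemx_entry (R : realType) m n (c : R) (M : 'M[R]_(m, n)) i j :
  (c *: M) i j = c * M i j.
Proof. by rewrite mxE. Qed.

Section PlanarSymmetries.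
Variables (R : realType) (N : nat) (H : 'cV[R]_(N * 2) -> R) (shift : R -> R).
Implicit Types (z w v : 'cV[R]_(N * 2)) (a e : 'cV[R]_2).
Hypothesis H_smooth : forall m, Ck_on m (config setT) H.
Hypothesis H_trans : forall z e, H (hat N e + z) = H z.
Hypothesis H_scale : forall (r : R) z, 0 < r -> config setT z -> H (r *: z) = H z + shift r.

Let op : open (@config R N setT).
Proof. by apply: open_config; exact: openT. Qed.

Lemma plane_derive_affine a (r : R) z v : 0 < r -> config setT z ->
  r * 'D_v H (hat N a + r *: z) = 'D_v H z.
Proof.
move=> r_gt0 zc; rewrite -[RHS]mul1r.
apply: (@derive_affine _ _ (config setT) _ _ _ _ (shift r)) => //.
- by move=> y yc; rewrite H_trans H_scale // mul1r.
- by apply: Ck1_derivable (H_smooth 1) _; apply: config_affine zc; rewrite gt_eqF.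
- exact: Ck1_derivable (H_smooth 1) zc.
Qed.

Lemma plane_gradient_affine a (r : R) z : 0 < r -> config setT z ->
  r *: gradient H (hat N a + r *: z) = gradient H z.
Proof.
move=> r_gt0 zc; apply/colP => i.
by rewrite [LHS]mxE !gradientE plane_derive_affine.
Qed.

Lemma plane_hessian_affine a (r : R) z : 0 < r -> config setT z ->
  r ^+ 2 *: hessian H (hat N a + r *: z) = hessian H z.
Proof.
move=> r_gt0 zc; apply/matrixP => i j.
rewrite scalemx_entry.
have E1 := hessianE H (hat N a + r *: z) i j.
have E2 := hessianE H z i j.
have C1 := Ck_on_derive (delta_mx j 0) (H_smooth 2).
have r_neq0 : r != 0 by rewrite gt_eqF.
have aff2 : r * 'D_(delta_mx i 0) ('D_(delta_mx j 0) H) (hat N a + r *: z) =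
    r^-1 * 'D_(delta_mx i 0) ('D_(delta_mx j 0) H) z.
  apply: (@derive_affine _ _ (config setT) _ _ _ _ 0) => //.
  - move=> y yc; rewrite addr0; apply: (mulfI r_neq0).
    by rewrite plane_derive_affine // mulrA mulfV // mul1r.
  - by apply: Ck1_derivable C1 _; apply: config_affine zc.
  - exact: Ck1_derivable C1 zc.
have aff3 : r ^+ 2 * 'D_(delta_mx i 0) ('D_(delta_mx j 0) H) (hat N a + r *: z) =
    'D_(delta_mx i 0) ('D_(delta_mx j 0) H) z.
  have sq_r (s t : R) : r * s = r^-1 * t -> r ^+ 2 * s = t.
    by move=> st; rewrite expr2 -mulrA st mulrA mulfV // mul1r.
  exact: sq_r aff2.
exact: (etrans (congr1 (fun t => r ^+ 2 * t) E1) (etrans aff3 (esym E2))).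
Qed.

Lemma plane_derive_hat e : 'D_(hat N e) H = fun=> 0.
Proof. by apply: derive_invariant => z h; rewrite -hatZ H_trans. Qed.

Lemma plane_gradient_hat z : config setT z -> (gradient H z)^T *m hat_mx R N = 0.
Proof.
move=> zc; apply/matrixP => i k; rewrite (ord1 i) mul_hat_col [RHS]mxE.
rewrite -(derive_gradient _ op (H_smooth 1) zc).
by rewrite (congr1 (fun f => f z) (plane_derive_hat _)).
Qed.

Lemma plane_hessian_hat z : config setT z -> hessian H z *m hat_mx R N = 0.
Proof.
move=> zc; apply/matrixP => i k; rewrite mul_hat_col [RHS]mxE.
have := derive_hessian (hat N (delta_mx k 0)) (delta_mx i 0) op (H_smooth 2) zc.
rewrite plane_derive_hat derive_cst => /esym.
by rewrite -mulmxA trmx_delta -rowE mxE.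
Qed.

End PlanarSymmetries.

Section VortexHamiltonian.
Variables (R : realType) (N : nat) (Gamma : 'I_N -> R).
Implicit Types (z w : 'cV[R]_(N * 2)) (a e : 'cV[R]_2).

Notation H0 := (hamiltonian_plane Gamma).

Lemma hamiltonian_planeE z :
  H0 z = \sum_(j < N) \sum_(k < N | k != j)
    (- (2 * pi)^-1 * (Gamma j * Gamma k)) * log_kernel (diff_lin j k z).
Proof.
rewrite /hamiltonian_plane big_distrr; apply: eq_bigr => j _.
by rewrite big_distrr; apply: eq_bigr => k _ /=; rewrite mulrA.
Qed.

Lemma hamiltonian_plane_smooth m : Ck_on m (config setT) H0.
Proof.
have op : open (@config R N setT) by apply: open_config; exact: openT.
have C : Ck_on m (config setT) (fun z => \sum_(j < N) \sum_(k < N | k != j)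
    (- (2 * pi)^-1 * (Gamma j * Gamma k)) * log_kernel (diff_lin j k z)).
  apply: Ck_on_sum => // j _; apply: Ck_on_sum => // k kj; apply: Ck_onZ => //.
  have C := Ck_on_precomp (diff_lin_lin j k) (@diff_lin_cont R N j k) (log_kernel_smooth R m).
  apply: Ck_on_sub C => z zc; apply: config_diff zc _; by rewrite eq_sym.
by apply: (Ck_on_eq op) C => z _; rewrite hamiltonian_planeE.
Qed.

Lemma hamiltonian_plane_translation z e : H0 (hat N e + z) = H0 z.
Proof.
rewrite !hamiltonian_planeE; apply: eq_bigr => j _; apply: eq_bigr => k _.
by rewrite /diff_lin -[hat N e]scale1r !vortex_lin !vortex_hat opprD addrACA subrr add0r.
Qed.

Definition scaling_shift (r : R) : R := \sum_(j < N) \sum_(k < N | k != j)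
    (- (2 * pi)^-1 * (Gamma j * Gamma k)) * ln r.

Lemma hamiltonian_plane_scaling (r : R) z : 0 < r -> config setT z ->
  H0 (r *: z) = H0 z + scaling_shift r.
Proof.
move=> r_gt0 zc; rewrite !hamiltonian_planeE /scaling_shift -big_split.
apply: eq_bigr => j _; rewrite -big_split; apply: eq_bigr => k kj /=.
rewrite -mulrDr; congr (_ * _).
have -> : diff_lin j k (r *: z) = r *: diff_lin j k z.
  by have := diff_lin_lin j k r z 0; rewrite addr0 /diff_lin => ->;
     rewrite [X in _ + X](_ : _ = 0) ?addr0 //; apply/colP => i; rewrite !mxE subrr.
rewrite log_kernelZ 1?addrC //; apply: config_diff zc _; by rewrite eq_sym.
Qed.

Variables (Omega : set 'cV[R]_2) (g : 'cV[R]_2 -> 'cV[R]_2 -> R).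

(** The double sum includes its diagonal, where g (z_j, z_j) is the Robin
    function: self-interaction is not a separate term. *)
Definition regular_part z : R := \sum_(j < N) \sum_(k < N)
  Gamma j * Gamma k * g (vortex z k) (vortex z j).

Lemma hamiltonianE z : hamiltonian Gamma g z = H0 z - regular_part z.
Proof.
have -> : regular_part z =
    \sum_(j < N) \sum_(k < N | k != j) Gamma j * Gamma k * g (vortex z k) (vortex z j)
    + \sum_(j < N) Gamma j ^+ 2 * robin g (vortex z j).
  rewrite -big_split; apply: eq_bigr => j _ /=.
  by rewrite (bigD1 j) //= addrC expr2.
rewrite hamiltonian_planeE opprD addrA; congr (_ - _).
rewrite -sumrN -big_split; apply: eq_bigr => j _ /=.
rewrite -sumrN -big_split; apply: eq_bigr => k _ /=.
have -> : log_kernel (diff_lin j k z) = ln (enorm (vortex z k - vortex z j)).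
  by rewrite -log_kernelN /log_kernel /diff_lin opprB.
by rewrite /green; ring.
Qed.

End VortexHamiltonian.

(** * The regular part at a collapsed configuration *)

Lemma double_sum_half (F : numFieldType) n (Gam B : 'I_n -> F) :
  \sum_(j < n) \sum_(k < n) Gam j * Gam k * (2^-1 * (B k + B j)) =
  (\sum_(j < n) Gam j) * \sum_(j < n) Gam j * B j.
Proof.
have split_jk j k : Gam j * Gam k * (2^-1 * (B k + B j)) =
    2^-1 * (Gam j * (Gam k * B k)) + 2^-1 * (Gam k * (Gam j * B j)) by ring.
transitivity (\sum_(j < n) \sum_(k < n) (2^-1 * (Gam j * (Gam k * B k))) +
    \sum_(j < n) \sum_(k < n) (2^-1 * (Gam k * (Gam j * B j)))).
  rewrite -big_split; apply: eq_bigr => j _ /=.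
  by rewrite -big_split; apply: eq_bigr => k _; rewrite split_jk.
rewrite [X in _ + X]exchange_big /= -mulr2n -[LHS]mulr_natl [LHS]big_distrr [RHS]big_distrl /=.
apply: eq_bigr => j _ /=; rewrite 2!big_distrr /=; apply: eq_bigr => k _ /=.
by rewrite !mulrA mulfV ?mul1r // pnatr_eq0.
Qed.

Section RegularPart.
Variables (R : realType) (Omega : set 'cV[R]_2) (g : 'cV[R]_2 -> 'cV[R]_2 -> R).
Implicit Types (a e u v : 'cV[R]_2).
Hypothesis Omega_open : open Omega.
Let G (p : 'cV[R]_2 * 'cV[R]_2) : R := g p.1 p.2.
Hypothesis G_C2 : Ck_on 2 (Omega `*` Omega) G.
Hypothesis g_sym : forall x y, Omega x -> Omega y -> g x y = g y x.

Let U2_open : open (Omega `*` Omega).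
Proof.
rewrite openE => -[x y] [/= Ox Oy]; exists (Omega, Omega).
  by split; apply: open_nbhs_nbhs.
by [].
Qed.

Definition dup (x : 'cV[R]_2) := (x, x).

Lemma dup_lin : linear dup. Proof. by []. Qed.

Lemma dup_cont : continuous dup.
Proof. by move=> x; have c := @cvg_id _ (nbhs x); exact: (cvg_pair c c). Qed.

Definition swap_pair (p : 'cV[R]_2 * 'cV[R]_2) := (p.2, p.1).

Lemma swap_lin : linear swap_pair. Proof. by []. Qed.

Lemma robin_smooth : Ck_on 2 Omega (robin g).
Proof.
have C := Ck_on_precomp dup_lin dup_cont G_C2.
by apply: Ck_on_sub C => x Ox; split.
Qed.

Lemma robin_derive e : 'D_e (robin g) = 'D_(dup e) G \o dup.
Proof. by rewrite -(derive_precomp dup_lin). Qed.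

Lemma robin_derive2 u e : 'D_u ('D_e (robin g)) = 'D_(dup u) ('D_(dup e) G) \o dup.
Proof. by rewrite robin_derive -(derive_precomp dup_lin). Qed.

Lemma mixed_swap a e u v : Omega a ->
  'D_(u, v) ('D_(dup e) G) (dup a) = 'D_(v, u) ('D_(dup e) G) (dup a).
Proof.
move=> Oa; have Ua : (Omega `*` Omega) (dup a) by split.
have G_swap p : (Omega `*` Omega) p -> G p = (G \o swap_pair) p.
  by case: p => x y [/= Ox Oy]; rewrite /G /= g_sym.
have near_swap : \forall p \near dup a, 'D_(dup e) G p = ('D_(dup e) G \o swap_pair) p.
  apply: filterS (open_nbhs_nbhs (conj U2_open Ua)) => p Up.
  rewrite -[RHS](congr1 (fun f => f p) (derive_precomp swap_lin G (dup e))).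
  by apply: near_eq_derive; exact: open_near_eq G_swap.
rewrite (near_eq_derive _ near_swap).
by rewrite (congr1 (fun f => f (dup a)) (derive_precomp swap_lin ('D_(dup e) G) (u, v))).
Qed.

(** Near the diagonal the derivative of g along (e, e) is symmetric in its two
    arguments, and on the diagonal it is the derivative of the Robin function:
    each argument contributes one half. *)
Lemma mixed_half a e u v : Omega a ->
  'D_(u, v) ('D_(dup e) G) (dup a) =
  2^-1 * ('D_u ('D_e (robin g)) a + 'D_v ('D_e (robin g)) a).
Proof.
move=> Oa; have Ua : (Omega `*` Omega) (dup a) by split.
have C1 := Ck_on_derive (dup e) G_C2.
have split_uv x y : 'D_(x, y) ('D_(dup e) G) (dup a) =
    'D_(x, 0) ('D_(dup e) G) (dup a) + 'D_(y, 0) ('D_(dup e) G) (dup a).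
  rewrite -(mixed_swap e 0 y Oa) -(derive_dirD _ _ U2_open C1 Ua).
  have {1}-> // : (x, y) = (x, 0) + (0, y) :> 'cV[R]_2 * 'cV[R]_2.
  by congr (_, _); rewrite /= ?addr0 ?add0r.
rewrite (congr1 (fun f => f a) (robin_derive2 u e)) (congr1 (fun f => f a) (robin_derive2 v e)) /=.
rewrite (split_uv u v) (split_uv u u) (split_uv v v).
move: ('D_(u, 0) _ _) ('D_(v, 0) _ _) => p q; by field.
Qed.

Variables (N : nat) (Gamma : 'I_N -> R).

Definition box := [set z : 'cV[R]_(N * 2) | forall j, Omega (vortex z j)].

Lemma open_box : open box.
Proof.
rewrite openE => z zO; rewrite /interior.
have nO (j : 'I_N) : nbhs z [set w | Omega (vortex w j)].
  have := open_comp (fun w _ => @vortex_cont R N j w) Omega_open.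
  by move=> op; apply: open_nbhs_nbhs; split.
exact: (@filter_forall _ _ (fun j w => Omega (vortex w j)) (nbhs z) (nbhs_filter z) nO).
Qed.

Lemma pair_smooth j k : Ck_on 2 box (G \o pair_lin k j).
Proof.
have C := Ck_on_precomp (pair_lin_lin k j) (@pair_lin_cont R N k j) G_C2.
by apply: Ck_on_sub C => z zO; split; exact: zO.
Qed.

Lemma regular_smooth : Ck_on 2 box (regular_part Gamma g).
Proof.
apply: Ck_on_sum open_box _ => j _; apply: Ck_on_sum open_box _ => k _.
have C := Ck_onZ (Gamma j * Gamma k) open_box (pair_smooth j k).
exact: C.
Qed.

Lemma regular_derive_hat e z : box z -> 'D_(hat N e) (regular_part Gamma g) z =
  \sum_(j < N) \sum_(k < N) Gamma j * Gamma k * 'D_(dup e) G (pair_lin k j z).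
Proof.
move=> zO.
have pd j k : derivable (fun y => Gamma j * Gamma k * (G \o pair_lin k j) y) z (hat N e).
  apply: (@derivableZ _ _ _ (G \o pair_lin k j)).
  exact: Ck1_derivable (Ck_onS (pair_smooth j k)) zO.
have sd j : derivable (fun y => \sum_(k < N) Gamma j * Gamma k * (G \o pair_lin k j) y) z (hat N e).
  have E : (fun y => \sum_(k < N) Gamma j * Gamma k * (G \o pair_lin k j) y) =
      \sum_(k < N) (fun y => Gamma j * Gamma k * (G \o pair_lin k j) y).
    by apply/funext => y; rewrite fct_sumE.
  by rewrite E; exact: derivable_sum.
have -> : regular_part Gamma g =
    \sum_(j < N) (fun y => \sum_(k < N) Gamma j * Gamma k * (G \o pair_lin k j) y).
  by apply/funext => y; rewrite fct_sumE.
rewrite derive_sum //; apply: eq_bigr => j _.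
have -> : (fun y => \sum_(k < N) Gamma j * Gamma k * (G \o pair_lin k j) y) =
    \sum_(k < N) (fun y => Gamma j * Gamma k * (G \o pair_lin k j) y).
  by apply/funext => y; rewrite fct_sumE.
rewrite derive_sum //; apply: eq_bigr => k _.
rewrite (@deriveZ _ _ _ (G \o pair_lin k j)); last first.
  exact: Ck1_derivable (Ck_onS (pair_smooth j k)) zO.
congr (_ * _).
rewrite (congr1 (fun f => f z) (derive_precomp (pair_lin_lin k j) G (hat N e))) /=.
by rewrite /pair_lin !vortex_hat.
Qed.

Lemma box_hat a : Omega a -> box (hat N a).
Proof. by move=> Oa j; rewrite vortex_hat. Qed.

Lemma pair_hat a j k : pair_lin k j (hat N a) = dup a.
Proof. by rewrite /pair_lin !vortex_hat. Qed.

Lemma regular_derive_hat0 a e : Omega a ->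
  'D_(hat N e) (regular_part Gamma g) (hat N a) =
  (\sum_(j < N) Gamma j) ^+ 2 * 'D_e (robin g) a.
Proof.
move=> Oa; rewrite (regular_derive_hat e (box_hat Oa)).
rewrite expr2 big_distrl big_distrl; apply: eq_bigr => j _ /=.
rewrite -mulrA big_distrl big_distrr; apply: eq_bigr => k _ /=.
by rewrite pair_hat (congr1 (fun f => f a) (robin_derive e)) mulrA.
Qed.

Lemma regular_derive2_hat0 a e w : Omega a ->
  'D_w ('D_(hat N e) (regular_part Gamma g)) (hat N a) =
  (\sum_(j < N) Gamma j) *
    \sum_(j < N) Gamma j * 'D_(vortex w j) ('D_e (robin g)) a.
Proof.
move=> Oa; have zO := box_hat Oa.
pose f j k := 'D_(dup e) G \o pair_lin k j : 'cV[R]_(N * 2) -> R.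
have near_f : \forall z \near hat N a, 'D_(hat N e) (regular_part Gamma g) z =
    \sum_(j < N) \sum_(k < N) Gamma j * Gamma k * f j k z.
  apply: filterS (open_nbhs_nbhs (conj open_box zO)) => z.
  exact: regular_derive_hat.
rewrite (near_eq_derive _ near_f).
have fd j k : derivable (f j k) (hat N a) w.
  apply: (derivable_precomp (pair_lin_lin k j)); rewrite pair_hat.
  by apply: (@Ck1_derivable _ _ (Omega `*` Omega)); [exact: Ck_on_derive | split].
have pd j k : derivable (fun y => Gamma j * Gamma k * f j k y) (hat N a) w.
  by apply: (@derivableZ _ _ _ (f j k)).
have E j : (fun y => \sum_(k < N) Gamma j * Gamma k * f j k y) =
    \sum_(k < N) (fun y => Gamma j * Gamma k * f j k y).
  by apply/funext => y; rewrite fct_sumE.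
have sd j : derivable (fun y => \sum_(k < N) Gamma j * Gamma k * f j k y) (hat N a) w.
  by rewrite E; exact: derivable_sum.
have -> : (fun y => \sum_(j < N) \sum_(k < N) Gamma j * Gamma k * f j k y) =
    \sum_(j < N) (fun y => \sum_(k < N) Gamma j * Gamma k * f j k y).
  by apply/funext => y; rewrite fct_sumE.
rewrite derive_sum //.
pose B j := 'D_(vortex w j) ('D_e (robin g)) a.
transitivity (\sum_(j < N) \sum_(k < N) Gamma j * Gamma k * (2^-1 * (B k + B j))).
  apply: eq_bigr => j _; rewrite E derive_sum //; apply: eq_bigr => k _.
  rewrite (@deriveZ _ _ _ (f j k)) //; congr (_ * _).
  rewrite /f (congr1 (fun f => f (hat N a)) (derive_precomp (pair_lin_lin k j) _ w)) /=.
  by rewrite pair_hat /pair_lin mixed_half.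
exact: double_sum_half.
Qed.

Lemma vortex_delta (j j' : 'I_N) (m : 'I_2) :
  vortex (delta_mx (mxvec_index j m) 0 : 'cV[R]_(N * 2)) j' =
  (j' == j)%:R *: delta_mx m 0.
Proof.
apply/colP => k; rewrite !mxE !eqxx !andbT.
have -> : (mxvec_index j' k == mxvec_index j m) = ((j', k) == (j, m)).
  apply/eqP/eqP => [|[-> ->] //].
  by rewrite /mxvec_index => /cast_ord_inj/enum_rank_inj.
by rewrite -pair_eqE /=; case: (j' == j); case: (k == m); rewrite /= ?mulr1 ?mulr0.
Qed.

Lemma regular_gradient_hat a : Omega a -> gradient (robin g) a = 0 ->
  (gradient (regular_part Gamma g) (hat N a))^T *m hat_mx R N = 0.
Proof.
move=> Oa ga; apply/matrixP => i k; rewrite (ord1 i) mul_hat_col [RHS]mxE.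
rewrite -(derive_gradient _ open_box (Ck_onS regular_smooth) (box_hat Oa)).
by rewrite regular_derive_hat0 // -gradientE ga mxE mulr0.
Qed.

(** The derivative of Phi along the translation e sums Gamma_j Gamma_k
    (B_j + B_k) / 2, B_j being the second derivative of the Robin function along
    e and the displacement of the vortex j. This factors through the total
    vorticity. *)
Lemma regular_hessian_hat a : Omega a ->
  hessian (regular_part Gamma g) (hat N a) *m hat_mx R N =
  (\sum_(j < N) Gamma j) *: (vorticity_mx Gamma *m hat_mx R N *m hessian (robin g) a).
Proof.
move=> Oa; apply/matrixP => i k; case/mxvec_indexP: i => j m.
rewrite mul_hat_col scalemx_entry.
have := derive_hessian (hat N (delta_mx k 0)) (delta_mx (mxvec_index j m) 0)
  open_box regular_smooth (box_hat Oa).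
rewrite -mulmxA trmx_delta -rowE mxE => <-.
rewrite regular_derive2_hat0 //; congr (_ * _).
rewrite (bigD1 j) //= big1 ?addr0 => [|j' j'j]; last first.
  by rewrite vortex_delta (negPf j'j) scale0r derive0 mulr0.
rewrite vortex_delta eqxx scale1r -mulmxA mul_diag_mx mxE mxvecE mxE; congr (_ * _).
rewrite mxE (bigD1 m) //= big1 ?addr0 => [|l lm].
  by rewrite !mxE mxvecE !mxE !eqxx mul1r.
by rewrite !mxE mxvecE !mxE eq_sym (negPf lm) mul0r.
Qed.

End RegularPart.

(** * The second derivative test in the plane *)

Section SecondDerivativeTest.
Variables (R : realType) (U : set 'cV[R]_2) (f : 'cV[R]_2 -> R) (a : 'cV[R]_2).
Hypotheses (U_open : open U) (f_C2 : Ck_on 2 U f) (Ua : U a).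
Hypothesis grad_a : gradient f a = 0.

Lemma derive_critical v : 'D_v f a = 0.
Proof.
by rewrite (derive_gradient _ U_open (Ck_onS f_C2) Ua) grad_a trmx0 mul0mx mxE.
Qed.

(** Taylor's formula at a critical point. The factor s replaces 1/2, as signs are
    all that matters. *)
Lemma taylor2 v : (forall t : R, 0 <= t <= 1 -> U (t *: v + a)) ->
  exists s t : R, [/\ 0 < s, 0 < t < 1 & f (v + a) - f a = s * 'D_v ('D_v f) (t *: v + a)].
Proof.
move=> seg; have f_C1 := Ck_onS f_C2; have fv_C1 := Ck_on_derive v f_C2.
have [|t /andP[t0 t1] ft] := @mvt_dir_open _ _ f a v.
  by move=> t t01; apply: Ck1_derivable f_C1 _; exact: seg.
have [|s /andP[s0 s1]] := @mvt_dir_open _ _ ('D_v f) a (t *: v).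
  move=> s /andP[s0 s1]; apply: (deriveZ_dir _ _).1; apply: Ck1_derivable fv_C1 _.
  rewrite scalerA; apply: seg; rewrite mulr_ge0 ?(ltW t0) //=.
  by rewrite -[1]mulr1 ler_pM ?(ltW t0) // ltW.
have st : 0 < s * t < 1 by rewrite mulr_gt0 //= -[1]mulr1 ltr_pM ?(ltW s0) ?(ltW t0).
rewrite derive_critical subr0 (deriveZ_dir _ _).2; last first.
  apply: Ck1_derivable fv_C1 _; rewrite scalerA; apply: seg.
  by case/andP: st => /ltW -> /ltW ->.
by rewrite scalerA => fs; exists t, (s * t); rewrite ft fs.
Qed.

Lemma extremum_second_derivative (c : R) v :
  (\forall x \near a, 0 <= c * (f x - f a)) -> 0 <= c * 'D_v ('D_v f) a.
Proof.
move=> f_ext; rewrite leNgt; apply/negP => neg.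
have fvv_cont : {for a, continuous (fun x => c * 'D_v ('D_v f) x)}.
  have C0 := Ck_onZ c U_open (Ck_on_derive v (Ck_on_derive v f_C2)).
  exact: Ck_on_continuous C0 Ua.
have near_neg : \forall x \near a, c * 'D_v ('D_v f) x < 0 by exact: (cvgr_lt _ fvv_cont).
have near_U : \forall x \near a, U x by apply: open_nbhs_nbhs.
have [d /= d_gt0 good] : nbhs_ball a [set x | [/\ c * 'D_v ('D_v f) x < 0, U x & 0 <= c * (f x - f a)]].
  rewrite nbhs_ballE; apply: filterS3 near_neg near_U f_ext => x *; by split.
pose h := d / 2 / (`|v| + 1).
have v1_gt0 : 0 < `|v| + 1 by rewrite ltr_wpDl.
have h_gt0 : 0 < h by rewrite !divr_gt0.
have hv_d : h * `|v| < d.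
  apply: (@le_lt_trans _ _ (d / 2)); last by rewrite ltr_pdivrMr // ltr_pMr // ltr1n.
  rewrite /h -mulrA ler_piMr ?divr_ge0 ?(ltW d_gt0) //.
  by rewrite mulrC ler_pdivrMr // mul1r lerDl.
have in_ball (t : R) : 0 <= t <= 1 -> ball a d (t *: (h *: v) + a).
  move=> /andP[t0 t1]; rewrite -ball_normE /= distrC addrK 2!normrZ.
  rewrite (ger0_norm t0) (gtr0_norm h_gt0); apply: le_lt_trans hv_d.
  by rewrite ler_piMl // mulr_ge0 // ltW.
have [|s [t [s_gt0 /andP[t0 t1] fE]]] := @taylor2 (h *: v).
  by move=> t t01; have [] := good _ (in_ball t t01).
have I1 : 0 <= (1 : R) <= 1 by rewrite lexx ler01.
have It : 0 <= t <= 1 by rewrite !ltW.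
have [_ _] := good _ (in_ball 1 I1); rewrite scale1r fE.
have [+ Ut _] := good _ (in_ball t It).
have fv_C1 := Ck_on_derive v f_C2.
have -> : 'D_(h *: v) ('D_(h *: v) f) (t *: (h *: v) + a) =
    h ^+ 2 * 'D_v ('D_v f) (t *: (h *: v) + a).
  have near_h : \forall x \near (t *: (h *: v) + a), 'D_(h *: v) f x = h * 'D_v f x.
    apply: filterS (open_nbhs_nbhs (conj U_open Ut)) => x Ux.
    by apply: (deriveZ_dir _ _).2; exact: Ck1_derivable (Ck_onS f_C2) Ux.
  rewrite (near_eq_derive _ near_h).
  have hd : derivable (fun x => h * 'D_v f x) (t *: (h *: v) + a) v.
    by apply: (@derivableZ _ _ _ ('D_v f)); exact: Ck1_derivable fv_C1 Ut.
  rewrite (deriveZ_dir h hd).2 (@deriveZ _ _ _ ('D_v f)); last exact: Ck1_derivable fv_C1 Ut.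
  move: ('D_v ('D_v f) (t *: (h *: v) + a)) => m.
  by rewrite [h *: m]/(h * m) mulrA -expr2.
move=> neg_t; rewrite leNgt => /negP; apply.
rewrite mulrCA pmulr_rlt0 // mulrCA pmulr_rlt0 // exprn_gt0 //.
Qed.

Let p := hessian f a 0 0.
Let q := hessian f a 0 1.
Let s := hessian f a 1 1.

Lemma ord2_cases (i : 'I_2) : i = 0 \/ i = 1.
Proof. by case: i => [[|[|]]] // ?; [left|right]; apply: val_inj. Qed.

Lemma sum_ord2 (F : 'I_2 -> R) : \sum_(i < 2) F i = F 0 + F 1.
Proof. by rewrite big_ord_recl big_ord1; congr (_ + F _); apply: val_inj. Qed.

Lemma quad_form2 (M : 'M[R]_2) (v : 'cV[R]_2) : M^T = M -> (v^T *m M *m v) 0 0 =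
  M 0 0 * v 0 0 ^+ 2 + 2 * M 0 1 * v 0 0 * v 1 0 + M 1 1 * v 1 0 ^+ 2.
Proof.
move=> M_sym; have M10 : M 1 0 = M 0 1 by rewrite -{1}M_sym mxE.
by rewrite !mxE sum_ord2 !mxE !sum_ord2 !mxE M10; ring.
Qed.

Lemma det2 (M : 'M[R]_2) : M^T = M -> \det M = M 0 0 * M 1 1 - M 0 1 ^+ 2.
Proof.
move=> M_sym; have M10 : M 1 0 = M 0 1 by rewrite -{1}M_sym mxE.
rewrite (expand_det_row _ 0) sum_ord2 /cofactor !det_mx11 !mxE /=.
have -> : lift 0 0 = 1 :> 'I_2 by apply: val_inj.
have -> : lift 1 0 = 0 :> 'I_2 by apply: val_inj.
by rewrite M10 expr0 expr1; ring.
Qed.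

Lemma extremum_det_gt0 (c : R) : c != 0 -> \det (hessian f a) != 0 ->
  (\forall x \near a, 0 <= c * (f x - f a)) -> 0 < \det (hessian f a).
Proof.
move=> c_neq0 det_neq0 f_ext; have h_sym := hessian_sym U_open f_C2 Ua.
rewrite lt_neqAle eq_sym det_neq0 /=.
have quad (v : 'cV[R]_2) : 0 <= c * (p * v 0 0 ^+ 2 + 2 * q * v 0 0 * v 1 0 + s * v 1 0 ^+ 2).
  rewrite -quad_form2 // -(derive_hessian _ _ U_open f_C2 Ua).
  exact: extremum_second_derivative.
pose vec (x y : R) : 'cV[R]_2 := \col_i (if i == 0 then x else y).
have quad2 x y : 0 <= c * (p * x ^+ 2 + 2 * q * x * y + s * y ^+ 2).
  by have := quad (vec x y); rewrite !mxE.
rewrite det2 // -/p -/q -/s leNgt; apply/negP => det_neg.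
have [p0|p_neq0] := eqVneq p 0.
  have q_neq0 : q != 0.
    by apply: contraTneq det_neg => ->; rewrite p0 mul0r expr0n subrr ltxx.
  (* The value of the form is linear in x; this x makes c times it - 1. *)
  have := quad2 (- (s + c^-1) / (2 * q)) 1.
  have -> : c * (p * (- (s + c^-1) / (2 * q)) ^+ 2 +
      2 * q * (- (s + c^-1) / (2 * q)) * 1 + s * 1 ^+ 2) = -1.
    by rewrite p0; field; rewrite c_neq0 q_neq0.
  by rewrite oppr_ge0 leNgt ltr01.
have h1 := quad2 1 0; have h2 := quad2 (- q) p.
have e1 : c * (p * 1 ^+ 2 + 2 * q * 1 * 0 + s * 0 ^+ 2) = c * p by ring.
have e2 : c * (p * (- q) ^+ 2 + 2 * q * (- q) * p + s * p ^+ 2) = (c * p) * (p * s - q ^+ 2) by ring.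
rewrite e1 in h1; rewrite e2 in h2.
have cp_gt0 : 0 < c * p by rewrite lt_neqAle h1 eq_sym mulf_neq0.
by move: h2; rewrite leNgt pmulr_rlt0 // det_neg.
Qed.

(** Definiteness of the Hessian is an open condition. *)
Lemma definite_extremum (c : R) : 0 < c * p -> 0 < \det (hessian f a) ->
  \forall x \near a, 0 <= c * (f x - f a).
Proof.
move=> cp_gt0 det_gt0.
have hess_C0 i j : Ck_on 0 U (fun x => hessian f x i j).
  have -> : (fun x => hessian f x i j) = 'D_(delta_mx i 0) ('D_(delta_mx j 0) f).
    by apply/funext => x; rewrite hessianE.
  exact: Ck_on_derive (Ck_on_derive _ f_C2).
have near_p : \forall x \near a, 0 < c * hessian f x 0 0.
  have C0 := Ck_on_continuous (Ck_onZ c U_open (hess_C0 0 0)) Ua.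
  exact: (cvgr_gt _ C0).
have near_det : \forall x \near a, 0 < hessian f x 0 0 * hessian f x 1 1 - hessian f x 0 1 ^+ 2.
  have C0 := Ck_on_continuous (Ck_onD U_open (Ck_onM U_open (hess_C0 0 0) (hess_C0 1 1))
    (Ck_onZ (-1) U_open (Ck_onM U_open (hess_C0 0 1) (hess_C0 0 1)))) Ua.
  have lim_gt0 : 0 < hessian f a 0 0 * hessian f a 1 1 + -1 * (hessian f a 0 1 * hessian f a 0 1).
    by move: det_gt0; rewrite det2 ?expr2 ?mulN1r //; exact: hessian_sym U_open f_C2 Ua.
  by apply: filterS (cvgr_gt _ C0 _ lim_gt0) => x; rewrite expr2 mulN1r.
have near_U : \forall x \near a, U x by apply: open_nbhs_nbhs.
have [d /= d_gt0 good] : nbhs_ball a [set x | [/\ 0 < c * hessian f x 0 0,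
    0 < hessian f x 0 0 * hessian f x 1 1 - hessian f x 0 1 ^+ 2 & U x]].
  rewrite nbhs_ballE; apply: filterS3 near_p near_det near_U => x *; by split.
apply/nbhs_ballP; exists d => // x ax; pose v := x - a.
have in_ball (t : R) : 0 <= t <= 1 -> ball a d (t *: v + a).
  move=> /andP[t0 t1]; move: ax; rewrite -!ball_normE /= ![`|a - _|]distrC addrK normrZ.
  by rewrite ger0_norm //; apply: le_lt_trans; rewrite ler_piMl.
have [|r [t [r_gt0 /andP[t0 t1] fE]]] := @taylor2 v.
  by move=> t t01; have [] := good _ (in_ball t t01).
have It : 0 <= t <= 1 by rewrite !ltW.
have [cp det_t Ut] := good _ (in_ball t It).
have -> : f x = f (v + a) by rewrite /v subrK.
rewrite fE mulrCA pmulr_rge0 // (derive_hessian _ _ U_open f_C2 Ut).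
rewrite quad_form2; last exact: hessian_sym U_open f_C2 Ut.
move: cp det_t; set P := hessian f _ 0 0; set Q := hessian f _ 0 1; set S := hessian f _ 1 1.
move: (v 0 0) (v 1 0) => X Y cp det_t.
have P_neq0 : P != 0 by apply: contraTneq cp => ->; rewrite mulr0 ltxx.
have -> : c * (P * X ^+ 2 + 2 * Q * X * Y + S * Y ^+ 2) =
    (c * P) * ((X + Q / P * Y) ^+ 2 + (P * S - Q ^+ 2) * (Y / P) ^+ 2) by field.
by rewrite mulr_ge0 ?(ltW cp) // addr_ge0 ?sqr_ge0 // mulr_ge0 ?sqr_ge0 // ltW.
Qed.

Lemma local_extremum_det_gt0 : \det (hessian f a) != 0 ->
  local_minimum f a \/ local_maximum f a -> 0 < \det (hessian f a).
Proof.
move=> det_neq0 [fmin|fmax].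
  apply: (@extremum_det_gt0 1) => //.
  by apply: filterS fmin => x; rewrite mul1r subr_ge0.
apply: (@extremum_det_gt0 (-1)) => //.
by apply: filterS fmax => x; rewrite mulN1r opprB subr_ge0.
Qed.

Lemma saddle_det_lt0 : \det (hessian f a) != 0 -> saddle_point f a ->
  \det (hessian f a) < 0.
Proof.
move=> det_neq0 [_ nmin nmax]; rewrite ltNge; apply/negP => det_ge0.
have det_gt0 : 0 < \det (hessian f a) by rewrite lt_neqAle eq_sym det_neq0.
have p_neq0 : p != 0.
  apply: contraTneq det_gt0 => p0.
  rewrite det2; last exact: hessian_sym U_open f_C2 Ua.
  by rewrite -/p p0 mul0r sub0r -leNgt oppr_le0 sqr_ge0.
have [p_lt0|p_gt0|p0] := ltgtP p 0; last by rewrite p0 eqxx in p_neq0.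
  apply: nmax; have := @definite_extremum (-1); rewrite mulN1r oppr_gt0.
  by move=> /(_ p_lt0 det_gt0); apply: filterS => x; rewrite mulN1r opprB subr_ge0.
apply: nmin; have := @definite_extremum 1; rewrite mul1r.
by move=> /(_ p_gt0 det_gt0); apply: filterS => x; rewrite mul1r subr_ge0.
Qed.

End SecondDerivativeTest.

(** * Curves of matrices and linear differential equations *)

Section MatrixCurves.
Variable R : realType.

Lemma mx_norm_le m n (X : 'M[R]_(m, n)) (c : R) : 0 <= c ->
  (forall i j, `|X i j| <= c) -> `|X| <= c.
Proof.
move=> c0 Xc; rewrite [leLHS]/Num.Def.normr /= mx_normrE.
by apply: bigmax_le => // -[i j] _; exact: Xc.
Qed.

Lemma entry_le_norm m n (X : 'M[R]_(m, n)) i j : `|X i j| <= `|X|.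
Proof.
rewrite [leRHS]/Num.Def.normr /= mx_normrE.
by apply/bigmax_geP; right => /=; exists (i, j).
Qed.

Lemma mulmx_norm m n p (A : 'M[R]_(m, n)) (B : 'M[R]_(n, p)) :
  `|A *m B| <= n%:R * `|A| * `|B|.
Proof.
apply: mx_norm_le => [|i j]; first by rewrite !mulr_ge0.
rewrite mxE; apply: (le_trans (ler_norm_sum _ _ _)).
apply: (@le_trans _ _ (\sum_(k < n) `|A| * `|B|)).
  by apply: ler_sum => k _; rewrite normrM ler_pM ?entry_le_norm.
by rewrite sumr_const card_ord -[leLHS]mulr_natl mulrA.
Qed.

Lemma mx_is_deriveP m n (X : R -> 'M[R]_(m, n)) (t : R) dX :
  is_derive t 1 X dX <-> forall i j, is_derive t 1 (fun s => X s i j) (dX i j).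
Proof.
split=> [[/derivable_mxP dXt <-] i j|dXij].
  have dX' : derivable X t 1 by apply/derivable_mxP.
  by rewrite derive_mx // mxE; apply: DeriveDef.
have dXt : derivable X t 1 by apply/derivable_mxP => i j; have [] := dXij i j.
apply: DeriveDef => //; rewrite derive_mx //; apply/matrixP => i j.
by rewrite mxE; have [] := dXij i j.
Qed.

Lemma is_derive_mulmx m n p (X : R -> 'M[R]_(m, n)) (Y : R -> 'M[R]_(n, p)) (t : R) dX dY :
  is_derive t 1 X dX -> is_derive t 1 Y dY ->
  is_derive t 1 (fun s => X s *m Y s) (dX *m Y t + X t *m dY).
Proof.
move=> /mx_is_deriveP dXt /mx_is_deriveP dYt; apply/mx_is_deriveP => i j.
have dk k : is_derive t 1 ((fun s => X s i k) * (fun s => Y s k j))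
    (X t i k *: dY k j + Y t k j *: dX i k).
  by apply: is_deriveM.
have := is_derive_sum dk; congr is_derive.
- by apply/funext => s; rewrite !fct_sumE mxE.
- rewrite !mxE -big_split; apply: eq_bigr => k _ /=.
  by rewrite addrC [_ *: dX i k]mulrC.
Qed.

Lemma is_derive_mulmxl m n p (A : 'M[R]_(m, n)) (Y : R -> 'M[R]_(n, p)) (t : R) dY :
  is_derive t 1 Y dY -> is_derive t 1 (fun s => A *m Y s) (A *m dY).
Proof.
move=> dYt; have := is_derive_mulmx (is_derive_cst A t 1) dYt.
by rewrite mul0mx add0r.
Qed.

Lemma is_derive_trmx m n (X : R -> 'M[R]_(m, n)) (t : R) dX :
  is_derive t 1 X dX -> is_derive t 1 (fun s => (X s)^T) dX^T.
Proof.
move=> /mx_is_deriveP dXt; apply/mx_is_deriveP => i j; rewrite mxE.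
by have := dXt j i; congr is_derive; apply/funext => s; rewrite mxE.
Qed.

Lemma is_derive_continuous (V : normedModType R) (X : R -> V) dX :
  (forall t : R, is_derive t 1 X (dX t)) -> continuous X.
Proof.
move=> dXt t; apply: differentiable_continuous; apply/derivable1_diffP.
by have [] := dXt t.
Qed.

Lemma derivable_is_derive (V : normedModType R) (X : R -> V) (t : R) :
  derivable X t 1 -> is_derive t 1 X (derive1 X t).
Proof. by move=> d; exact: (DeriveDef d (esym (derive1E _ _))). Qed.

(** The mean value inequality for curves, entry by entry. *)
Lemma growth_le m n (X dX : R -> 'M[R]_(m, n)) (G dG : R -> R) (s t : R) : s <= t ->
  (forall u : R, is_derive u 1 X (dX u)) -> (forall u : R, is_derive u 1 G (dG u)) ->
  (forall u, s <= u <= t -> `|dX u| <= dG u) ->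
  `|X t - X s| <= G t - G s.
Proof.
move=> st dXu dGu le_dX.
have bound (f df : R -> R) : (forall u : R, is_derive u 1 f (df u)) ->
    (forall u, s <= u <= t -> df u <= dG u) -> f t - f s <= G t - G s.
  move=> dfu le_df.
  have dGf (u : R) : is_derive u 1 (G - f) (dG u - df u) by apply: is_deriveB.
  have [|c cst E] := @MVT_segment R (G - f) (fun u => dG u - df u) s t st
    (fun u _ => dGf u).
    by apply: continuous_subspaceT; exact: is_derive_continuous dGf.
  have {}E : (G t - f t) - (G s - f s) = (dG c - df c) * (t - s) by exact: E.
  suff : 0 <= (dG c - df c) * (t - s) by rewrite -E; lra.
  apply: mulr_ge0; last by rewrite subr_ge0.
  by rewrite subr_ge0; apply: le_df; move: cst; rewrite in_itv.
have G_mono : 0 <= G t - G s.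
  rewrite -(subrr (0 : R)); apply: (bound (fun=> 0) (fun=> 0)).
  by move=> u /le_dX; apply: le_trans.
apply: mx_norm_le => // i j; rewrite !mxE ler_norml; apply/andP; split; last first.
  apply: (bound (fun u => X u i j) (fun u => dX u i j)) => u; first by move/mx_is_deriveP: (dXu u).
  by move=> /le_dX; apply: le_trans; apply: le_trans (entry_le_norm _ i j); exact: ler_norm.
have := bound (fun u => - X u i j) (fun u => - dX u i j).
rewrite lerNl opprB opprK [- _ + _]addrC; apply=> u.
  by apply: is_deriveN; move/mx_is_deriveP: (dXu u).
move=> /le_dX; apply: le_trans; apply: le_trans (entry_le_norm _ i j).
by rewrite -normrN; exact: ler_norm.
Qed.

(** The function B e^(c |t|) grows fast enough to dominate X, but has a corner at
    0, so that the two half-lines are treated separately. *)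
Lemma exp_growth m n (X dX : R -> 'M[R]_(m, n)) (c B T t : R) : 0 < c -> 0 <= B ->
  (forall u : R, is_derive u 1 X (dX u)) -> X 0 = 0 ->
  (forall u, `|u| <= T -> `|dX u| <= c * B * expR (c * `|u|)) ->
  `|t| <= T -> `|X t| <= B * expR (c * `|t|).
Proof.
move=> c0 B0 dXu X0 le_dX tT.
have dexp (a b u : R) : is_derive u 1 (fun s => b * expR (a * s)) (b * a * expR (a * u)).
  have d1 : is_derive u 1 (fun s => expR (a * s)) (expR (a * u) * a).
    exact: (is_derive1_comp (is_derive_expR _) (is_derive_linear a u)).
  have := is_deriveZ b d1.
  by congr is_derive; rewrite /GRing.scale /= -mulrA [expR _ * a]mulrC.
have e0 u : 0 < expR (c * u) := expR_gt0 _.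
have [t0|t0] := leP 0 t.
  have := @growth_le _ _ X dX _ _ 0 t t0 dXu (dexp c B).
  rewrite X0 subr0 mulr0 expR0 mulr1 (ger0_norm t0) => le.
  apply: (le_trans (le _)); last by rewrite gerBl.
  move=> u /andP[u0 ut]; rewrite [B * c]mulrC; have := le_dX u.
  by rewrite ger0_norm //; apply; apply: (le_trans ut); rewrite -(ger0_norm t0).
have := @growth_le _ _ X dX _ _ t 0 (ltW t0) dXu (dexp (- c) (- B)).
rewrite X0 sub0r normrN mulr0 expR0 mulr1 (ltr0_norm t0) => le.
apply: (le_trans (le _)); last by rewrite mulNr opprK mulNr -mulrN; lra.
move=> u /andP[tu u0]; rewrite mulrNN [B * c]mulrC.
have := le_dX u; rewrite ler0_norm // mulrN mulNr; apply.
by move: tT; rewrite ltr0_norm //; apply: le_trans; rewrite lerN2.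
Qed.

Lemma continuous_bounded m n (A : R -> 'M[R]_(m, n)) (T : R) : continuous A ->
  exists2 K, 0 <= K & forall t, `|t| <= T -> `|A t| <= K.
Proof.
move=> cA; have [T0|T0] := leP 0 T; last first.
  by exists 0 => // t tT; have := le_lt_trans tT T0; rewrite normr_lt0.
have cn : {within `[- T, T], continuous (fun t => `|A t|)}.
  by apply: continuous_subspaceT => t; exact: (cvg_norm (cA t)).
have [|k _ max_k] := EVT_max _ cn; first lra.
by exists `|A k| => // t; rewrite ler_norml => tT; apply: max_k; rewrite in_itv.
Qed.

(** If B is the maximum of |X(t)| e^(- 2 kappa |t|) on the interval, then the
    differential inequality returns the bound B / 2 + delta / (2 kappa) for
    the same quantity, whence B <= delta / kappa. *)
Lemma gronwall m n (X dX : R -> 'M[R]_(m, n)) (k d T t : R) : 0 < k -> 0 <= d ->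
  (forall u : R, is_derive u 1 X (dX u)) -> X 0 = 0 ->
  (forall u, `|u| <= T -> `|dX u| <= k * `|X u| + d) ->
  `|t| <= T -> `|X t| <= d / k * expR (2 * k * `|t|).
Proof.
move=> k0 d0 dXu X0 le_dX tT.
have cX := is_derive_continuous dXu.
pose w (u : R) := expR (2 * k * `|u|).
have w0 u : 0 < w u := expR_gt0 _.
have w1 u : 1 <= w u by rewrite -expR0 ler_expR !mulr_ge0 // ltW.
have cw : continuous (fun u => `|X u| / w u).
  move=> u; apply: cvgM; first exact: (cvg_norm (cX u)).
  apply: cvgV; first by rewrite gt_eqF.
  apply: continuous_comp; last exact: continuous_expR.
  by apply: cvgM; [exact: cvg_cst|exact: (cvg_norm cvg_id)].
have T0 : 0 <= T by exact: le_trans tT.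
have [|s sT max_s] := @EVT_max _ (fun u => `|X u| / w u) (- T) T _
  (continuous_subspaceT cw); first lra.
pose B : R := `|X s| / w s; rewrite -/B in max_s.
have leB u : `|u| <= T -> `|X u| <= B * w u.
  by rewrite ler_norml => uT; rewrite -ler_pdivrMr //; apply: max_s; rewrite in_itv.
have B0 : 0 <= B by rewrite divr_ge0 // ltW.
have leB' u : `|u| <= T -> `|X u| <= (B / 2 + d / (2 * k)) * w u.
  apply: (exp_growth _ _ dXu X0); first lra.
    by rewrite addr_ge0 // divr_ge0 // mulr_ge0 // ltW.
  move=> v vT; apply: (le_trans (le_dX v vT)).
  have -> : 2 * k * (B / 2 + d / (2 * k)) = k * B + d by field; rewrite ?gt_eqF.
  rewrite mulrDl lerD //; last by apply: ler_peMr => //; exact: w1.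
  by rewrite -mulrA ler_pM2l //; exact: leB.
have {}sT : `|s| <= T.
  by move: sT; rewrite in_itv /= ler_norml.
suff leB2 : B <= d / k by apply: (le_trans (leB t tT)); rewrite ler_pM2r.
have := leB' s sT; rewrite -ler_pdivrMr // -/B => le2.
have E : d / (2 * k) = d / k / 2 by field; rewrite ?gt_eqF.
move: le2; rewrite E; lra.
Qed.

(** Cut the graph of f at the origin: each half is an integral from -1 of a
    function that vanishes on the negative half-line. *)
Lemma antiderivative (f : R -> R) : continuous f ->
  exists2 F, F 0 = 0 & forall t : R, is_derive t 1 F (f t).
Proof.
move=> cf.
have half (k : R -> R) : continuous k -> (forall t : R, t <= 0 -> k t = 0) ->
    exists F : R -> R, forall t : R, is_derive t 1 F (k t).
  move=> ck k0.
  pose F : R -> R := fun x => (\int[@lebesgue_measure R]_(t in `[- 1, x]) k t)%R.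
  exists F => t.
  have [tN1|tN1] := ltP (- 1) t.
    have [||dF dFt] := @continuous_FTC1_closed R k (- 1) t (t + 1) _ _ tN1 (ck t).
    - by rewrite ltrDl.
    - apply: continuous_compact_integrable; first exact: segment_compact.
      exact: continuous_subspaceT.
    - exact: (DeriveDef dF (etrans (esym (derive1E _ _)) dFt)).
  have F0 s : s < 0 -> F s = 0.
    move=> s0; rewrite /F.
    rewrite (@eq_Rintegral _ _ _ _ _ (fun=> 0)); first by rewrite /Rintegral integral0.
    move=> x; rewrite inE /= in_itv /= => /andP[_ xs].
    by apply: k0; apply: le_trans xs (ltW s0).
  have t0 : t < 0 by apply: le_lt_trans tN1 _; rewrite oppr_lt0.
  rewrite k0 ?ltW //.
  apply: (@near_eq_is_derive _ _ _ (fun=> 0)).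
  by near=> s; rewrite F0 //; near: s; exact: lt_nbhsl.
pose P (t : R) : R := Num.max t 0.
have cP : continuous (P : R -> R).
  by move=> t; apply: continuous_max; [exact: cvg_id|exact: cvg_cst].
have [|t t0|F dF] := half (fun t => f (P t) - f 0).
- move=> t; apply: cvgB; last exact: cvg_cst.
  by apply: continuous_comp; [exact: cP|exact: cf].
- by rewrite /P max_r // subrr.
have [|t t0|G dG] := half (fun t => f (- P t) - f 0).
- move=> t; apply: cvgB; last exact: cvg_cst.
  apply: continuous_comp; last exact: cf.
  by apply: cvgN; exact: cP.
- by rewrite /P max_r // oppr0 subrr.
pose K (t : R) : R := f 0 * t + F t - G (- t).
have dK (t : R) : is_derive t 1 K (f t).
  have d1 := is_derive_linear (f 0) t.
  have dN : is_derive t 1 (fun s : R => - s) (- 1) by apply: is_deriveN.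
  have d2 := is_derive1_comp (dG (- t)) dN.
  have := is_deriveB (is_deriveD d1 (dF t)) d2.
  congr is_derive; rewrite /P.
  have [t0|t0] := leP 0 t.
    by rewrite max_r ?oppr_le0 // oppr0; ring.
  by rewrite max_l ?oppr_ge0 ?ltW // opprK; ring.
exists (fun t => K t - K 0); first by rewrite subrr.
by move=> t; have := is_deriveB (dK t) (is_derive_cst (K 0) t 1); rewrite subr0.
Unshelve. all: by end_near. Qed.
Lemma le_geometric0 (a C : R) : (forall k, a <= C / 2 ^+ k) -> a <= 0.
Proof.
move=> le_a; have [//|a0] := leP a 0.
have C0 : 0 < C by have := le_a 0%N; rewrite expr0 divr1; apply: lt_le_trans.
have kC := Num.Theory.archi_boundP (ltW (divr_gt0 C0 a0)).
set k := Num.Def.archi_bound _ in kC; have := le_a k.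
suff : C / 2 ^+ k < a by move=> lt1 le1; have := lt_le_trans lt1 le1; rewrite ltxx.
rewrite ltr_pdivrMr ?exprn_gt0 // mulrC -ltr_pdivrMr //; apply: (lt_trans kC).
by rewrite -natrX ltr_nat ltn_expl.
Qed.

(** The limit is the supremum of the increasing sequence u k - 2 C / 2^k, which
    stays below the decreasing sequence u k + 2 C / 2^k. *)
Lemma geometric_limit (u : nat -> R) (C : R) :
  (forall k, `|u k.+1 - u k| <= C / 2 ^+ k) ->
  exists l, forall k, `|l - u k| <= 2 * C / 2 ^+ k.
Proof.
move=> uC; pose e k := 2 * C / 2 ^+ k.
have eS k : e k - e k.+1 = C / 2 ^+ k.
  by rewrite /e exprS; field; rewrite expf_neq0.
have lo k : u k - e k <= u k.+1 - e k.+1.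
  by have := uC k; rewrite ler_norml -eS; lra.
have hi k : u k.+1 + e k.+1 <= u k + e k.
  by have := uC k; rewrite ler_norml -eS; lra.
have e0 k : 0 <= e k.
  have C0 : 0 <= C by have := le_trans (normr_ge0 _) (uC 0%N); rewrite expr0 divr1.
  by rewrite divr_ge0 ?mulr_ge0 ?exprn_ge0.
have lohi j k : u j - e j <= u k + e k.
  have loD i m : u i - e i <= u (i + m)%N - e (i + m)%N.
    by elim: m => [|m IH]; rewrite ?addn0 ?addnS //; apply: le_trans IH (lo _).
  have hiD i m : u (i + m)%N + e (i + m)%N <= u i + e i.
    by elim: m => [|m IH]; rewrite ?addn0 ?addnS //; apply: le_trans (hi _) IH.
  apply: (le_trans (loD j k)); apply: le_trans (hiD k j); rewrite addnC.
  by have := e0 (k + j)%N; lra.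
exists (sup [set u k - e k | k in setT]) => k; rewrite ler_norml -/(e k).
have ub : has_sup [set u k - e k | k in setT].
  by split; [exists (u 0%N - e 0%N), 0%N|exists (u 0%N + e 0%N) => _ [j _ <-]].
have le1 : u k - e k <= sup [set u k - e k | k in setT].
  by apply: sup_upper_bound => //; exists k.
have le2 : sup [set u k - e k | k in setT] <= u k + e k.
  by apply: ge_sup; [case: ub|move=> _ [j _ <-]].
lra.
Qed.

Lemma mx_antiderivative m n (X : R -> 'M[R]_(m, n)) : continuous X ->
  exists2 Y : R -> 'M[R]_(m, n), Y 0 = 0 & forall t : R, is_derive t 1 Y (X t).
Proof.
move=> cX.
have cij (ij : 'I_m * 'I_n) : continuous (fun t => X t ij.1 ij.2).
  move=> t; exact: (proj1 (@cvg_mxP R R (nbhs t) _ m n X (X t)) (cX t) ij.1 ij.2).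
have exF ij : exists F : R -> R, F 0 = 0 /\
    forall t : R, is_derive t 1 F (X t ij.1 ij.2).
  by have [F ? ?] := antiderivative (cij ij); exists F.
have [F FP] := choice exF.
exists (fun t => \matrix_(i, j) F (i, j) t).
  by apply/matrixP => i j; rewrite !mxE; case: (FP (i, j)).
move=> t; apply/mx_is_deriveP => i j; case: (FP (i, j)) => _ /(_ t).
by congr is_derive; apply/funext => s; rewrite mxE.
Qed.

Lemma mx_geometric_limit m n (u : nat -> 'M[R]_(m, n)) (C : R) :
  (forall k, `|u k.+1 - u k| <= C / 2 ^+ k) ->
  exists l : 'M[R]_(m, n), forall k, `|l - u k| <= 2 * C / 2 ^+ k.
Proof.
move=> uC.
have lim ij : exists l, forall k, `|l - u k ij.1 ij.2| <= 2 * C / 2 ^+ k.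
  apply: geometric_limit => k; apply: le_trans (uC k).
  by have := entry_le_norm (u k.+1 - u k) ij.1 ij.2; rewrite !mxE.
have [l lP] := choice lim; exists (\matrix_(i, j) l (i, j)) => k.
have C0 : 0 <= C by have := le_trans (normr_ge0 _) (uC 0%N); rewrite expr0 divr1.
apply: mx_norm_le => [|i j]; first by rewrite divr_ge0 ?mulr_ge0 ?exprn_ge0.
by rewrite !mxE; exact: (lP (i, j)).
Qed.

Lemma mulmx_continuous m n p (A : R -> 'M[R]_(m, n)) (B : R -> 'M[R]_(n, p)) :
  continuous A -> continuous B -> continuous (fun t => A t *m B t).
Proof. by move=> cA cB t; apply: cvg_mulmx; [exact: cA|exact: cB]. Qed.

(** Picard iteration, in the norm weighted by e^(- 2 kappa |t|), for which the
    iteration map is a contraction of ratio 1 / 2 on every bounded interval. *)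
Lemma linear_ode_exists n (A : R -> 'M[R]_n) : continuous A ->
  exists2 X : R -> 'M[R]_n, X 0 = 1%:M & forall t : R, is_derive t 1 X (A t *m X t).
Proof.
move=> cA.
have step (f : R -> 'M[R]_n) : exists F : R -> 'M[R]_n, continuous f ->
    F 0 = 1%:M /\ forall t : R, is_derive t 1 F (A t *m f t).
  have [cf|ncf] := pselect (continuous f); last by exists f.
  have [F F0 dF] := mx_antiderivative (mulmx_continuous cA cf).
  exists (fun t => 1%:M + F t) => _; rewrite F0 addr0; split=> // t.
  by have := is_deriveD (is_derive_cst 1%:M t 1) (dF t); rewrite add0r.
have [Phi PhiP] := choice step; pose S k := iter k Phi (fun=> 1%:M).
have cS k : continuous (S k).
  elim: k => [|k IH] /=; first by move=> t; exact: cvg_cst.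
  by have [_ d] := PhiP _ IH; exact: is_derive_continuous d.
have S0 k : S k 0 = 1%:M by case: k => [//|k] /=; have [] := PhiP _ (cS k).
have dS k (t : R) : is_derive t 1 (S k.+1) (A t *m S k t).
  by have [_] := PhiP _ (cS k); apply.
have kappa T : exists2 k : R, 0 < k & forall t, `|t| <= T ->
    forall B : 'M[R]_n, `|A t *m B| <= k * `|B|.
  have [K K0 AK] := continuous_bounded T cA; exists (n%:R * K + 1).
    by rewrite ltr_wpDl ?mulr_ge0.
  move=> t tT B; apply: (le_trans (mulmx_norm _ _)); rewrite ler_wpM2r //.
  by rewrite ler_wpDr // ler_wpM2l ?AK.
have contract (X Y : R -> 'M[R]_n) (T k b t : R) : 0 < k -> 0 <= b ->
    (forall t, `|t| <= T -> forall B : 'M[R]_n, `|A t *m B| <= k * `|B|) ->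
    X 0 = 0 -> (forall t : R, is_derive t 1 X (A t *m Y t)) ->
    (forall t, `|t| <= T -> `|Y t| <= b * expR (2 * k * `|t|)) ->
    `|t| <= T -> `|X t| <= b / 2 * expR (2 * k * `|t|).
  move=> k0 b0 Ak X0 dX Yb tT.
  apply: (exp_growth _ _ dX X0 _ tT); rewrite ?mulr_gt0 ?divr_ge0 // => u uT.
  apply: (le_trans (Ak u uT _)).
  have -> : 2 * k * (b / 2) = k * b by field.
  by rewrite -mulrA ler_pM2l //; exact: Yb.
have cauchy T : exists2 C, 0 <= C & forall t, `|t| <= T ->
    forall k, `|S k.+1 t - S k t| <= C / 2 ^+ k.
  have [k k0 Ak] := kappa T.
  have [M M0 SM] := continuous_bounded T
    (fun t => @cvgB _ _ _ _ _ _ _ _ _ (cS 1%N t) (cS 0%N t)).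
  have bound j t : `|t| <= T -> `|S j.+1 t - S j t| <= M / 2 ^+ j * expR (2 * k * `|t|).
    elim: j t => [|j IH] t tT.
      rewrite expr0 divr1; apply: (le_trans (SM t tT)); rewrite ler_peMr //.
      by rewrite -expR0 ler_expR !mulr_ge0 // ltW.
    have -> : M / 2 ^+ j.+1 = M / 2 ^+ j / 2 by rewrite exprSr invfM mulrA.
    apply: (@contract (fun t => S j.+2 t - S j.+1 t) (fun t => S j.+1 t - S j t) T) => //.
    - by rewrite divr_ge0 ?exprn_ge0.
    - by rewrite !S0 subrr.
    - by move=> u; have := is_deriveB (dS j.+1 u) (dS j u); rewrite mulmxBr.
  exists (M * expR (2 * k * T)); first by rewrite mulr_ge0 ?expR_ge0.
  move=> t tT j; apply: (le_trans (bound j t tT)); rewrite mulrAC ler_wpM2r ?invr_ge0 ?exprn_ge0 //.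
  by rewrite ler_wpM2l // ler_expR ler_wpM2l // mulr_ge0 // ltW.
have pointwise (t : R) : exists l : 'M[R]_n, forall C, (forall k, `|S k.+1 t - S k t| <= C / 2 ^+ k) ->
    forall k, `|l - S k t| <= 2 * C / 2 ^+ k.
  have [C0 _ C0P] := cauchy `|t|.
  have [l lP] := mx_geometric_limit (C0P t (lexx _)).
  exists l => C CP k; have [l' l'P] := mx_geometric_limit CP.
  suff -> : l = l' by [].
  apply/eqP; rewrite -subr_eq0 -normr_le0; apply: (@le_geometric0 _ (2 * C0 + 2 * C)) => j.
  rewrite mulrDl -(subrKA (S j t)); apply: (le_trans (ler_normD _ _)).
  by rewrite lerD // -normrN opprB.
have [X XP] := choice pointwise.
have unif T : exists2 C, 0 <= C & forall t, `|t| <= T -> forall k, `|X t - S k t| <= C / 2 ^+ k.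
  have [C C0 CP] := cauchy T; exists (2 * C); first by rewrite mulr_ge0.
  by move=> t tT; apply: XP; exact: CP.
have cX : continuous X.
  move=> t; apply/cvgrPdist_lt => e e0.
  have [C C0 CP] := unif (`|t| + 1).
  have [k ke] : exists k, C / 2 ^+ k < e / 3.
    apply: contrapT => no; have : e / 3 <= 0.
      apply: (@le_geometric0 _ C) => k; rewrite leNgt; apply/negP => lt.
      by apply: no; exists k.
    by rewrite leNgt divr_gt0.
  have tT : `|t| <= `|t| + 1 by rewrite lerDl.
  near=> s.
  have sT : `|s| <= `|t| + 1.
    rewrite -[s](subrK t) addrC; apply: (le_trans (ler_normD _ _)); rewrite lerD2l.
    rewrite distrC; near: s; have /cvgrPdist_le := @cvg_id _ (nbhs t); apply; exact: ltr01.
  have sk : `|S k t - S k s| < e / 3.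
    by near: s; have /cvgrPdist_lt := cS k t; apply; rewrite divr_gt0.
  have -> : X t - X s = (X t - S k t) + (S k t - S k s) - (X s - S k s).
    by rewrite opprB !subrKA.
  apply: (le_lt_trans (ler_normB _ _)).
  have := ler_normD (X t - S k t) (S k t - S k s).
  have := CP t tT k; have := CP s sT k.
  lra.
have [Y0 dY] := PhiP X cX; suff E t : X t = Phi X t.
  by exists (Phi X) => // t; rewrite -E; exact: dY.
 have [k k0 Ak] := kappa `|t|; have [C C0 CP] := unif `|t|.
apply/eqP; rewrite -subr_eq0 -normr_le0.
apply: (@le_geometric0 _ (C + C * expR (2 * k * `|t|))) => j.
have tt : `|t| <= `|t| by [].
have e1 u : 1 <= expR (2 * k * `|u|) by rewrite -expR0 ler_expR !mulr_ge0 // ltW.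
have le1 : `|Phi X t - S j.+1 t| <= C / 2 ^+ j / 2 * expR (2 * k * `|t|).
  apply: (@contract (fun t => Phi X t - S j.+1 t) (fun t => X t - S j t) `|t|) => //.
  - by rewrite divr_ge0 ?exprn_ge0.
  - by rewrite Y0 S0 subrr.
  - by move=> u; have := is_deriveB (dY u) (dS j u); rewrite mulmxBr.
  - move=> u ut; apply: (le_trans (CP u ut j)); rewrite ler_peMr //.
    by rewrite divr_ge0 ?exprn_ge0.
have le2 := CP t tt j.+1.
have -> : X t - Phi X t = (X t - S j.+1 t) - (Phi X t - S j.+1 t) by rewrite opprB subrKA.
apply: (le_trans (ler_normB _ _)); rewrite mulrDl; apply: lerD.
  apply: (le_trans le2); rewrite exprS invfM mulrCA ler_piMl ?divr_ge0 ?exprn_ge0 //.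
  by rewrite invf_le1 // ler1n.
apply: (le_trans le1); rewrite [leLHS]mulrAC [leRHS]mulrAC ler_piMr //.
  by rewrite mulr_ge0 ?divr_ge0 ?exprn_ge0 ?expR_ge0.
by rewrite invf_le1 // ler1n.
Unshelve. all: by end_near. Qed.
End MatrixCurves.
(** * Symplectic linear flows *)
Section SymplecticFlow.
Variables (R : realType) (n : nat) (W : 'M[R]_n) (S : R -> 'M[R]_n).
Hypotheses (W_skew : W^T = - W) (S_sym : forall t, (S t)^T = S t).
(** Hamilton's equations M X' = J S X, multiplied by J: here W = J M. *)
Definition hamiltonian_flow p (X : R -> 'M[R]_(n, p)) := exists2 dX,
  forall t : R, is_derive t 1 X (dX t) & forall t, W *m dX t = - (S t *m X t).
Lemma symplectic_invariant p q (X : R -> 'M[R]_(n, p)) (Y : R -> 'M[R]_(n, q)) t :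
  hamiltonian_flow X -> hamiltonian_flow Y ->
  (X t)^T *m W *m Y t = (X 0)^T *m W *m Y 0.
Proof.
move=> [dX dXt WX] [dY dYt WY].
have dW (s : R) : is_derive s 1 (fun s => (X s)^T *m W *m Y s) 0.
  have d1 := is_derive_mulmx (is_derive_trmx (dXt s)) (is_derive_mulmxl W (dYt s)).
  have -> : (fun s => (X s)^T *m W *m Y s) = (fun s => (X s)^T *m (W *m Y s)).
    by apply/funext => u; rewrite mulmxA.
  suff <- : (dX s)^T *m (W *m Y s) + (X s)^T *m (W *m dY s) = 0 by [].
  have -> : (dX s)^T *m (W *m Y s) = (X s)^T *m S s *m Y s.
    rewrite mulmxA; congr (_ *m _); apply: trmx_inj.
    by rewrite trmx_mul W_skew trmxK mulNmx WX opprK trmx_mul trmxK S_sym.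
  by rewrite WY mulmxN mulmxA subrr.
have const (a b : R) : a <= b ->
    (X b)^T *m W *m Y b = (X a)^T *m W *m Y a.
  move=> ab; apply/eqP; rewrite -subr_eq0 -normr_le0 -(subrr (0 : R)).
  apply: (@growth_le _ _ _ (fun s => (X s)^T *m W *m Y s) (fun=> 0) (fun=> 0) (fun=> 0) a b ab dW).
  by move=> u _; rewrite normr0.
by have [t0|/ltW t0] := leP 0 t; rewrite (const _ _ t0).
Qed.

Section Monodromy.
Hypothesis W_unit : W \in unitmx.
Variables (X : R -> 'M[R]_n).
Hypotheses (X_flow : hamiltonian_flow X) (X0 : X 0 = 1%:M).

Lemma flow_symplectic t : (X t)^T *m W *m X t = W.
Proof. by rewrite (symplectic_invariant t X_flow X_flow) X0 trmx1 mul1mx mulmx1. Qed.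

(** The determinant is a continuous function of time with values in {1, -1}. *)
Lemma flow_det t : \det (X t) = 1.
Proof.
have detW : \det W != 0 by rewrite -unitfE -unitmxE.
have sq s : \det (X s) ^+ 2 = 1.
  have := congr1 determinant (flow_symplectic s).
  rewrite !det_mulmx det_tr mulrAC -expr2 => E; apply: (mulIf detW).
  by rewrite mul1r.
have cX : continuous X by case: X_flow => dX dXt _; exact: is_derive_continuous dXt.
have cdet : continuous (fun s => \det (X s)).
  by move=> s; apply: cvg_det; exact: cX.
have pm s : \det (X s) = 1 \/ \det (X s) = -1.
  have /eqP := sq s; rewrite sqrf_eq1 => /orP[] /eqP; [by left|by right].
have [//|dN] := pm t.
have d0 : \det (X 0) = 1 by rewrite X0 det1.
have no s : \det (X s) <> 0.
  by have := sq s => + E; rewrite E expr0n => /eqP; rewrite eq_sym oner_eq0.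
have ivt (a b : R) : a <= b -> Num.min (\det (X a)) (\det (X b)) <= 0 <=
    Num.max (\det (X a)) (\det (X b)) -> False.
  move=> ab; move/(IVT ab (continuous_subspaceT cdet)) => [c _]; exact: no.
exfalso; have [t0|/ltW t0] := leP 0 t; apply: (ivt _ _ t0); rewrite d0 dN.
  by rewrite min_r ?max_l; lra.
by rewrite min_l ?max_r; lra.
Qed.

(** In particular, with the velocity of a T-periodic solution for v: being
    symplectic, X(T) fixes it on both sides. *)
Lemma flow_fixed p (v : R -> 'M[R]_(n, p)) T : hamiltonian_flow v -> v T = v 0 ->
  X T *m v 0 = v 0 /\ (W *m v 0)^T *m X T = (W *m v 0)^T.
Proof.
move=> v_flow vT.
have E : (X T)^T *m W *m v 0 = W *m v 0.
  have := symplectic_invariant T X_flow v_flow.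
  by rewrite vT X0 trmx1 mul1mx.
have XWu : (X T)^T *m W \in unitmx.
  rewrite unitmx_mul W_unit andbT unitmx_tr unitmxE flow_det; exact: unitr1.
split; first by apply: (can_inj (mulKmx XWu)); rewrite mulmxA flow_symplectic.
by apply: trmx_inj; rewrite trmx_mul !trmxK mulmxA.
Qed.

End Monodromy.

Lemma skew_isotropic (v : 'cV[R]_n) : (W *m v)^T *m v = 0.
Proof.
set a := (W *m v)^T *m v.
have aT : a^T = - a.
  by rewrite /a trmx_mul trmxK trmx_mul W_skew mulmxN mulNmx opprK mulmxA.
apply/matrixP => i j; rewrite (ord1 i) (ord1 j) [RHS]mxE.
have /matrixP/(_ 0 0) := aT; rewrite !mxE -/a => E0.
apply/eqP; move/eqP: E0; rewrite -subr_eq0 opprK -mulr2n mulrn_eq0 /=.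
by move=> /eqP ->.
Qed.

End SymplecticFlow.

(** * Uniform limits of flows *)

Section UniformLimits.
Variables (R : realType) (T : Type) (F : set_system T).
Context {FF : Filter F}.

Definition uniformly (V : normedModType R) (A : set R) (f : T -> R -> V) (g : R -> V) :=
  forall e : R, 0 < e -> F [set r | forall s, A s -> `|f r s - g s| <= e].

Lemma uniformly_cvg (V : normedModType R) A (f : T -> R -> V) g s :
  uniformly A f g -> A s -> f r s @[r --> F] --> g s.
Proof.
move=> fg As; apply/cvgrPdist_le => e e0; apply: filterS (fg e e0) => r /(_ s As).
by rewrite distrC.
Qed.

Lemma uniformly_le (V V' : normedModType R) A (f : T -> R -> V) g (f' : T -> R -> V') g' (K : R) :
  uniformly A f g ->
  F [set r | forall s, A s -> `|f' r s - g' s| <= K * `|f r s - g s|] ->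
  uniformly A f' g'.
Proof.
move=> fg le_f' e e0; pose K' := Num.max K 1.
have K'0 : 0 < K' by rewrite lt_max ltr01 orbT.
apply: filterS2 (fg (e / K') (divr_gt0 e0 K'0)) le_f' => r le1 le2 s As.
apply: (le_trans (le2 s As)); apply: (@le_trans _ _ (K' * `|f r s - g s|)).
  by rewrite ler_wpM2r // le_max lexx.
by rewrite mulrC -ler_pdivlMr //; exact: le1.
Qed.

(** Continuity along a compact piece of a limit curve upgrades to uniformity. *)
Lemma uniformly_comp (V V' : normedModType R) (a b : R) (u : T -> R -> V) Z (f : V -> V') :
  continuous Z -> (forall s, {for Z s, continuous f}) ->
  uniformly `[a, b] u Z ->
  uniformly `[a, b] (fun r s => f (u r s)) (fun s => f (Z s)).
Proof.
move=> cZ cf uZ e e0.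
have := @segment_compact R a b; rewrite compact_near_coveringP.
pose I : set R := [set` `[a, b]].
move=> /(_ T F (fun r s => I s -> `|f (u r s) - f (Z s)| <= e) FF) near_P.
suff : F [set r | I `<=` (fun s => I s -> `|f (u r s) - f (Z s)| <= e)].
  by apply: filterS => r le s ab; exact: le.
apply: near_P => s _.
have e2 : 0 < e / 2 by rewrite divr_gt0.
have /cvgrPdist_le/(_ _ e2)/nbhs_normP[d /= d0 fd] := cf s.
have d2 : 0 < d / 2 by rewrite divr_gt0.
exists ([set s' | `|Z s - Z s'| < d / 2], [set r | forall s, I s -> `|u r s - Z s| <= d / 2]).
  split => /=.
    by have /cvgrPdist_lt := cZ s; apply.
  exact: uZ _ d2.
move=> [s' r] /= [Zs' ur] abs'.
have f1 : `|f (Z s) - f (Z s')| <= e / 2 by apply: fd => /=; lra.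
have f2 : `|f (Z s) - f (u r s')| <= e / 2.
  apply: fd => /=; rewrite -(subrKA (Z s')); apply: (le_lt_trans (ler_normD _ _)).
  by have := ur s' abs'; rewrite distrC; lra.
rewrite -(subrKA (f (Z s))); apply: (le_trans (ler_normD _ _)).
by rewrite distrC; lra.
Qed.

Lemma uniformly_perturb (V : normedModType R) A (f d f' : T -> R -> V) g :
  uniformly A f g -> uniformly A d (fun=> 0) ->
  F [set r | forall s, A s -> f' r s = f r s - d r s] -> uniformly A f' g.
Proof.
move=> fg d0 f'E e e0; have e2 : 0 < e / 2 by rewrite divr_gt0.
apply: filterS3 f'E (fg _ e2) (d0 _ e2) => r f'E le1 le2 s As; rewrite f'E // addrAC.
apply: (le_trans (ler_normB _ _)); have := le1 s As; have := le2 s As.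
by rewrite subr0; lra.
Qed.

Lemma uniformly_vanishing (V : normedModType R) A (c : T -> R) (f : T -> R -> V) g K :
  c r @[r --> F] --> 0 -> (forall s, A s -> `|g s| <= K) -> uniformly A f g ->
  uniformly A (fun r s => c r *: f r s) (fun=> 0).
Proof.
move=> c0 gK fg e e0; pose C : R := `|K| + 1.
have C0 : 0 < C by rewrite ltr_wpDl.
move/cvgr0_norm_le: c0 => /(_ _ (divr_gt0 e0 C0)) le_c.
apply: filterS2 le_c (fg 1 ltr01) => r le_c le_f s As.
rewrite subr0 normrZ.
have le1 : `|f r s| <= C.
  rewrite -[f r s](subrK (g s)) addrC; apply: (le_trans (ler_normD _ _)).
  by rewrite lerD ?le_f // (le_trans (gK s As)) // ler_norm.
apply: (@le_trans _ _ (e / C * C)); last by rewrite divfK // gt_eqF.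
exact: ler_pM.
Qed.

Lemma uniformly_mulmxl m n p A (C : 'M[R]_(m, n)) (f : T -> R -> 'M[R]_(n, p)) g :
  uniformly A f g -> uniformly A (fun r s => C *m f r s) (fun s => C *m g s).
Proof.
move=> fg; apply: (uniformly_le (K := n%:R * `|C|) fg); apply: filterE => r s _.
by rewrite -mulmxBr mulmx_norm.
Qed.

Lemma uniformly_mulmx m n p A (f : T -> R -> 'M[R]_(m, n)) g
    (f' : T -> R -> 'M[R]_(n, p)) g' (K : R) : 0 <= K ->
  (forall s, A s -> `|g s| <= K) -> (forall s, A s -> `|g' s| <= K) ->
  uniformly A f g -> uniformly A f' g' ->
  uniformly A (fun r s => f r s *m f' r s) (fun s => g s *m g' s).
Proof.
move=> K0 gK g'K fg fg' e e0; pose C := n%:R * (2 * K + 1) + 1.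
have n0 : 0 <= n%:R :> R by exact: ler0n.
have C0 : 0 < C by rewrite ltr_wpDl // mulr_ge0 // addr_ge0 // mulr_ge0.
pose d := Num.min 1 (e / C).
have d0 : 0 < d by rewrite lt_min ltr01 divr_gt0.
have d1 : d <= 1 by rewrite ge_min lexx.
have dC : d * C <= e by rewrite -ler_pdivlMr // ge_min lexx orbT.
apply: filterS2 (fg d d0) (fg' d d0) => r le_f le_f' s As.
have {}le_f := le_f s As; have {}le_f' := le_f' s As.
have -> : f r s *m f' r s - g s *m g' s =
    (f r s - g s) *m f' r s + g s *m (f' r s - g' s).
  by rewrite mulmxBl mulmxBr subrKA.
apply: (le_trans (ler_normD _ _)).
have le1 : `|f' r s| <= K + 1.
  rewrite -[f' r s](subrK (g' s)) addrC; apply: (le_trans (ler_normD _ _)).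
  by rewrite lerD ?g'K //; apply: le_trans d1.
apply: le_trans dC; apply: (@le_trans _ _ (n%:R * d * (K + 1) + n%:R * K * d)).
  apply: lerD; apply: (le_trans (mulmx_norm _ _)).
    by rewrite ler_pM ?mulr_ge0 // ler_wpM2l.
  by rewrite ler_pM ?mulr_ge0 // ler_wpM2l ?gK.
rewrite /C [leRHS](_ : _ = n%:R * d * (K + 1) + n%:R * K * d + d); last ring.
by rewrite lerDl ltW.
Qed.

(** Gronwall's inequality for the difference, which is driven by the term
    (A - B) Y. *)
Lemma flow_cvg n (T0 : R) (A : T -> R -> 'M[R]_n) (B : R -> 'M[R]_n)
    (X : T -> R -> 'M[R]_n) (Y : R -> 'M[R]_n) : 0 <= T0 ->
  continuous B -> Y 0 = 1%:M -> (forall t : R, is_derive t 1 Y (B t *m Y t)) ->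
  F [set r | X r 0 = 1%:M /\ forall t : R, is_derive t 1 (X r) (A r t *m X r t)] ->
  uniformly `[- T0, T0] A B -> uniformly `[- T0, T0] X Y.
Proof.
move=> T00 cB Y0 dY X_flow AB e e0.
have [K K0 BK] := continuous_bounded T0 cB.
have [M M0 YM] := continuous_bounded T0 (is_derive_continuous dY).
pose k := n%:R * (K + 1) + 1.
have k0 : 0 < k by rewrite ltr_wpDl // mulr_ge0 // addr_ge0.
pose E := expR (2 * k * T0); have E0 : 0 < E := expR_gt0 _.
pose d := Num.min 1 (e * k / ((n%:R * M + 1) * E)).
have C0 : 0 < n%:R * M + 1 by rewrite ltr_wpDl // mulr_ge0.
have d0 : 0 < d by rewrite lt_min ltr01 divr_gt0 ?mulr_gt0.
have d1 : d <= 1 by rewrite ge_min lexx.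
have dC : n%:R * d * M / k * E <= e.
  have : d <= e * k / ((n%:R * M + 1) * E) by rewrite ge_min lexx orbT.
  rewrite ler_pdivlMr ?mulr_gt0 // => le; rewrite mulrAC ler_pdivrMr //.
  apply: le_trans le; rewrite mulrAC [n%:R * d]mulrC -2!mulrA ler_pM2l //.
  by rewrite [E * M]mulrC mulrA ler_pM2r // lerDl.
apply: filterS2 (AB d d0) X_flow => r Ad [X0 dX] t; rewrite /= in_itv /= -ler_norml => tT.
have dE (u : R) : is_derive u 1 (fun t => X r t - Y t)
    (A r u *m X r u - B u *m Y u).
  by apply: is_deriveB.
have := @gronwall _ _ _ (fun t => X r t - Y t) _ k (n%:R * d * M) T0 t k0 _ dE _ _ tT.
move=> le; apply: (le_trans (le _ _ _)).
- by rewrite !mulr_ge0 // ltW.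
- by rewrite X0 Y0 subrr.
- move=> u uT; have -> : A r u *m X r u - B u *m Y u =
      A r u *m (X r u - Y u) + (A r u - B u) *m Y u.
    by rewrite mulmxBr mulmxBl subrKA.
  have leA : `|A r u - B u| <= d by apply: Ad; rewrite /= in_itv /= -ler_norml.
  apply: (le_trans (ler_normD _ _)); apply: lerD; apply: (le_trans (mulmx_norm _ _)).
    rewrite ler_wpM2r // /k; apply: (@le_trans _ _ (n%:R * (K + 1))); last by rewrite lerDl.
    rewrite ler_wpM2l // -[A r u](subrK (B u)) addrC; apply: (le_trans (ler_normD _ _)).
    by rewrite lerD ?BK //; apply: le_trans d1.
  by rewrite ler_pM ?mulr_ge0 // ?ler_wpM2l ?YM.
- apply: le_trans dC; rewrite ler_wpM2l ?divr_ge0 ?mulr_ge0 ?(ltW d0) ?(ltW k0) //.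
  by rewrite ler_expR ler_wpM2l // mulr_ge0 // ltW.
Qed.

(** The mean value inequality for X r s - s C. *)
Lemma cvg_of_derivative m n (T0 : R) (X dX : T -> R -> 'M[R]_(m, n)) (C : 'M[R]_(m, n)) :
  0 < T0 ->
  F [set r | X r 0 = 0 /\ forall t : R, is_derive t 1 (X r) (dX r t)] ->
  uniformly `[- T0, T0] dX (fun=> C) -> X r T0 @[r --> F] --> T0 *: C.
Proof.
move=> T00 X_flow dXC; apply/cvgrPdist_le => e e0.
apply: filterS2 X_flow (dXC (e / T0) (divr_gt0 e0 T00)) => r [X0 dX0] le_dX.
have dD (u : R) : is_derive u 1 (fun s => X r s - s *: C) (dX r u - C).
  apply: is_deriveB; apply/mx_is_deriveP => i j.
  have := is_derive_linear (C i j) u; congr is_derive.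
  by apply/funext => s; rewrite !mxE mulrC.
have := @growth_le _ _ _ (fun s => X r s - s *: C) _ (fun s => e / T0 * s) (fun=> e / T0)
  0 T0 (ltW T00) dD (is_derive_linear _).
rewrite X0 scale0r !subr0 mulr0 subr0 divfK ?gt_eqF // distrC; apply=> u /andP[u0 uT].
by apply: le_dX; rewrite /= in_itv /= uT andbT (le_trans _ u0) // oppr_le0 ltW.
Qed.

End UniformLimits.

(** * Rotations and the symplectic form of the vortex system *)

Lemma mulmx_cV_inj (F : comNzRingType) m n (A B : 'M[F]_(m, n)) :
  (forall z : 'cV[F]_n, A *m z = B *m z) -> A = B.
Proof.
move=> AB; apply/matrixP => i j.
by have /colP/(_ i) := AB (delta_mx j 0); rewrite -!colE !mxE.
Qed.

Section Rotation.
Variables (R : realType) (N : nat).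
Notation J := (JN R N).
Notation J2 := (J2 R).

Lemma J2_sq : J2 *m J2 = - 1%:M.
Proof.
rewrite mulmxBl !mulmxBr !mul_delta_mx_cond /= !mulr0n !mulr1n subr0 sub0r -opprD.
congr (- _); apply/matrixP => i j; rewrite !mxE.
by case: (ord2_cases i) => ->; case: (ord2_cases j) => ->; rewrite /= ?addr0 ?add0r.
Qed.

Lemma J2_tr : J2^T = - J2.
Proof. by rewrite linearB /= !trmx_delta opprB. Qed.

Lemma det_J2 : \det J2 = 1.
Proof.
rewrite (expand_det_row _ 0) sum_ord2 /cofactor !det_mx11 !mxE /=.
by rewrite !(mulr0, mul0r, mulr1, mul1r, subr0, sub0r, addr0, add0r) expr1 mulrNN mulr1.
Qed.

Lemma vortex_JN z (j : 'I_N) : vortex (J *m z) j = J2 *m vortex z j.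
Proof.
have idx (j1 j2 : 'I_N) (k1 k2 : 'I_2) :
    (mxvec_index j1 k1 == mxvec_index j2 k2) = (j1 == j2) && (k1 == k2).
  apply/eqP/andP => [|[/eqP -> /eqP ->] //].
  by rewrite /mxvec_index => /cast_ord_inj/enum_rank_inj[-> ->].
have deltaE (a b i : 'I_(N * 2)) : (delta_mx a b *m z) i 0 = (i == a)%:R * z b 0.
  rewrite mxE (bigD1 b) //= big1 ?addr0 => [|c cb]; first by rewrite mxE eqxx andbT.
  by rewrite mxE (negPf cb) andbF mul0r.
apply/colP => k; rewrite [LHS]mxE [RHS]mxE /JN mulmx_suml summxE (bigD1 j) //=.
rewrite [X in _ + X]big1 ?addr0 => [|i ij]; last first.
  rewrite mulmx_suml summxE big1 // => p _; rewrite mulmx_suml summxE big1 // => q _.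
  by rewrite -scalemxAl scalemx_entry deltaE idx eq_sym (negPf ij) mul0r mulr0.
rewrite mulmx_suml summxE (bigD1 k) //= [X in _ + X]big1 ?addr0 => [|p pk]; last first.
  rewrite mulmx_suml summxE big1 // => q _.
  by rewrite -scalemxAl scalemx_entry deltaE idx eqxx [k == p]eq_sym (negPf pk) mul0r mulr0.
rewrite mulmx_suml summxE; apply: eq_bigr => l _.
by rewrite -scalemxAl scalemx_entry deltaE eqxx mul1r [vortex z j l 0]mxE.
Qed.

Lemma JN_sq : J *m J = - 1%:M.
Proof.
apply: mulmx_cV_inj => z; apply: vortex_inj => j; rewrite -mulmxA !vortex_JN mulmxA J2_sq.
by rewrite !mulNmx !mul1mx; apply/colP => k; rewrite !mxE.
Qed.

Lemma JN_tr : J^T = - J.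
Proof.
rewrite /JN linear_sum -sumrN; apply: eq_bigr => j _ /=.
transitivity (\sum_(k < 2) \sum_(l < 2)
    J2 k l *: delta_mx (mxvec_index j l) (mxvec_index j k) : 'M[R]_(N * 2)).
  rewrite linear_sum; apply: eq_bigr => k _ /=; rewrite linear_sum; apply: eq_bigr => l _ /=.
  by rewrite linearZ /= trmx_delta.
rewrite exchange_big -sumrN; apply: eq_bigr => k _ /=; rewrite -sumrN; apply: eq_bigr => l _.
rewrite -scaleNr; congr (_ *: _); have /matrixP/(_ k l) := J2_tr.
by rewrite [LHS]mxE [RHS]mxE.
Qed.

Lemma JN_hat : J *m hat_mx R N = hat_mx R N *m J2.
Proof.
apply: mulmx_cV_inj => e; rewrite -!mulmxA !hat_mxE.
by apply: vortex_inj => j; rewrite vortex_JN !vortex_hat.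
Qed.

(** The complex exponential series, with J in place of the imaginary unit. *)
Lemma expmx_rotation (c : R) : expmx (c *: J) = (cos c)%:M + sin c *: J.
Proof.
have powJ k : J ^+ k = (-1) ^+ k./2 *: (if odd k then J else 1%:M).
  have even m : J ^+ m.*2 = ((-1) ^+ m)%:M.
    elim: m => [|m IH]; first by rewrite !expr0.
    rewrite doubleS !exprS IH mulrA -[J * J]/(J *m J) JN_sq mulNr mul1r.
    by rewrite mulN1r raddfN.
  rewrite -[in LHS](odd_double_half k) exprD even.
  by case: odd; rewrite ?expr1 ?expr0 -mulmxE ?mul1mx ?mul_mx_scalar ?scalemx1.
have powZ k : (c *: J) ^+ k = c ^+ k *: J ^+ k.
  elim: k => [|k IH]; first by rewrite !expr0 scale1r.
  by rewrite !exprS IH -!mulmxE -scalemxAl -scalemxAr scalerA.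
apply/matrixP => i j; rewrite !mxE.
have cS : series (cos_coeff c) @ \oo --> cos c.
  by rewrite unlock; exact: is_cvg_series_cos_coeff.
have sS : series (sin_coeff c) @ \oo --> sin c.
  by rewrite unlock; exact: is_cvg_series_sin_coeff.
apply: cvg_lim => //.
have -> : series (fun k => (k`!%:R)^-1 * ((c *: J) ^+ k) i j) =
    (fun n => series (cos_coeff c) n * (1%:M : 'M[R]_(N * 2)) i j + series (sin_coeff c) n * J i j).
  apply/funext => n; rewrite /series /= !mulr_suml -big_split; apply: eq_bigr => k _ /=.
  rewrite powZ powJ scalerA scalemx_entry /cos_coeff /sin_coeff /= -!exprnP.
  have [ok|ek] := boolP (odd k).
    have -> : k.-1./2 = k./2.
      by case: k ok => //= k ok; rewrite uphalf_half (negPf ok).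
    rewrite /= !mul0r add0r mul1r; ring.
  rewrite /= !mul0r addr0 mul1r; ring.
rewrite -[cos c *+ _]mulr_natr; apply: cvgD; last by apply: cvgM => //; exact: cvg_cst.
by rewrite mxE; apply: cvgM => //; exact: cvg_cst.
Qed.

Section Vorticity.
Variable Gamma : 'I_N -> R.
Notation M := (vorticity_mx Gamma).

Lemma vorticity_tr : M^T = M. Proof. exact: tr_diag_mx. Qed.

Lemma vortex_vorticity z (j : 'I_N) : vortex (M *m z) j = Gamma j *: vortex z j.
Proof.
by apply/colP => k; rewrite [LHS]mxE mul_diag_mx mxE mxvecE mxE [RHS]mxE [vortex z j k 0]mxE.
Qed.

Lemma JN_vorticity : J *m M = M *m J.
Proof.
apply: mulmx_cV_inj => z; apply: vortex_inj => j; rewrite -!mulmxA.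
by rewrite vortex_JN !vortex_vorticity vortex_JN scalemxAr.
Qed.

Lemma vorticity_unit : (forall j, Gamma j != 0) -> M \in unitmx.
Proof.
move=> G0; rewrite unitmxE det_diag unitfE; apply/prodf_neq0 => i _.
by case/mxvec_indexP: i => j k; rewrite mxvecE mxE.
Qed.

Lemma hat_vorticity_hat :
  (hat_mx R N)^T *m M *m hat_mx R N = (\sum_j Gamma j)%:M.
Proof.
apply/matrixP => k l.
rewrite -mulmxA mxE (reindex _ (curry_mxvec_bij _ _)) /=.
pose F j m := (hat_mx R N)^T k (mxvec_index j m) * (M *m hat_mx R N) (mxvec_index j m) l.
rewrite (eq_bigr (fun p => F p.1 p.2)); last by case.
rewrite -(pair_bigA _ F) /= mxE -sumrMnl; rewrite {}/F.
apply: eq_bigr => j _; rewrite (bigD1 k) //= big1 ?addr0 => [|m mk].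
  by rewrite mul_diag_mx !mxE !mxvecE !mxE !eqxx !andbT mul1r mulr_natr.
by rewrite !mxE !mxvecE !mxE (negPf mk) /= mul0r.
Qed.

(** The symplectic form of the vortex system. *)
Definition vortex_form : 'M[R]_(N * 2) := J *m M.
Notation W := vortex_form.

Lemma vortex_form_skew : W^T = - W.
Proof. by rewrite trmx_mul JN_tr vorticity_tr mulmxN -JN_vorticity. Qed.

Lemma vortex_form_unit : (forall j, Gamma j != 0) -> W \in unitmx.
Proof.
move=> G0; rewrite unitmx_mul vorticity_unit // andbT.
by have /mulmx1_unit[] : J *m (- J) = 1%:M by rewrite mulmxN JN_sq opprK.
Qed.

Lemma vortex_form_hat : W *m hat_mx R N = M *m hat_mx R N *m J2.
Proof. by rewrite /W JN_vorticity -!mulmxA JN_hat. Qed.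

Lemma hamiltonian_equation p (X Y : 'M[R]_(N * 2, p)) :
  M *m X = J *m Y <-> W *m X = - Y.
Proof.
split=> [E|E]; first by rewrite -mulmxA E mulmxA JN_sq mulNmx mul1mx.
rewrite -[Y]opprK -E mulmxN /W !mulmxA -[J *m J *m M]mulmxA.
by rewrite mulmxA JN_sq mulNmx mul1mx mulNmx opprK.
Qed.

End Vorticity.

(** The velocity at time 0 is - nu J z0. If it were a translation, so would be
    z0, and all vortices would coincide. *)
Lemma relative_equilibrium_velocity (Gamma : 'I_N -> R) Z : (1 < N)%N ->
  relative_equilibrium Gamma Z ->
  [/\ (forall t, Z (t + 2 * pi) = Z t), continuous Z &
      forall e, derive1 Z 0 <> hat N e].
Proof.
move=> N2 [_ [nu [z0 [nuE z0_config ZE]]]].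
have {}ZE t : Z t = cos (nu * t) *: z0 - sin (nu * t) *: (J *m z0).
  by rewrite ZE expmx_rotation cosN sinN scaleNr mulmxBl mul_scalar_mx scalemxAl.
have dZ (t : R) : is_derive t 1 Z
    (- (nu * sin (nu * t)) *: z0 - (nu * cos (nu * t)) *: (J *m z0)).
  apply/mx_is_deriveP => i j; rewrite [j]ord1 {j}.
  have -> : (fun s => Z s i 0) = (fun s => z0 i 0 * cos (nu * s) - (J *m z0) i 0 * sin (nu * s)).
    by apply/funext => s; rewrite ZE mxE scalemx_entry mxE scalemx_entry mulrC [sin _ * _]mulrC.
  have d1 := is_derive1_comp (is_derive_cos (nu * t)) (is_derive_linear nu t).
  have d2 := is_derive1_comp (is_derive_sin (nu * t)) (is_derive_linear nu t).
  have := is_deriveB (is_deriveZ (z0 i 0) d1) (is_deriveZ ((J *m z0) i 0) d2).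
  congr is_derive; move: (J *m z0) => w; rewrite !mxE /GRing.scale /=; ring.
split.
- move=> t; rewrite !ZE mulrDr; case: nuE => ->; rewrite ?mul1r ?mulN1r.
    by rewrite mulr_natl cosD2pi sinD2pi.
  by rewrite -opprD !cosN !sinN mulr_natl cosD2pi sinD2pi.
- exact: is_derive_continuous dZ.
- move=> e; have [dZ0 dZ0E] := dZ 0; rewrite derive1E dZ0E mulr0 sin0 cos0.
  rewrite mulr0 oppr0 scale0r sub0r mulr1 => E.
  have nu2 : nu * nu = 1 by case: nuE => ->; ring.
  have z0E : z0 = hat N (nu *: (J2 *m e)).
    have : J *m (nu *: (nu *: (J *m z0))) = - z0.
      by rewrite scalerA nu2 scale1r mulmxA JN_sq mulNmx mul1mx.
    rewrite -[nu *: (J *m z0)]opprK E => E2; rewrite -[LHS]opprK -E2.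
    rewrite scalerN -hatZ mulmxN opprK; apply: vortex_inj => j.
    by rewrite vortex_JN !vortex_hat scalemxAr.
  have [_ /(_ (Ordinal (ltnW N2)) (Ordinal N2))] := z0_config.
  by rewrite z0E !vortex_hat; apply.
Qed.

End Rotation.

(** * Linearization along solutions *)

(** E and its dual (W E)^T pair to zero, as E is isotropic. So both can be
    deflated from X - 1, and each of them accounts for k multipliers 1. *)
Lemma isotropic_fixed_multiplicity (R : realType) n k (W X : 'M[R]_n) (E : 'M[R]_(n, k)) :
  W \in unitmx -> X *m E = E -> (W *m E)^T *m X = (W *m E)^T ->
  (W *m E)^T *m E = 0 -> row_free E^T ->
  (k + k <= algebraic_multiplicity (map_mx (real_complex R) X) 1%R)%N.
Proof.
move=> W_unit XE EX EE E_free.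
pose K := X - 1%:M; pose A := (pinvmx E^T)^T; pose B := invmx W^T *m A^T.
have AE : A *m E = 1%:M by apply: trmx_inj; rewrite trmx_mul trmxK mulmxVp ?trmx1.
have LB : (W *m E)^T *m B = 1%:M.
  rewrite trmx_mul /B mulmxA -[_ *m W^T *m _]mulmxA mulmxV ?unitmx_tr // mulmx1.
  by rewrite -trmx_mul AE trmx1.
have KE : K *m E = 0 by rewrite mulmxBl XE mul1mx subrr.
have LK : (W *m E)^T *m K = 0 by rewrite mulmxBr EX mulmx1 subrr.
have := deflation A B KE LK EE; rewrite AE LB.
have char1 : char_poly (1%:M : 'M[R]_k) = ('X - 1%:P) ^+ k.
  rewrite /char_poly /char_poly_mx map_scalar_mx -[RHS](det_scalar k); congr (\det _).
  by rewrite raddfB.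
have charX : char_poly X = char_poly K \Po ('X - 1%:P).
  rewrite /char_poly -[RHS](det_map_mx (comp_poly ('X - 1%:P))); congr (\det _).
  apply/matrixP => i j; rewrite !mxE rmorphB /= rmorphMn /= comp_polyX comp_polyC.
  by rewrite polyCB mulrnBl polyCMn opprB addrA subrK.
rewrite char1 => E1.
have dvdK : 'X^(k + k) %| char_poly K.
  have cop : coprimep 'X^(k + k) (('X - 1%:P) ^+ k * ('X - 1%:P) ^+ k : {poly R}).
    rewrite -exprD coprimep_expl // coprimep_expr // -[X in coprimep X]subr0 -polyC0.
    by rewrite coprimep_XsubC root_XsubC oner_eq0.
  by rewrite -(Gauss_dvdpl _ cop) mulrA -E1 dvdp_mulr.
have dvdX : ('X - 1%:P) ^+ (k + k) %| char_poly X.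
  rewrite charX; have := dvdp_comp_poly ('X - 1%:P) dvdK.
  by rewrite comp_Xn_poly.
rewrite /algebraic_multiplicity mup_geq ?monic_neq0 ?char_poly_monic //.
rewrite -map_char_poly; have := dvdX; rewrite -(dvdp_map (real_complex R)).
by rewrite rmorphXn /= map_polyXsubC.
Qed.

Section Flows.
Variables (R : realType) (N : nat) (Gamma : 'I_N -> R) (H : 'cV[R]_(N * 2) -> R).
Variables (Omega : set 'cV[R]_2).
Hypothesis Gamma_neq0 : forall j, Gamma j != 0.
Hypotheses (Omega_open : open Omega) (H_C2 : Ck_on 2 (config Omega) H).
Notation M := (vorticity_mx Gamma).
Notation J := (JN R N).
Notation W := (vortex_form Gamma).

Let M_unit : M \in unitmx. Proof. exact: vorticity_unit. Qed.

Lemma fundamental_flow z X : fundamental_solution Gamma H z X ->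
  hamiltonian_flow W (fun t => hessian H (z t)) X.
Proof.
move=> [_ dX]; exists (derive1 X) => t; have [d E] := dX t.
  exact: derivable_is_derive.
by apply/hamiltonian_equation; rewrite E mulmxA.
Qed.

Lemma hamiltonian_generator p (X Y : 'M[R]_(N * 2, p)) :
  M *m X = J *m Y -> X = invmx M *m (J *m Y).
Proof. by move=> <-; rewrite mulKmx. Qed.

Section Solution.
Variable z : R -> 'cV[R]_(N * 2).
Hypothesis z_sol : solution Gamma Omega H z.

Let open_c : open (@config R N Omega). Proof. exact: open_config. Qed.
Let zc t : config Omega (z t). Proof. by have [] := z_sol t. Qed.

Lemma solution_is_derive (t : R) : is_derive t 1 z (derive1 z t).
Proof. by have [_ d _] := z_sol t; exact: derivable_is_derive. Qed.

Lemma solution_continuous : continuous z.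
Proof. exact: is_derive_continuous solution_is_derive. Qed.

Lemma hessian_along_sym t : (hessian H (z t))^T = hessian H (z t).
Proof. exact: (hessian_sym open_c H_C2 (zc t)). Qed.

Lemma hessian_along_continuous : continuous (fun t => hessian H (z t)).
Proof.
move=> t; apply: (@continuous_comp _ _ _ z (hessian H)).
  exact: solution_continuous.
exact: (hessian_continuous H_C2 (zc t)).
Qed.

Lemma solution_velocity t : derive1 z t = invmx M *m (J *m gradient H (z t)).
Proof. by apply: hamiltonian_generator; have [] := z_sol t. Qed.

(** Differentiate the equation of motion in time. *)
Lemma velocity_flow : hamiltonian_flow W (fun t => hessian H (z t)) (derive1 z).
Proof.
exists (fun t => invmx M *m (J *m (hessian H (z t) *m derive1 z t))) => t.
  have [_ d _] := z_sol t.
  have [dg gE] := is_derive_gradient open_c H_C2 (zc t) d.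
  have dgt : is_derive t 1 (gradient H \o z) (hessian H (z t) *m derive1 z t).
    exact: (DeriveDef dg (etrans (esym (derive1E _ _)) gE)).
  have := is_derive_mulmxl (invmx M) (is_derive_mulmxl J dgt).
  by congr is_derive; apply/funext => s; rewrite solution_velocity.
by apply/hamiltonian_equation; rewrite mulKVmx.
Qed.

Lemma periodic_velocity T : z T = z 0 -> derive1 z T = derive1 z 0.
Proof. by move=> zT; rewrite !solution_velocity zT. Qed.

Lemma fundamental_solution_exists : exists X, fundamental_solution Gamma H z X.
Proof.
have cA : continuous (fun t => invmx M *m (J *m hessian H (z t))).
  move=> t; apply: cvg_mulmx; first exact: cvg_cst.
  by apply: cvg_mulmx; [exact: cvg_cst|exact: hessian_along_continuous].
have [X X0 dX] := linear_ode_exists cA; exists X; split=> // t.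
have [d E] := dX t; split=> //; rewrite derive1E E -!mulmxA.
by rewrite mulKVmx.
Qed.

End Solution.
End Flows.

(** * The monodromy of a relative equilibrium *)

Section PlaneMonodromy.
Variables (R : realType) (N : nat) (Gamma : 'I_N -> R).
Hypotheses (N2 : (1 < N)%N) (Gamma_neq0 : forall j, Gamma j != 0).
Notation M := (vorticity_mx Gamma).
Notation J := (JN R N).
Notation W := (vortex_form Gamma).
Notation H0 := (hamiltonian_plane Gamma).
Notation hatm := (hat_mx R N).
Variables (Z : R -> 'cV[R]_(N * 2)) (X : R -> 'M[R]_(N * 2)).
Hypotheses (Z_releq : relative_equilibrium Gamma Z).
Hypothesis X_fund : fundamental_solution Gamma H0 Z X.

Let Z_sol : solution Gamma setT H0 Z. Proof. by case: Z_releq. Qed.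
Let S t := hessian H0 (Z t).
Let X_flow : hamiltonian_flow W S X. Proof. exact: fundamental_flow X_fund. Qed.
Let X0 : X 0 = 1%:M. Proof. by case: X_fund. Qed.
Let H0_C2 : Ck_on 2 (config setT) H0. Proof. exact: hamiltonian_plane_smooth. Qed.
Let Zc t : config setT (Z t). Proof. by have [] := Z_sol t. Qed.
Let S_sym t : (S t)^T = S t.
Proof. exact: (hessian_along_sym openT H0_C2 Z_sol). Qed.
Let W_skew := vortex_form_skew Gamma.
Let W_unit := vortex_form_unit Gamma_neq0.

Lemma plane_symplectic t : (X t)^T *m W *m X t = W /\ \det (X t) = 1.
Proof.
split; first exact: (flow_symplectic W_skew S_sym X_flow X0).
exact: (flow_det W_skew S_sym W_unit X_flow X0).
Qed.

(** Translations are symmetries of the plane flow, and dually the center of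
    vorticity is conserved. *)
Lemma plane_fixed_hat t : X t *m hatm = hatm /\ hatm^T *m M *m X t = hatm^T *m M.
Proof.
have hat_flow : hamiltonian_flow W S (fun=> hatm).
  exists (fun=> 0) => s; first exact: is_derive_cst.
  rewrite mulmx0 (plane_hessian_hat (hamiltonian_plane_smooth Gamma)) ?oppr0 //.
  exact: hamiltonian_plane_translation.
have [E1 E2] := flow_fixed (T := t) W_skew S_sym W_unit X_flow X0 hat_flow erefl.
split=> //; move: E2; rewrite (vortex_form_hat Gamma) trmx_mul trmx_mul vorticity_tr.
rewrite J2_tr !mulNmx -mulmxA => /oppr_inj /(congr1 (mulmx (J2 R))).
by rewrite !mulmxA J2_sq !mulNmx !mul1mx => /oppr_inj; rewrite -!mulmxA.
Qed.

Notation e0 := (derive1 Z 0).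

Lemma plane_fixed_velocity : X (2 * pi) *m e0 = e0 /\ (W *m e0)^T *m X (2 * pi) = (W *m e0)^T.
Proof.
apply: (flow_fixed W_skew S_sym W_unit X_flow X0).
  exact: (velocity_flow Gamma_neq0 openT H0_C2 Z_sol).
apply: (periodic_velocity Gamma_neq0 Z_sol).
by have [per _ _] := relative_equilibrium_velocity N2 Z_releq; rewrite -[2 * pi]add0r per.
Qed.

Lemma plane_momentum_velocity : hatm^T *m M *m e0 = 0.
Proof.
have [_ _ E] := Z_sol 0; rewrite -mulmxA E mulmxA -[hatm^T *m J]opprK -mulmxN -JN_tr.
rewrite -trmx_mul JN_hat trmx_mul J2_tr !mulNmx opprK -mulmxA.
have -> : hatm^T *m gradient H0 (Z 0) = 0.
  apply: trmx_inj; rewrite trmx_mul trmxK trmx0.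
  exact: (plane_gradient_hat (hamiltonian_plane_smooth Gamma) (hamiltonian_plane_translation Gamma)).
by rewrite mulmx0.
Qed.

Lemma plane_velocity_hat : (W *m e0)^T *m hatm = 0.
Proof.
rewrite trmx_mul W_skew mulmxN mulNmx -mulmxA vortex_form_hat mulmxA.
have -> : e0^T *m (M *m hatm) = 0.
  by apply: trmx_inj; rewrite trmx_mul trmxK trmx_mul vorticity_tr trmx0 plane_momentum_velocity.
by rewrite mul0mx oppr0.
Qed.

(** Otherwise translations and velocity span a 3-dimensional isotropic space of
    fixed vectors, and the multiplicity of 1 would be at least 6. *)
Lemma total_vorticity_neq0 :
  algebraic_multiplicity (map_mx (real_complex R) (X (2 * pi))) 1 = 4%N ->
  \sum_j Gamma j != 0.
Proof.
move=> mult4; apply/negP => /eqP Gtot.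
pose E := row_mx hatm e0.
have [Xe eX] := plane_fixed_velocity; have [Xh _] := plane_fixed_hat (2 * pi).
have hat_flow_dual : (W *m hatm)^T *m X (2 * pi) = (W *m hatm)^T.
  have [_ hX] := plane_fixed_hat (2 * pi).
  by rewrite vortex_form_hat trmx_mul trmx_mul vorticity_tr -mulmxA hX.
suff : (3 + 3 <= algebraic_multiplicity (map_mx (real_complex R) (X (2 * pi))) 1%R)%N.
  by rewrite mult4.
apply: (@isotropic_fixed_multiplicity _ _ _ W _ E) => //.
- by rewrite mul_mx_row Xh Xe.
- by rewrite mul_mx_row tr_row_mx mul_col_mx hat_flow_dual eX.
- rewrite [W *m E]mul_mx_row tr_row_mx mul_col_mx !mul_mx_row plane_velocity_hat.
  rewrite (skew_isotropic W_skew) vortex_form_hat trmx_mul trmx_mul vorticity_tr -!mulmxA.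
  rewrite (mulmxA hatm^T) hat_vorticity_hat Gtot.
  rewrite (mulmxA hatm^T) plane_momentum_velocity !(mulmx0, mul0mx) raddf0 mulmx0.
  by rewrite -[RHS]col_mx0 !row_mx0.
- apply: inj_row_free => v; rewrite -[v]trmxK -trmx_mul -[v^T]vsubmxK mul_row_col.
  move=> /(congr1 trmx); rewrite trmxK trmx0.
  set a := usubmx v^T; set c := dsubmx v^T; rewrite hat_mxE [c]mx11_scalar mul_mx_scalar.
  have [_ _ no] := relative_equilibrium_velocity N2 Z_releq.
  have [->|c0] := eqVneq (c 0 0) 0.
    rewrite scale0r addr0 => a0; rewrite -[RHS]trmx0; congr trmx.
    rewrite -[a](vortex_hat (N := N) _ (Ordinal N2)) a0 raddf0.
    have -> : vortex (0 : 'cV[R]_(N * 2)) (Ordinal N2) = 0 by apply/colP => k; rewrite !mxE.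
    by rewrite col_mx0.
  move=> E0; exfalso; apply: (no (- (c 0 0)^-1 *: a)).
  rewrite hatZ; have -> : hat N a = - (c 0 0 *: e0) by apply/eqP; rewrite -addr_eq0 E0.
  by rewrite scalerN scaleNr opprK scalerA mulVf // scale1r.
Qed.

End PlaneMonodromy.

(** * The induced family *)

Section HamiltonianSplitting.
Variables (R : realType) (N : nat) (Gamma : 'I_N -> R) (Omega : set 'cV[R]_2).
Variable (g : 'cV[R]_2 -> 'cV[R]_2 -> R).
Hypothesis Omega_open : open Omega.
Hypothesis g_C2 : Ck_on 2 (Omega `*` Omega) (fun p => g p.1 p.2).
Notation H := (hamiltonian Gamma g).
Notation H0 := (hamiltonian_plane Gamma).
Notation Phi := (regular_part Gamma g).
Notation C := (@config R N Omega).

Let open_C : open C. Proof. exact: open_config. Qed.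

Let H0_C2 : Ck_on 2 C H0.
Proof. exact: Ck_on_sub (@sub_config R N Omega) (hamiltonian_plane_smooth Gamma 2). Qed.

Let Phi_C2 : Ck_on 2 C Phi.
Proof.
have sub : C `<=` box Omega (N := N) by move=> w [].
exact: Ck_on_sub sub (regular_smooth Omega_open g_C2 Gamma).
Qed.

Lemma hamiltonian_smooth : Ck_on 2 C H.
Proof.
apply: (Ck_on_eq open_C _ (Ck_onD open_C H0_C2 (Ck_onZ (-1) open_C Phi_C2))).
by move=> w _; rewrite /= hamiltonianE mulN1r.
Qed.

Lemma derive_hamiltonian v w : C w -> 'D_v H w = 'D_v H0 w - 'D_v Phi w.
Proof.
move=> Cw; have -> : H = H0 - Phi by apply/funext => y; exact: hamiltonianE.
have d0 : derivable H0 w v by exact: (@Ck1_derivable _ _ C H0 w v (Ck_onS H0_C2) Cw).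
have d1 : derivable Phi w v by exact: (@Ck1_derivable _ _ C Phi w v (Ck_onS Phi_C2) Cw).
exact: (deriveB d0 d1).
Qed.

Lemma gradient_hamiltonian w : C w -> gradient H w = gradient H0 w - gradient Phi w.
Proof.
move=> Cw; apply/colP => i; rewrite gradientE (derive_hamiltonian _ Cw).
by rewrite [RHS]mxE [(- gradient Phi w) i 0]mxE !gradientE.
Qed.

Lemma hessian_hamiltonian w : C w -> hessian H w = hessian H0 w - hessian Phi w.
Proof.
move=> Cw; apply/matrixP => i j.
have subE (A B : 'M[R]_(N * 2)) : (A - B) i j = A i j - B i j by rewrite !mxE.
apply: etrans (esym (subE _ _)).
apply: etrans (hessianE H w i j) _.
apply: etrans _ (congr2 (fun x y => x - y) (esym (hessianE H0 w i j)) (esym (hessianE Phi w i j))).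
have near_D : \near w, 'D_(delta_mx j 0) H w =
    ('D_(delta_mx j 0) H0 - 'D_(delta_mx j 0) Phi) w.
  by apply: open_near_eq open_C Cw _ => y Cy; exact: derive_hamiltonian.
rewrite (near_eq_derive _ near_D); apply: deriveB.
  exact: (@Ck1_derivable _ _ C _ w _ (Ck_on_derive _ H0_C2) Cw).
exact: (@Ck1_derivable _ _ C _ w _ (Ck_on_derive _ Phi_C2) Cw).
Qed.

End HamiltonianSplitting.

Section InducedFamily.
Variables (R : realType) (N : nat) (hN : (1 < N)%N).
Variables (Omega : set 'cV[R]_2) (Omega_open : open Omega).
Variables (Gamma : 'I_N -> R) (Gamma_neq0 : forall j, Gamma j != 0).
Variables (g : 'cV[R]_2 -> 'cV[R]_2 -> R).
Hypothesis g_C2 : Ck_on 2 (Omega `*` Omega) (fun p => g p.1 p.2).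
Hypothesis g_sym : forall x y, Omega x -> Omega y -> g x y = g y x.
Variables (a0 : 'cV[R]_2) (a0_Omega : Omega a0).
Hypothesis a0_crit : gradient (robin g) a0 = 0.
Variables (Z : R -> 'cV[R]_(N * 2)) (Z_releq : relative_equilibrium Gamma Z).
Variables (r0 : R) (z : R -> R -> 'cV[R]_(N * 2)).
Hypothesis r0_gt0 : 0 < r0.
Notation H := (hamiltonian Gamma g).
Notation H0 := (hamiltonian_plane Gamma).
Notation Phi := (regular_part Gamma g).
Notation M := (vorticity_mx Gamma).
Notation J := (JN R N).
Notation W := (vortex_form Gamma).
Notation hatm := (hat_mx R N).
Notation h'' := (hessian (robin g) a0).
Notation Gtot := (\sum_j Gamma j).
Hypothesis z_sol : forall r, 0 < r < r0 ->
  solution Gamma Omega H (z r) /\ periodic (z r) (2 * pi * r ^+ 2).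
Hypothesis z_asymp : forall e : R, 0 < e -> \forall r \near 0^'+, forall t,
  enorm (z r t - (hat N a0 + r *: Z (t / r ^+ 2))) <= e * r.

Let M_unit : M \in unitmx. Proof. exact: vorticity_unit. Qed.
Let H_C2 : Ck_on 2 (config Omega) H. Proof. exact: hamiltonian_smooth. Qed.
Let W_skew := vortex_form_skew Gamma.
Let W_unit := vortex_form_unit Gamma_neq0.
Let Z_sol : solution Gamma setT H0 Z. Proof. by case: Z_releq. Qed.
Let Z_cont : continuous Z.
Proof. by have [] := relative_equilibrium_velocity hN Z_releq. Qed.
Let Phi_C2 : Ck_on 2 (box Omega (N := N)) Phi. Proof. exact: regular_smooth. Qed.
Let box_a0 : box Omega (hat N a0). Proof. exact: box_hat. Qed.
Let T0 : 0 < 2 * pi :> R. Proof. by rewrite mulr_gt0 ?pi_gt0. Qed.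
Let I : set R := [set` `[- (2 * pi), 2 * pi] ].

Let admissible : \forall r \near 0^'+, 0 < r < r0.
Proof.
near=> r; apply/andP; split; first by near: r; exact: nbhs_right_gt.
by near: r; exact: nbhs_right_lt.
Unshelve. all: by end_near. Qed.
Let r_cvg : (r : R) @[r --> 0^'+] --> (0 : R).
Proof. by apply: cvg_at_right_filter; exact: cvg_id. Qed.
Definition blowup r s : 'cV[R]_(N * 2) := r^-1 *: (z r (r ^+ 2 * s) - hat N a0).
Notation u := blowup.
Lemma blowupK r s : 0 < r -> z r (r ^+ 2 * s) = hat N a0 + r *: u r s.
Proof. by move=> r_gt0; rewrite scalerA mulfV ?gt_eqF // scale1r addrC subrK. Qed.
Lemma blowup_config r s : 0 < r < r0 -> config setT (u r s).
Proof.
move=> r_adm; have [sol _] := z_sol r_adm; have [zc _ _] := sol (r ^+ 2 * s).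
have /andP[r_gt0 _] := r_adm.
have -> : u r s = hat N (- r^-1 *: a0) + r^-1 *: z r (r ^+ 2 * s).
  by rewrite hatZ /u scalerBr scaleNr addrC.
by apply: config_affine; [rewrite invr_neq0 // gt_eqF|exact: sub_config zc].
Qed.

Lemma norm_le_enorm n (v : 'cV[R]_n) : `|v| <= enorm v.
Proof.
apply: mx_norm_le => [|i j]; first exact: sqrtr_ge0.
rewrite [j]ord1 -sqrtr_sqr ler_sqrt ?sumr_ge0 // => [|k _]; last exact: sqr_ge0.
by rewrite (bigD1 i) //= lerDl sumr_ge0 // => k _; exact: sqr_ge0.
Qed.

Lemma blowup_cvg : uniformly 0^'+ I u Z.
Proof.
move=> e e0; apply: filterS2 admissible (z_asymp e0) => r /andP[r_gt0 _] le_e s _.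
have := le_e (r ^+ 2 * s); rewrite [r ^+ 2 * s]mulrC mulfK ?sqrf_eq0 ?gt_eqF //.
rewrite [s * _]mulrC blowupK // opprD addrACA subrr add0r -scalerBr => le1.
have := le_trans (norm_le_enorm _) le1; rewrite normrZ gtr0_norm // mulrC.
by rewrite ler_pM2r.
Qed.

Lemma orbit_cvg : uniformly 0^'+ I (fun r s => z r (r ^+ 2 * s)) (fun=> hat N a0).
Proof.
have [K K0 ZK] := continuous_bounded (2 * pi) Z_cont.
have ZI s : I s -> `|Z s| <= K by rewrite /I /= in_itv /= -ler_norml; exact: ZK.
have ru : uniformly 0^'+ I (fun r s => r *: u r s) (fun=> 0).
  exact: (uniformly_vanishing r_cvg ZI blowup_cvg).
move=> e e0; apply: filterS2 admissible (ru e e0) => r /andP[r_gt0 _] le_e s Is.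
by have := le_e s Is; rewrite subr0 blowupK // addrC addKr.
Qed.

Definition rescaled_hessian r s := r ^+ 2 *: hessian H (z r (r ^+ 2 * s)).
Notation S := rescaled_hessian.

(** The plane Hamiltonian only sees the blown-up configuration; the regular part
    is not rescaled and enters at order r^2. *)
Lemma rescaled_hessianE r s : 0 < r < r0 ->
  S r s = hessian H0 (u r s) - r ^+ 2 *: hessian Phi (z r (r ^+ 2 * s)).
Proof.
move=> r_adm; have [sol _] := z_sol r_adm; have [zc _ _] := sol (r ^+ 2 * s).
have /andP[r_gt0 _] := r_adm.
rewrite /S (hessian_hamiltonian Gamma Omega_open g_C2 zc) scalerBr; congr (_ - _).
rewrite blowupK //.
apply: (plane_hessian_affine (hamiltonian_plane_smooth Gamma)) => //.
- exact: hamiltonian_plane_translation.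
- exact: hamiltonian_plane_scaling.
- exact: blowup_config.
Qed.

Lemma regular_hessian_cvg : uniformly 0^'+ I
  (fun r s => hessian Phi (z r (r ^+ 2 * s))) (fun=> hessian Phi (hat N a0)).
Proof.
apply: (uniformly_comp (Z := fun=> hat N a0) _ _ orbit_cvg).
  by move=> s; exact: cvg_cst.
by move=> s; exact: (hessian_continuous Phi_C2 box_a0).
Qed.

Lemma rescaled_hessian_cvg : uniformly 0^'+ I S (fun s => hessian H0 (Z s)).
Proof.
have c1 : uniformly 0^'+ I (fun r s => hessian H0 (u r s)) (fun s => hessian H0 (Z s)).
  apply: (uniformly_comp Z_cont _ blowup_cvg) => s.
  apply: (hessian_continuous (hamiltonian_plane_smooth Gamma 2)).
  by have [] := Z_sol s.
have r2 : r ^+ 2 @[r --> (0 : R)^'+] --> (0 : R).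
  by rewrite -[X in _ --> X](mulr0 (0 : R)); exact: (cvgM r_cvg r_cvg).
have c2 : uniformly 0^'+ I (fun r s => r ^+ 2 *: hessian Phi (z r (r ^+ 2 * s))) (fun=> 0).
  exact: (uniformly_vanishing (K := `|hessian Phi (hat N a0)|) r2 (fun s _ => lexx _) regular_hessian_cvg).
apply: (uniformly_perturb c1 c2); apply: filterS admissible => r r_adm s _.
exact: rescaled_hessianE.
Qed.

Lemma hat_gradient_regular r s : 0 < r < r0 ->
  hatm^T *m gradient H (z r (r ^+ 2 * s)) = - (hatm^T *m gradient Phi (z r (r ^+ 2 * s))).
Proof.
move=> r_adm; have [sol _] := z_sol r_adm; have [zc _ _] := sol (r ^+ 2 * s).
rewrite (gradient_hamiltonian Gamma Omega_open g_C2 zc) mulmxBr -[RHS]sub0r.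
congr (_ - _); apply: trmx_inj; rewrite trmx_mul trmxK trmx0.
apply: (plane_gradient_hat (hamiltonian_plane_smooth Gamma)).
  exact: hamiltonian_plane_translation.
exact: sub_config zc.
Qed.

Lemma rescaled_hessian_hat r s : 0 < r < r0 ->
  S r s *m hatm = - (r ^+ 2 *: (hessian Phi (z r (r ^+ 2 * s)) *m hatm)).
Proof.
move=> r_adm; rewrite rescaled_hessianE // mulmxBl -scalemxAl -[RHS]sub0r; congr (_ - _).
apply: (plane_hessian_hat (hamiltonian_plane_smooth Gamma)).
  exact: hamiltonian_plane_translation.
exact: blowup_config.
Qed.

Section LinearizedFlow.
Variables (Y : R -> R -> 'M[R]_(N * 2)) (P : R -> 'M[R]_(N * 2)).
Hypothesis Y_fund : forall r, 0 < r < r0 -> fundamental_solution Gamma H (z r) (Y r).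
Hypothesis P_fund : fundamental_solution Gamma H0 Z P.
Let X r s := Y r (r ^+ 2 * s).
Let A r s := invmx M *m (J *m S r s).

Lemma is_derive_rescale m n (f : R -> 'M[R]_(m, n)) df (c s : R) :
  is_derive (c * s) 1 f df -> is_derive s 1 (fun s => f (c * s)) (c *: df).
Proof.
move=> /mx_is_deriveP dfE; apply/mx_is_deriveP => i j; rewrite mxE mulrC.
exact: (is_derive1_comp (dfE i j) (is_derive_linear c s)).
Qed.

Lemma rescaled_flow r : 0 < r < r0 ->
  X r 0 = 1%:M /\ forall s : R, is_derive s 1 (X r) (A r s *m X r s).
Proof.
move=> /Y_fund[Y0 dY]; split=> [|s]; first by rewrite /X mulr0.
have [d E] := dY (r ^+ 2 * s).
have dYs : is_derive (r ^+ 2 * s) 1 (Y r) (derive1 (Y r) (r ^+ 2 * s)).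
  exact: derivable_is_derive.
have := is_derive_rescale dYs; congr is_derive.
rewrite -mulmxA in E; rewrite (hamiltonian_generator Gamma_neq0 E).
by rewrite /A /S -!scalemxAr -!scalemxAl !mulmxA.
Qed.

Lemma rescaled_flow_cvg : uniformly 0^'+ I X P.
Proof.
have cB : continuous (fun s => invmx M *m (J *m hessian H0 (Z s))).
  move=> s; apply: cvg_mulmx; first exact: cvg_cst.
  apply: cvg_mulmx; first exact: cvg_cst.
  exact: (hessian_along_continuous (hamiltonian_plane_smooth Gamma 2) Z_sol).
have [P0 dP] := P_fund.
have dP' (s : R) : is_derive s 1 P (invmx M *m (J *m hessian H0 (Z s)) *m P s).
  have [d E] := dP s; have dPs : is_derive s 1 P (derive1 P s).
    exact: derivable_is_derive.
  move: dPs; congr is_derive; rewrite -mulmxA in E.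
  by rewrite (hamiltonian_generator Gamma_neq0 E) !mulmxA.
apply: (flow_cvg (ltW T0) cB P0 dP'); first exact: filterS rescaled_flow admissible.
apply: uniformly_mulmxl; apply: uniformly_mulmxl; exact: rescaled_hessian_cvg.
Qed.

Let two_pi : I (2 * pi).
Proof. by rewrite /I /= in_itv /= lexx andbT; have := T0; lra. Qed.

Definition scaled_velocity r := r *: derive1 (z r) 0.
Notation e := scaled_velocity.

Lemma rescaled_flow_fixed r : 0 < r < r0 ->
  [/\ r != 0, (X r (2 * pi))^T *m W *m X r (2 * pi) = W /\ \det (X r (2 * pi)) = 1,
    (X r (2 * pi) - 1%:M) *m e r = 0, (W *m e r)^T *m (X r (2 * pi) - 1%:M) = 0 &
    (W *m e r)^T *m e r = 0].
Proof.
move=> r_adm; have [sol per] := z_sol r_adm.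
have Yf := fundamental_flow (Y_fund r_adm); have [Y0 _] := Y_fund r_adm.
have S_sym := hessian_along_sym Omega_open H_C2 sol.
have T_E : r ^+ 2 * (2 * pi) = 2 * pi * r ^+ 2 by rewrite mulrC.
have zT : z r (2 * pi * r ^+ 2) = z r 0 by rewrite -[2 * pi * _]add0r per.
have vT := periodic_velocity Gamma_neq0 sol zT.
have v_flow := velocity_flow Gamma_neq0 Omega_open H_C2 sol.
have [fix1 fix2] := flow_fixed W_skew S_sym W_unit Yf Y0 v_flow vT.
rewrite /X T_E; split.
- by have /andP[r_gt0 _] := r_adm; rewrite gt_eqF.
- split; first exact: (flow_symplectic W_skew S_sym Yf Y0).
  exact: (flow_det W_skew S_sym W_unit Yf Y0).
- by rewrite /e -scalemxAr mulmxBl fix1 mul1mx subrr scaler0.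
- by rewrite /e -scalemxAr linearZ /= -scalemxAl mulmxBr fix2 mulmx1 subrr scaler0.
- exact: skew_isotropic.
Qed.

Let u0_cvg : u r 0 @[r --> 0^'+] --> Z 0.
Proof.
apply: (uniformly_cvg blowup_cvg); rewrite /I /= in_itv /=.
by have := T0; rewrite oppr_le0 => /ltW ->.
Qed.

Lemma scaled_velocity_cvg : e r @[r --> 0^'+] --> derive1 Z 0.
Proof.
have -> : derive1 Z 0 = invmx M *m (J *m (gradient H0 (Z 0) - 0)).
  by rewrite subr0; exact: (solution_velocity Gamma_neq0 Z_sol).
have z0_cvg : z r (r ^+ 2 * 0) @[r --> 0^'+] --> hat N a0.
  apply: (uniformly_cvg orbit_cvg); rewrite /I /= in_itv /=.
  by have := T0; rewrite oppr_le0 => /ltW ->.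
have c1 : gradient H0 (u r 0) @[r --> 0^'+] --> gradient H0 (Z 0).
  apply: cvg_comp u0_cvg _.
  apply: (gradient_continuous (hamiltonian_plane_smooth Gamma 1)).
  by have [] := Z_sol 0.
have c2 : gradient Phi (z r (r ^+ 2 * 0)) @[r --> 0^'+] --> gradient Phi (hat N a0).
  apply: cvg_comp z0_cvg _.
  exact: (gradient_continuous (Ck_onS Phi_C2) box_a0).
have c3 : r *: gradient Phi (z r (r ^+ 2 * 0)) @[r --> 0^'+] --> (0 : 'cV[R]_(N * 2)).
  by rewrite -[X in _ --> X](scale0r (gradient Phi (hat N a0))); exact: (cvgZ r_cvg c2).
apply: (@cvg_trans _ (invmx M *m (J *m (gradient H0 (u r 0) -
    r *: gradient Phi (z r (r ^+ 2 * 0)))) @[r --> 0^'+])).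
  apply: near_eq_cvg; apply: filterS admissible => r r_adm.
  have [sol _] := z_sol r_adm; have [zc _ _] := sol (r ^+ 2 * 0).
  have /andP[r_gt0 _] := r_adm.
  rewrite /e -[X in derive1 _ X](mulr0 (r ^+ 2)) (solution_velocity Gamma_neq0 sol).
  rewrite 2!scalemxAr; congr (_ *m (_ *m _)).
  rewrite (gradient_hamiltonian Gamma Omega_open g_C2 zc) scalerBr; congr (_ - _).
  rewrite blowupK //; apply: esym.
  apply: (plane_gradient_affine (hamiltonian_plane_smooth Gamma)) => //.
  - exact: hamiltonian_plane_translation.
  - exact: hamiltonian_plane_scaling.
  - exact: blowup_config.
apply: cvg_mulmx; first exact: cvg_cst.
apply: cvg_mulmx; first exact: cvg_cst.
exact: cvgB c1 c3.
Qed.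

Hypothesis Gtot_neq0 : Gtot != 0.
Let L := Gtot^-1 *: (hatm^T *m M).
Let B : 'M[R]_2 := 2 * pi *: (- Gtot *: (J2 R *m h'')).

Lemma momentum_generator p (V : 'M[R]_(N * 2, p)) :
  L *m (invmx M *m (J *m V)) = Gtot^-1 *: (J2 R *m (hatm^T *m V)).
Proof.
rewrite /L -scalemxAl; congr (_ *: _).
rewrite -mulmxA mulKVmx // !mulmxA; congr (_ *m _).
apply: trmx_inj; rewrite !trmx_mul !trmxK JN_tr J2_tr mulNmx mulmxN.
by rewrite JN_hat.
Qed.

Lemma regular_dual w : box Omega w ->
  (hessian Phi w *m hatm)^T = hatm^T *m hessian Phi w.
Proof.
by move=> bw; rewrite trmx_mul (hessian_sym (@open_box _ _ Omega_open N) Phi_C2 bw).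
Qed.

(** The plane interaction conserves the center of vorticity, which therefore
    drifts at the rate r^2 under the regular part alone. To leading order this
    part may be evaluated at the collapsed configuration, where it is given by
    the Hessian of the Robin function. *)
Lemma momentum_drift_cvg :
  r ^- 2 *: (L *m (X r (2 * pi) - 1%:M)) @[r --> 0^'+] --> B *m L.
Proof.
have -> : B *m L = 2 * pi *: (- Gtot *: (J2 R *m h'') *m L) by rewrite [RHS]scalemxAl.
pose dX r s := - Gtot^-1 *: J2 R *m ((hessian Phi (z r (r ^+ 2 * s)) *m hatm)^T *m X r s).
apply: (cvg_of_derivative (X := fun r s => r ^- 2 *: (L *m (X r s - 1%:M))) (dX := dX) T0).
  apply: filterS admissible => r r_adm; have [X0 dX0] := rescaled_flow r_adm.
  have /andP[r_gt0 _] := r_adm.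
  split=> [|s]; first by rewrite X0 subrr mulmx0 scaler0.
  have d1 := is_derive_mulmxl L (is_deriveB (dX0 s) (is_derive_cst 1%:M s 1)).
  have := is_deriveZ (r ^- 2) d1; congr is_derive.
  rewrite subr0 /A -mulmxA -[J *m _ *m _]mulmxA momentum_generator /dX.
  have -> : hatm^T *m (S r s *m X r s) =
      - (r ^+ 2 *: ((hessian Phi (z r (r ^+ 2 * s)) *m hatm)^T *m X r s)).
    rewrite mulmxA scalemxAl -mulNmx; congr (_ *m _); apply: trmx_inj.
    have tr_opp m n (c : R) (V : 'M[R]_(m, n)) : (- (c *: V^T))^T = - (c *: V).
      by rewrite linearN linearZ /= trmxK.
    apply: etrans (trmx_mul _ _) _; apply: etrans _ (esym (tr_opp _ _ _ _)).
    apply: etrans _ (rescaled_hessian_hat s r_adm); rewrite trmxK; congr (_ *m _).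
    have [sol _] := z_sol r_adm; rewrite /S linearZ /=; congr (_ *: _).
    exact: (hessian_along_sym Omega_open H_C2 sol).
  rewrite mulmxN scalerN -scalemxAr scalerN !scalerA mulrAC mulrC mulrA.
  rewrite divfK ?expf_neq0 ?gt_eqF //.
  by rewrite -scalemxAl scaleNr.
have [K K0 PK] : exists2 K, 0 <= K & forall s, `|s| <= 2 * pi -> `|P s| <= K.
  apply: continuous_bounded => s.
  have [_ dP] := P_fund; have [d _] := dP s.
  by apply: differentiable_continuous; apply/derivable1_diffP.
have lim : uniformly 0^'+ I
    (fun r s => (hessian Phi (z r (r ^+ 2 * s)) *m hatm)^T *m X r s)
    (fun s => (hessian Phi (hat N a0) *m hatm)^T *m P s).
  pose C := (hessian Phi (hat N a0) *m hatm)^T.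
  apply: (uniformly_mulmx (K := K + `|C|)).
  - by rewrite addr_ge0.
  - by move=> s _; rewrite lerDr.
  - move=> s; rewrite /I /= in_itv /= -ler_norml => /PK le.
    by apply: (le_trans le); rewrite lerDl.
  - have c : uniformly 0^'+ I (fun r s => hatm^T *m hessian Phi (z r (r ^+ 2 * s)))
        (fun=> hatm^T *m hessian Phi (hat N a0)).
      exact: uniformly_mulmxl regular_hessian_cvg.
    move=> eps eps0; apply: filterS2 admissible (c eps eps0) => r r_adm le s Is.
    have [sol _] := z_sol r_adm; have [[zO _] _ _] := sol (r ^+ 2 * s).
    exact: etrans (congr2 (fun V V' : 'M[R]_(2, N * 2) => `|V - V'| <= eps)
      (regular_dual zO) (regular_dual box_a0)) (le s Is).
  - exact: rescaled_flow_cvg.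
have c : uniformly 0^'+ I dX
    (fun s => - Gtot^-1 *: J2 R *m ((hessian Phi (hat N a0) *m hatm)^T *m P s)).
  exact: uniformly_mulmxl lim.
move=> eps eps0; apply: filterS (c eps eps0) => r le s Is.
suff <- : - Gtot^-1 *: J2 R *m ((hessian Phi (hat N a0) *m hatm)^T *m P s) =
    - Gtot *: (J2 R *m h'') *m L by exact: le.
rewrite (regular_hessian_hat Omega_open g_C2 g_sym Gamma a0_Omega).
have [_ LP] := plane_fixed_hat Gamma_neq0 Z_releq P_fund s.
have h_sym := hessian_sym Omega_open (robin_smooth g_C2) a0_Omega.
rewrite linearZ /= trmx_mul h_sym trmx_mul vorticity_tr.
rewrite -[Gtot *: _ *m P s]scalemxAl -[h'' *m _ *m P s]mulmxA LP /L.
rewrite -!scalemxAl -!scalemxAr !scalerA !mulNr mulVf // mulfV //.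
by rewrite -[in RHS]mulmxA.
Qed.

Lemma hat_gradient_entry w k : box Omega w ->
  (hatm^T *m gradient Phi w) k 0 = 'D_(hat N (delta_mx k 0)) Phi w.
Proof.
move=> bw; rewrite (derive_gradient _ (@open_box _ _ Omega_open N) (Ck_onS Phi_C2) bw).
by rewrite -mul_hat_col -[in LHS](trmxK (gradient Phi w)) -trmx_mul [LHS]mxE.
Qed.

(** At the collapsed configuration the regular part is critical along
    translations, since a0 is a critical point of the Robin function. *)
Lemma hat_gradient_cvg :
  r^-1 *: (hatm^T *m gradient Phi (z r (r ^+ 2 * 0))) @[r --> 0^'+] -->
  \col_k 'D_(Z 0) ('D_(hat N (delta_mx k 0)) Phi) (hat N a0).
Proof.
apply/cvg_mxP => k j; rewrite [j]ord1 [X in _ --> X]mxE.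
have Dk_C1 := Ck_on_derive (hat N (delta_mx k 0)) Phi_C2.
have r_neq0 : \forall r \near (0 : R)^'+, r != 0 by exact: nbhs_right_neq.
have lim : r^-1 * ('D_(hat N (delta_mx k 0)) Phi (r *: u r 0 + hat N a0) -
    'D_(hat N (delta_mx k 0)) Phi (hat N a0)) @[r --> 0^'+] -->
    'D_(Z 0) ('D_(hat N (delta_mx k 0)) Phi) (hat N a0).
  exact: (dir_limit _ (@open_box _ _ Omega_open N) Dk_C1 box_a0 r_cvg r_neq0 u0_cvg).
apply: cvg_trans lim; apply: near_eq_cvg; apply: filterS admissible => r r_adm.
have [sol _] := z_sol r_adm; have [[zO _] _ _] := sol (r ^+ 2 * 0).
have /andP[r_gt0 _] := r_adm.
rewrite scalemx_entry; congr (_ * _).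
have -> : 'D_(hat N (delta_mx k 0)) Phi (hat N a0) = 0.
  rewrite -(hat_gradient_entry _ box_a0).
  have := regular_gradient_hat Omega_open g_C2 Gamma a0_Omega a0_crit.
  by move=> /(congr1 trmx); rewrite trmx_mul trmxK trmx0 => ->; rewrite mxE.
by rewrite subr0 addrC -blowupK // (hat_gradient_entry _ zO).
Qed.

Lemma momentum_velocity_cvg : r ^- 2 *: (L *m e r) @[r --> 0^'+] -->
  - Gtot^-1 *: J2 R *m \col_k 'D_(Z 0) ('D_(hat N (delta_mx k 0)) Phi) (hat N a0).
Proof.
apply: (@cvg_trans _ (- Gtot^-1 *: J2 R *m
    (r^-1 *: (hatm^T *m gradient Phi (z r (r ^+ 2 * 0)))) @[r --> 0^'+])).
  apply: near_eq_cvg; apply: filterS admissible => r r_adm.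
  have [sol _] := z_sol r_adm; have /andP[r_gt0 _] := r_adm.
  rewrite /e -[X in derive1 _ X](mulr0 (r ^+ 2)) (solution_velocity Gamma_neq0 sol).
  rewrite -[in RHS]scalemxAr momentum_generator hat_gradient_regular // mulmxN.
  rewrite scalerN scalerN scalerN !scalerA -scalemxAr -scalemxAl scalerA mulrN scaleNr.
  congr (- (_ *: _)).
  by field; rewrite ?Gtot_neq0 ?gt_eqF.
by apply: cvg_mulmx; [exact: cvg_cst|exact: hat_gradient_cvg].
Qed.

Hypothesis P_circle : spectrum_on_circle (map_mx (real_complex R) (P (2 * pi))).
Hypothesis P_four :
  algebraic_multiplicity (map_mx (real_complex R) (P (2 * pi))) 1%R = 4%N.
Hypothesis P_simple : other_multipliers_simple (map_mx (real_complex R) (P (2 * pi))).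

Lemma det_momentum_drift : exists2 k : R, 0 < k & \det B = k * \det h''.
Proof.
exists ((2 * pi * - Gtot) ^+ 2); last by rewrite /B !detZ det_mulmx det_J2; ring.
by rewrite exprn_even_gt0 //= mulf_neq0 // ?oppr_eq0 // gt_eqF.
Qed.

Lemma monodromy_alternative :
  (\det h'' < 0 -> \forall r \near 0^'+,
     ~ spectrum_on_circle (map_mx (real_complex R) (X r (2 * pi)))) /\
  (0 < \det h'' -> \forall r \near 0^'+,
     [/\ spectrum_on_circle (map_mx (real_complex R) (X r (2 * pi))),
       algebraic_multiplicity (map_mx (real_complex R) (X r (2 * pi))) 1%R = 2%N &
       other_multipliers_simple (map_mx (real_complex R) (X r (2 * pi)))]).
Proof.
have nN : (N * 2 = N.*2)%N by rewrite muln2.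
have [P_symp P_det] := plane_symplectic Gamma_neq0 Z_releq P_fund (2 * pi).
have [PD LP] := plane_fixed_hat Gamma_neq0 Z_releq P_fund (2 * pi).
have [Pe eP] := plane_fixed_velocity hN Gamma_neq0 Z_releq P_fund.
have LD : L *m hatm = 1%:M.
  by rewrite /L -scalemxAl hat_vorticity_hat scale_scalar_mx mulVf.
have PD' : (P (2 * pi) - 1%:M) *m hatm = 0 by rewrite mulmxBl PD mul1mx subrr.
have LP' : L *m (P (2 * pi) - 1%:M) = 0.
  by rewrite mulmxBr mulmx1 /L -scalemxAl LP subrr.
have Pe' : (P (2 * pi) - 1%:M) *m derive1 Z 0 = 0 by rewrite mulmxBl Pe mul1mx subrr.
have eP' : (W *m derive1 Z 0)^T *m (P (2 * pi) - 1%:M) = 0.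
  by rewrite mulmxBr mulmx1 eP subrr.
have lD := plane_velocity_hat Z_releq.
have Le : L *m derive1 Z 0 = 0.
  by rewrite /L -scalemxAl (plane_momentum_velocity Z_releq) scaler0.
have e_neq0 : derive1 Z 0 != 0.
  have [_ _ no] := relative_equilibrium_velocity hN Z_releq.
  apply/eqP => Z0; apply: (no 0); rewrite Z0; apply: vortex_inj => j.
  by rewrite vortex_hat; apply/colP => k; rewrite !mxE.
have l_neq0 : (W *m derive1 Z 0)^T != 0.
  rewrite trmx_eq0; apply: contra e_neq0 => /eqP We.
  by apply/eqP/(can_inj (mulKmx W_unit)); rewrite We mulmx0.
have X_prop : \forall r \near 0^'+, [/\ r != 0,
    (X r (2 * pi))^T *m W *m X r (2 * pi) = W /\ \det (X r (2 * pi)) = 1,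
    (X r (2 * pi) - 1%:M) *m e r = 0, (W *m e r)^T *m (X r (2 * pi) - 1%:M) = 0 &
    (W *m e r)^T *m e r = 0].
  exact: filterS rescaled_flow_fixed admissible.
have X_cvg : X r (2 * pi) @[r --> 0^'+] --> P (2 * pi).
  exact: (uniformly_cvg rescaled_flow_cvg two_pi).
have l_cvg : (W *m e r)^T @[r --> 0^'+] --> (W *m derive1 Z 0)^T.
  have We : W *m e r @[r --> 0^'+] --> W *m derive1 Z 0.
    by apply: cvg_mulmx; [exact: cvg_cst|exact: scaled_velocity_cvg].
  apply/cvg_mxP => i j; rewrite [X in _ --> X]mxE.
  have /cvg_mxP/(_ j i) := We.
  by apply: cvg_trans; apply: near_eq_cvg; apply: filterE => r; rewrite [RHS]mxE.
have [k k_gt0 detB] := det_momentum_drift.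
split=> [h_lt0|h_gt0].
  have B_lt0 : \det B < 0 by rewrite detB pmulr_rlt0.
  exact: (spectral_instability (FF := at_right_proper_filter 0) nN W_unit LD P_symp P_det PD' LP' Pe' eP'
    (skew_isotropic W_skew _) lD Le e_neq0 l_neq0 X_prop X_cvg scaled_velocity_cvg l_cvg
    momentum_drift_cvg momentum_velocity_cvg P_circle P_four P_simple B_lt0).
have B_gt0 : 0 < \det B by rewrite detB pmulr_rgt0.
exact: (spectral_stability (FF := at_right_proper_filter 0) nN W_unit LD P_symp P_det PD' LP' Pe' eP'
  (skew_isotropic W_skew _) lD Le e_neq0 l_neq0 X_prop X_cvg scaled_velocity_cvg l_cvg
  momentum_drift_cvg momentum_velocity_cvg P_circle P_four P_simple B_gt0).
Qed.

End LinearizedFlow.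

Lemma monodromy_of_family r (Y : R -> R -> 'M[R]_(N * 2)) :
  fundamental_solution Gamma H (z r) (Y r) ->
  monodromy Gamma H (z r) (2 * pi * r ^+ 2)
    (map_mx (real_complex R) (Y r (r ^+ 2 * (2 * pi)))).
Proof. by move=> Yf; exists (Y r) => //; rewrite [r ^+ 2 * _]mulrC. Qed.

Lemma family_fundamental_solutions : exists Y : R -> R -> 'M[R]_(N * 2),
  forall r, 0 < r < r0 -> fundamental_solution Gamma H (z r) (Y r).
Proof.
suff /choice[Y YP] : forall r, exists X, 0 < r < r0 -> fundamental_solution Gamma H (z r) X.
  by exists Y.
move=> r; have [r_adm|] := pselect (0 < r < r0); last by exists (fun=> 0).
have [sol _] := z_sol r_adm.
have [X Xf] := fundamental_solution_exists Gamma_neq0 H_C2 sol.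
by exists X.
Qed.

Lemma stability_alternative : LRE_stable Gamma Z ->
  (\det h'' < 0 -> \forall r \near 0^'+,
     spectrally_unstable Gamma H (z r) (2 * pi * r ^+ 2)) /\
  (0 < \det h'' -> \forall r \near 0^'+, L_stable Gamma H (z r) (2 * pi * r ^+ 2)).
Proof.
move=> [_ [P P_fund ->] [P_circle _ P_four P_simple]].
have Gtot0 := total_vorticity_neq0 hN Gamma_neq0 Z_releq P_fund P_four.
have [Y Y_fund] := family_fundamental_solutions.
have [unst stab] := monodromy_alternative Y_fund P_fund Gtot0 P_circle P_four P_simple.
split=> [/unst|/stab]; apply: filterS2 admissible => r /Y_fund Yf spec.
  exact: ex_intro2 (monodromy_of_family Yf) spec.
exact: ex_intro2 (monodromy_of_family Yf) spec.
Qed.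

End InducedFamily.

Theorem theorem2p4 (R : realType) (N : nat) (hN : (2 <= N)%N)
    (Omega : set 'cV[R]_2) (Omega_open : open Omega)
    (Omega_connected : connected Omega)
    (Gamma : 'I_N -> R) (Gamma_neq0 : forall j, Gamma j != 0)
    (g : 'cV[R]_2 -> 'cV[R]_2 -> R)
    (g_C4 : Ck_on 4 (Omega `*` Omega) (fun p => g p.1 p.2))
    (g_sym : forall x y, Omega x -> Omega y -> g x y = g y x)
    (a0 : 'cV[R]_2) (a0_Omega : Omega a0)
    (a0_nondeg : nondegenerate_critical_point (robin g) a0)
    (Z : R -> 'cV[R]_(N * 2)) (Z_releq : relative_equilibrium Gamma Z)
    (Z_stable : LRE_stable Gamma Z)
    (r0 : R) (z : R -> R -> 'cV[R]_(N * 2))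
    (z_induced : induced_family 4 Gamma Omega g a0 Z r0 z) :
  (saddle_point (robin g) a0 ->
     \forall r \near 0^'+,
       spectrally_unstable Gamma (hamiltonian Gamma g) (z r)
         (2 * pi * r ^+ 2)) /\
  (local_minimum (robin g) a0 \/ local_maximum (robin g) a0 ->
     \forall r \near 0^'+,
       L_stable Gamma (hamiltonian Gamma g) (z r) (2 * pi * r ^+ 2)).
Proof.
have g_C2 : Ck_on 2 (Omega `*` Omega) (fun p => g p.1 p.2) by apply: Ck_on_le g_C4.
have [a0_crit a0_det] := a0_nondeg.
have [r0_gt0 [z_sol [z_asymp _]]] := z_induced.
have [unst stab] := stability_alternative hN Omega_open Gamma_neq0 g_C2 g_sym a0_Omega
  a0_crit Z_releq r0_gt0 z_sol z_asymp Z_stable.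
have robin_C2 := robin_smooth g_C2.
split=> [saddle|extremum].
  by apply: unst; exact: (saddle_det_lt0 Omega_open robin_C2 a0_Omega a0_crit).
by apply: stab; exact: (local_extremum_det_gt0 Omega_open robin_C2 a0_Omega a0_crit).
Qed.
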